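(* Let $\lambda$ and $h$ be nonnegative Borel measurable bounded functions on $\mathcal X$ with $h(0,0)=0$, and let $(X_t,\,t\ge 0)$ be the associated single-server queueing process (as defined in the context). Then for every nonrandom initial state $X\in\mathcal X$, every $t>0$ and every $f\in C^1_b(\mathcal X)$, $$E_Xf(X_t)-f(X)=E_X\int_0^t \mathcal G f(X_s)\,ds,$$ and for every nonrandom initial state $X\in\mathcal X$, every $t>0$ and every $\varphi\in C^1_b([0,\infty)\times\mathcal X)$, $$E_X\varphi(t,X_t)-\varphi(0,X)=E_X\int_0^t\left(\frac{\partial}{\partial s}\varphi(s,X_s)+\mathcal G\varphi(s,X_s)\right)ds.$$ Moreover, the process $(X_t,\,t\ge 0)$ is strong Markov with respect to the filtration $(\mathcal F^X_t,\,t\ge 0)$.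
   Context: State space: $\mathcal X=\{(0,0)\}\cup\{(n,x): n=1,2,\ldots,\ x\ge 0\}$ with the metric $\mathrm{dist}((n,x),(n',x'))=|n-n'|+|x-x'|$. Here $n$ is the number of customers in the system and $x$ is the elapsed time of the current service. The arrival intensity $\lambda:\mathcal X\to[0,\infty)$ and the service intensity $h:\mathcal X\to[0,\infty)$ are given functions, with $h(0,0)=0$. Notation: for $X=(n,x)$ with $n\ge1$ and $s\ge0$, $X+s:=(n,x+s)$, and $(0,0)+s:=(0,0)$. For $X=(n,x)\in\mathcal X$, $X^+:=(n+1,x)$ and $X^-:=((n-1)\vee 0,0)$. The process: $(X_t=(n_t,x_t),\,t\ge 0)$ is the right-continuous (with left limits) piecewise deterministic Markov process on $\mathcal X$ constructed as follows. Between jumps the evolution is deterministic: from state $X$, after time $s$ without jumps the state is $X+s$. Given the present state $X$, two conditionally independent candidate waiting times are realised: one for a jump up (arrival), with density $z\mapsto\lambda(X+z)\exp(-\int_0^z\lambda(X+s)\,ds)$ on $z\ge0$, and one for a jump down (end of service), with density $z\mapsto h(X+z)\exp(-\int_0^z h(X+s)\,ds)$ on $z\ge 0$ (either may be $+\infty$ with the remaining probability). The smaller of the two determines the time and type of the next jump: a jump up moves the current state $Y$ to $Y^+$, a jump down moves the current state $Y$ to $Y^-$; then the procedure restarts independently from the new state. In particular the conditional probability given $X_t$ of no jumps during a time interval of length $\Delta$ after $t$ is $\exp(-\int_0^\Delta(\lambda+h)(X_t+s)\,ds)$. Since $\lambda,h$ are bounded, there are a.s. finitely many jumps on bounded time intervals.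 $P_X$, $E_X$ denote probability and expectation for the process started from the nonrandom state $X$, and $\mathcal F^X_t=\sigma(X_s: s\le t)$. Operator: $\mathcal G f(X):=\frac{\partial}{\partial x}f(X)+\lambda(X)(f(X^+)-f(X))+h(X)(f(X^-)-f(X))$, where the term $\frac{\partial}{\partial x}f$ is understood as $0$ at the state $(0,0)$ (where there is no variable $x$). For functions $\varphi(s,X)$, $\mathcal G$ acts in the variable $X$. Function classes: $C^1_b(\mathcal X)$ is the set of bounded functions on $\mathcal X$ with a bounded continuous derivative in $x$; $C^1_b([0,\infty)\times\mathcal X)$ is the set of bounded functions $\varphi(t,X)$ that are continuously differentiable in $(t,x)$ with bounded derivatives. *)

(* Defs.v *)
From HB Require Import structures.
From mathcomp Require Import all_boot all_order all_algebra.
From mathcomp Require Import all_classical all_reals all_analysis.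
From mathcomp Require Import measurable_realfun.

Set Implicit Arguments.
Unset Strict Implicit.
Unset Printing Implicit Defensive.

Import Order.TTheory GRing.Theory Num.Theory.
Import numFieldNormedType.Exports.

Local Open Scope classical_set_scope.
Local Open Scope ring_scope.

(* States (n, x) live in the ambient type nat * R, whose product topology and
   product sigma-algebra are those of the metric |n - n'| + |x - x'|; functions
   of the state are total on nat * R, and only their values on the closed set
   [statespace] matter. *)
Definition statespace {R : realType} : set (nat * R) :=
  [set y | 0 <= y.2 /\ (y.1 = 0%N -> y.2 = 0)].

Section flow.
Context {R : realType}.
Implicit Type y : nat * R.

Definition shift y (s : R) : nat * R :=
  if y.1 == 0%N then y else (y.1, y.2 + s).

Definition up y : nat * R := (y.1.+1, y.2).

Definition down y : nat * R := (y.1.-1, 0).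

End flow.

Section test_functions.
Context {R : realType}.
Implicit Types (g : R -> R) (f : nat * R -> R) (phi : R -> nat * R -> R).

(* Derivatives of functions on the half-line [0, +oo[: the difference quotient
   is restricted to the half-line, hence one-sided at 0. *)
Definition half_quotient g (x : R) : set_system R :=
  (g u - g x) / (u - x) @[u --> within `[0, +oo[ x^'].

Definition half_derivable g (x : R) : Prop := cvg (half_quotient g x).

Definition half_derive g (x : R) : R := lim (half_quotient g x).

Definition derive_x f (y : nat * R) : R :=
  if y.1 == 0%N then 0 else half_derive (fun x => f (y.1, x)) y.2.

Definition derivable_x f (y : nat * R) : Prop :=
  y.1 <> 0%N -> half_derivable (fun x => f (y.1, x)) y.2.

Definition derive_t phi (t : R) (y : nat * R) : R :=
  half_derive (fun s => phi s y) t.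

Definition derivable_t phi (t : R) (y : nat * R) : Prop :=
  half_derivable (fun s => phi s y) t.

Definition C1b f : Prop :=
  [/\ [bounded f y | y in statespace],
      forall y, statespace y -> derivable_x f y,
      {within statespace, continuous (derive_x f)}
    & [bounded derive_x f y | y in statespace]].

Definition time_statespace : set (R * (nat * R)) :=
  [set p | 0 <= p.1 /\ statespace p.2].

Definition C1b_time phi : Prop :=
  [/\ [bounded phi p.1 p.2 | p in time_statespace],
      forall (t : R) y, 0 <= t -> statespace y ->
        derivable_t phi t y /\ derivable_x (phi t) y,
      {within time_statespace, continuous (fun p => derive_t phi p.1 p.2)} /\
      {within time_statespace, continuous (fun p => derive_x (phi p.1) p.2)}
    & [bounded derive_t phi p.1 p.2 | p in time_statespace] /\
      [bounded derive_x (phi p.1) p.2 | p in time_statespace]].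

Definition generator (lam h : nat * R -> R) f (y : nat * R) : R :=
  derive_x f y + lam y * (f (up y) - f y) + h y * (f (down y) - f y).

End test_functions.

Section waiting_time.
Context {R : realType}.
Variable g : nat * R -> R.

Definition wait_density (y : nat * R) (z : R) : R :=
  g (shift y z) *
  expR (- \int[lebesgue_measure]_(s in `[0, z]) g (shift y s)).

(* Law on [0, +oo] of the candidate waiting time with intensity g from state y;
   the mass missing from the density sits at +oo. *)
Definition wait_law (y : nat * R) (A : set (\bar R)) : \bar R :=
  (\int[lebesgue_measure]_(z in `[0%R, +oo[ `&` [set z : R | A z%:E])
      (wait_density y z)%:E
   + (1 - \int[lebesgue_measure]_(z in `[0%R, +oo[) (wait_density y z)%:E)
     * (\1_A (+oo%E : \bar R))%:E)%E.

End waiting_time.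

(* g is a version of the conditional probability P(E | F), where F is the
   sigma-algebra given by its members. *)
Definition is_cond_prob {R : realType} {d : measure_display}
    {Omega : measurableType d} (P : probability Omega R)
    (F : set (set Omega)) (E : set Omega) (g : Omega -> \bar R) : Prop :=
  [/\ measurable E,
      forall B : set (\bar R), measurable B -> F (g @^-1` B)
    & forall G, F G -> P (G `&` E) = \int[P]_(w in G) g w]%E.

Section jumps.
Context {R : realType}.
Variables (x : nat * R) (u v : nat -> \bar R).

(* The state after one step from y with candidate waiting times a (up) and
   b (down). If both are +oo there is no further jump and the value is
   immaterial; ties a = b < +oo have probability 0. *)
Definition next_state (y : nat * R) (a b : \bar R) : nat * R :=
  if (mine a b == +oo)%E then y
  else if (a < b)%E then up (shift y (fine a)) else down (shift y (fine b)).

Fixpoint jump_state (k : nat) : nat * R :=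
  if k is j.+1 then next_state (jump_state j) (u j) (v j) else x.

(* With [jump_time 0 = 0], the time of the k-th jump, +oo if there are fewer
   than k jumps. *)
Definition jump_time (k : nat) : \bar R :=
  (\sum_(j < k) mine (u j) (v j))%E.

Definition follows_jumps (p : R -> nat * R) : Prop :=
  forall (k : nat) (t : R),
    (jump_time k <= t%:E < jump_time k.+1)%E ->
    p t = shift (jump_state k) (t - fine (jump_time k)).

End jumps.

Section process.
Context {R : realType} {d : measure_display} {Omega : measurableType d}.
Implicit Types (P : probability Omega R) (X : R -> Omega -> nat * R).

(* sigma-algebra of the candidate waiting times drawn before the k-th step. *)
Definition past (U V : nat -> Omega -> \bar R) (k : nat) : set (set Omega) :=
  <<s [set E | exists j (B : set (\bar R)),
         [/\ (j < k)%N, measurable B & E = U j @^-1` B \/ E = V j @^-1` B]] >>.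

(* Under P, the process X is the one constructed from the initial state x:
   U k and V k are the candidate waiting times (up and down) drawn after the
   k-th jump. Given the past they are conditionally independent, with the
   waiting-time laws from the state reached at the k-th jump. *)
Definition constructed_from (lam h : nat * R -> R) P X (x : nat * R) : Prop :=
  exists U V : nat -> Omega -> \bar R,
  [/\ forall k, measurable_fun setT (U k) /\ measurable_fun setT (V k),
      forall k w, (0 <= U k w)%E /\ (0 <= V k w)%E,
      forall k (A B : set (\bar R)), measurable A -> measurable B ->
        is_cond_prob P (past U V k) (U k @^-1` A `&` V k @^-1` B)
          (fun w => let y := jump_state x (U ^~ w) (V ^~ w) k in
             wait_law lam y A * wait_law h y B)%E
    & {ae P, forall w, follows_jumps x (U ^~ w) (V ^~ w) (X ^~ w)}].

(* The single-server queue with arrival intensity lam and service intensity h: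
   one process X with right-continuous paths with left limits in the state
   space, and one probability P x for each nonrandom initial state x. *)
Definition queue_process (lam h : nat * R -> R)
    (P : nat * R -> probability Omega R) X : Prop :=
  [/\ forall t : R, 0 <= t -> measurable_fun setT (X t),
      forall (t : R) w, 0 <= t -> statespace (X t w),
      forall (t : R) w, 0 <= t -> X s w @[s --> t^'+] --> X t w,
      forall (t : R) w, 0 < t -> exists l : nat * R, X s w @[s --> t^'-] --> l
    & forall x, statespace x -> constructed_from lam h (P x) X x].

Definition generated_by (I : set R) X : set (set Omega) :=
  <<s [set E | exists s (A : set (nat * R)),
         [/\ I s, measurable A & E = X s @^-1` A]] >>.

Definition natural_filtration X (t : R) : set (set Omega) :=
  generated_by `[0, t] X.

Definition stopping_time (F : R -> set (set Omega)) (tau : Omega -> \bar R) :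
    Prop :=
  (forall w, 0 <= tau w)%E /\
  forall t : R, 0 <= t -> F t [set w | tau w <= t%:E]%E.

Definition stopped_sigma_algebra X (tau : Omega -> \bar R) : set (set Omega) :=
  [set E | generated_by `[0, +oo[ X E /\
           forall t : R, 0 <= t ->
             natural_filtration X t (E `&` [set w | tau w <= t%:E]%E)].

(* Time-homogeneous strong Markov property, with transition function
   P_s(y, A) = P_y(X_s \in A): for every stopping time tau, on {tau < +oo},
   P_x(X_(tau + s) \in A | F_tau) = P_s(X_tau, A). *)
Definition strong_markov (P : nat * R -> probability Omega R) X : Prop :=
  (forall (s : R) (A : set (nat * R)), 0 <= s -> measurable A ->
     measurable_fun statespace (fun y => P y (X s @^-1` A))) /\
  (forall x tau (s : R) (A : set (nat * R)),
     statespace x -> stopping_time (natural_filtration X) tau ->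
     0 <= s -> measurable A ->
     is_cond_prob (P x) (stopped_sigma_algebra X tau)
       [set w | (tau w < +oo)%E /\ A (X (fine (tau w) + s) w)]
       (fun w => if (tau w < +oo)%E
                 then P (X (fine (tau w)) w) (X s @^-1` A) else 0%E)).

End process.

(* Main.v *)
Require Import Defs.
From HB Require Import structures.
From mathcomp Require Import all_boot all_order all_algebra.
From mathcomp Require Import all_classical all_reals all_analysis.
From mathcomp Require Import measurable_realfun.
From mathcomp Require Import ring lra.
Set Implicit Arguments.
Unset Strict Implicit.
Unset Printing Implicit Defensive.
Import Order.TTheory GRing.Theory Num.Theory.
Import numFieldNormedType.Exports.
Local Open Scope classical_set_scope.
Local Open Scope ring_scope.
Import Defs.

(** The process follows the flow [shift] between the jumps of a chain, so its law is obtained by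
    conditioning on the first jump. For a nonnegative measurable [f], the mean of [f] at time s
    from the state y solves the renewal equation [v = renewal v]: either there is no jump before
    s, or the first jump, at time z, leaves the time s - z from the new state. Iterating this
    equation from 0 gives the means restricted to fewer than k jumps ([expect_upto]); they increase
    to a solution, called [transition]. With intensities at most C, each step lasts longer than t
    with probability at least exp(-2Ct), so the jumps do not accumulate ([nonexplosion]), no mass is
    lost in the limit, and E_x f(X_s) is [transition f (s, x)]. The conditional independence of
    the two candidate times enters through [freezing], which integrates functions of the past and
    of the two times.

    The Markov property at a fixed time t ([markov]) is the same computation started after the last
    jump before t: while the j-th jump is the last one, the path up to t is determined by the first
    j steps of the chain, and the renewal equation can be cut at t ([renewal_shift]).

    For the strong Markov property, tau is approximated from above by grid times, which take
    countably many values, and the Markov property is summed over the cells of the grid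
    ([markov_at_grid]). The passage to the limit needs right-continuity of the indicator of A along
    the paths, and of P_s(y, A) in y along the flow. Both hold for A = {n} x [a, +oo[: almost every
    path follows the flow right after each time, and P_s(shift y d, A) differs by O(d) from the mean
    of P_s(X_d, A) under P_y, that is, from P_y(X_(d + s) in A) ([transition_cvg_flow]). Such sets
    generate the sigma-algebra and are stable under intersection, which gives every A.

    For Dynkin's formula the intensities are only measurable, so E_x phi(t, X_t) need not be
    differentiable in t. Instead, let D(t) be this mean minus the integral over [0, t] of the mean
    of (d/ds + G) phi. Over an interval of length s at most one jump matters, and the increment of D
    is O(s^2), uniformly ([dynkin_local]). Such a function is constant
    ([quadratic_increments_const]). The smoothness of phi is used only to write phi along the flow
    as the integral of its derivatives in time and age ([flow_FTC]), and to get measurability.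

    The process never sees the intensities outside the state space, so they may be extended by 0
    ([queue_process_ext]) and treated as bounded measurable functions on the whole type. *)

(** * Lebesgue integrals of bounded functions over segments *)

Section segment_integrals.
Context {R : realType}.
Notation mu := (@lebesgue_measure R).
Implicit Types (g : R -> R) (a b c M K T : R).

(** Cutting [0, T] into [n] equal pieces bounds the total increment by [K * T ^+ 2 / n]. This
    replaces differentiation where the intensities are only measurable. *)
Lemma quadratic_increments_const g K T : 0 <= T ->
  (forall a b, 0 <= a -> a <= b -> b <= T -> `|g b - g a| <= K * (b - a) ^+ 2) ->
  g T = g 0.
Proof.
move=> T0 gK.
have K0 : 0 <= K * T ^+ 2.
  by have := gK 0 T (lexx _) T0 (lexx _); rewrite subr0; exact: le_trans.
have step (n k : nat) : (k <= n.+1)%N ->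
    `|g (k%:R * (T / n.+1%:R)) - g 0| <= k%:R * (K * (T / n.+1%:R) ^+ 2).
  set h := T / n.+1%:R; have h0 : 0 <= h by rewrite divr_ge0.
  have nh : n.+1%:R * h = T by rewrite mulrC divfK.
  elim: k => [|k IH] kn; first by rewrite !mul0r subrr normr0.
  have e1 : k.+1%:R * h = k%:R * h + h by rewrite -natr1 mulrDl mul1r.
  have e2 : k.+1%:R * h <= T by rewrite -nh ler_wpM2r// ler_nat.
  apply: le_trans (ler_distD (g (k%:R * h)) _ _) _.
  have -> : k.+1%:R * (K * h ^+ 2) = K * h ^+ 2 + k%:R * (K * h ^+ 2).
    by rewrite -natr1 mulrDl mul1r addrC.
  apply: lerD; last by apply: IH; exact: ltnW.
  have := gK (k%:R * h) (k.+1%:R * h).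
  rewrite (_ : k.+1%:R * h - k%:R * h = h); last by rewrite e1; lra.
  apply => //; first by rewrite mulr_ge0.
  by rewrite e1 lerDl.
apply/eqP; rewrite -subr_eq0 -normr_le0; apply/ler_addgt0Pl => e e0.
rewrite addr0.
have [n Hn] : exists n : nat, K * T ^+ 2 / e < n.+1%:R.
  exists (Num.bound (K * T ^+ 2 / e)).
  apply: lt_trans (archi_boundP _) _; first by rewrite divr_ge0// ltW.
  by rewrite ltr_nat.
have := step n n.+1 (leqnn _).
rewrite mulrCA divff ?mulr1 ?pnatr_eq0// => /le_trans; apply.
rewrite expr_div_n.
rewrite ltr_pdivrMr// in Hn.
have n0 : (0 : R) < n.+1%:R by [].
have -> : n.+1%:R * (K * (T ^+ 2 / n.+1%:R ^+ 2)) = K * T ^+ 2 / n.+1%:R.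
  by field; rewrite lt0r_neq0.
rewrite ler_pdivrMr//; apply: ltW; rewrite [ltRHS]mulrC; exact: Hn.
Qed.

Lemma segment_lty a b : (mu `[a, b] < +oo)%E.
Proof.
by rewrite /= lebesgue_measure_itv /=; case: ifP => // _; rewrite -EFinB ltry.
Qed.

Lemma bounded_integrable_segment g M a b : measurable_fun setT g ->
  (forall x, a <= x <= b -> `|g x| <= M) -> mu.-integrable `[a, b] (EFin \o g).
Proof.
move=> mg gM; apply: measurable_bounded_integrable => //.
- exact: segment_lty.
- exact: measurable_funTS.
- exists M; split; first by rewrite num_real.
  move=> N MN x /= /[!in_itv]/= xab; apply: le_trans (gM _ xab) _; exact: ltW.
Qed.

Lemma le_normr_segment g M a b : a <= b -> measurable_fun setT g ->
  (forall x, a <= x <= b -> `|g x| <= M) ->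
  `|\int[mu]_(x in `[a, b]) g x| <= M * (b - a).
Proof.
move=> ab mg gM.
have ig := bounded_integrable_segment mg gM.
apply: (le_trans (le_normr_Rintegral _ ig)) => //.
have -> : M * (b - a) = \int[mu]_(x in `[a, b]) cst M x.
  rewrite Rintegral_cst//= lebesgue_measure_itv /= lte_fin.
  by case: ltP ab => // ba ab; rewrite (le_anti (_ : a <= b <= a)) ?subrr// ab.
apply: le_Rintegral => //.
- apply: (@bounded_integrable_segment (fun x => `|g x|) M) => [|x /gM].
    exact: measurableT_comp.
  by rewrite normr_id.
- by apply: (@bounded_integrable_segment (cst M) `|M|).
Qed.

Lemma Rintegral_segmentD g M a b c : a <= b -> b <= c ->
  measurable_fun setT g -> (forall x, a <= x <= c -> `|g x| <= M) ->
  \int[mu]_(x in `[a, c]) g x =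
  \int[mu]_(x in `[a, b]) g x + \int[mu]_(x in `[b, c]) g x.
Proof.
move=> ab bc mg gM.
have ig := bounded_integrable_segment mg gM.
rewrite -(@Rintegral_itv_obnd_cbnd _ b (BRight c)); last first.
  apply: integrableS ig => //.
  by apply: subset_itv; rewrite ?bnd_simp//.
by rewrite -(@Rintegral_itvB _ g (BLeft a) (BRight c) b)// ?bnd_simp// addrC subrK.
Qed.

Lemma lebesgue_measure_translate c (A : set R) : measurable A ->
  pushforward mu (fun x => c + x : measurableTypeR R) A = mu A.
Proof.
have mc : measurable_fun setT (fun x : measurableTypeR R => c + x : measurableTypeR R).
  exact: measurable_funD.
move=> mA; apply/esym/lebesgue_measure_unique => //= _ [[a b]] _ <-.
rewrite /pushforward/=.
rewrite (_ : _ @^-1` _ = `](a - c), (b - c)]%classic); last first.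
  by apply/seteqP; split => x /=; rewrite !in_itv/= ltrBlDl lerBrDl.
rewrite !lebesgue_measure_itv/= !lte_fin ltrD2r.
by case: ifP => // _; rewrite -!EFinB; congr EFin; lra.
Qed.

Lemma ge0_integral_translate (f : R -> \bar R) c a b : measurable_fun setT f ->
  (forall x, (0 <= f x)%E) ->
  (\int[mu]_(x in `[(c + a)%R, (c + b)%R]) f x = \int[mu]_(x in `[a, b]) f (c + x)%R)%E.
Proof.
move=> mf f0.
have mc : measurable_fun setT (fun x : measurableTypeR R => c + x : measurableTypeR R).
  exact: measurable_funD.
transitivity (\int[pushforward mu (fun x => c + x : measurableTypeR R)%R]_(x in `[(c + a)%R, (c + b)%R]) f x)%E.
  by apply: eq_measure_integral => A mA _; exact/esym/lebesgue_measure_translate.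
rewrite ge0_integral_pushforward//; last exact: measurable_funTS.
congr integral.
by apply/seteqP; split => x /=; rewrite !in_itv/= !lerD2l.
Qed.

Lemma Rintegral_translate g c a b : measurable_fun setT g ->
  \int[mu]_(x in `[c + a, c + b]) g x = \int[mu]_(x in `[a, b]) g (c + x).
Proof.
move=> mg; rewrite /Rintegral; congr fine.
have mc : measurable_fun setT (fun x : R => c + x) by exact: measurable_funD.
rewrite integralE [in RHS]integralE; congr (_ - _)%E.
- rewrite ge0_integral_translate//.
    by apply: eq_integral => x _; rewrite unlock.
  by apply: measurable_funepos; exact/measurable_EFinP.
- rewrite ge0_integral_translate//.
    by apply: eq_integral => x _; rewrite unlock.
  by apply: measurable_funeneg; exact/measurable_EFinP.
Qed.

End segment_integrals.

(** * Measurability of the flow and of parametrised integrals *)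

Ltac mfun_base := first
  [ exact: measurable_cst | exact: measurable_id
  | exact: measurable_fst | exact: measurable_snd | eassumption ].
Ltac mfun := repeat (first
  [ mfun_base
  | apply: measurable_fun_pair
  | apply: (iffRL (measurable_EFinP _ _))
  | apply: measurable_and | apply: measurable_or | apply: measurable_neg
  | apply: measurable_fun_ler | apply: measurable_fun_ltr
  | apply: measurable_fun_eqn
  | apply: measurable_funD | apply: measurable_funB | apply: measurable_funM
  | apply: measurable_funN
  | apply: measurable_fun_ifT
  | apply: (measurableT_comp measurable_fst)
  | apply: (measurableT_comp measurable_snd) ]).

Section flow_measurability.
Context {R : realType}.
Implicit Types (y : nat * R) (a b s : R).

Lemma shift0 y : shift y 0 = y.
Proof. by rewrite /shift addr0; case: ifP => //; case: y. Qed.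

Lemma shift_shift y a b : shift (shift y a) b = shift y (a + b).
Proof.
by case: y => -[|n] x; rewrite /shift//= addrA.
Qed.

Lemma statespace_shift y s : statespace y -> 0 <= s -> statespace (shift y s).
Proof.
move=> [y0 yn] s0; rewrite /shift; case: ifPn => // n0; split => /=.
  by rewrite addr_ge0.
by move/eqP: n0.
Qed.

Lemma statespace_up y : statespace y -> statespace (up y).
Proof. by case. Qed.

Lemma statespace_down y : statespace (down y).
Proof. by split => /=. Qed.

Lemma measurable_shift :
  measurable_fun setT (fun p : (nat * R) * R => shift p.1 p.2).
Proof. by rewrite /shift; mfun. Qed.

Lemma measurable_up : measurable_fun setT (@up R).
Proof.
apply: measurable_fun_pair; last by mfun.
by apply: (measurableT_comp _ measurable_fst).
Qed.

Lemma measurable_down : measurable_fun setT (@down R).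
Proof.
apply: measurable_fun_pair; last by mfun.
by apply: (measurableT_comp _ measurable_fst).
Qed.

Lemma measurable_statespace : measurable (@statespace R).
Proof.
have -> : @statespace R =
    setT `&` (fun y : nat * R => (0 <= y.2) && ((y.1 == 0%N) ==> (y.2 == 0))) @^-1` [set true].
  apply/seteqP; split => y /=.
    move=> [-> /= h]; split => //; apply/implyP => /eqP /h ->; exact: eqxx.
  by move=> [_ /andP[y0 /implyP h]]; split => // /eqP /h /eqP.
suff : measurable_fun setT (fun y : nat * R => (0 <= y.2) && ((y.1 == 0%N) ==> (y.2 == 0))).
  by apply.
apply: measurable_and; first by mfun.
rewrite [X in measurable_fun _ X](_ : _ = fun y => ~~ (y.1 == 0%N) || (y.2 == 0)); last first.
  by apply/funext => y; rewrite implybE.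
apply: measurable_or; first by mfun.
by apply: measurable_fun_eqr; mfun.
Qed.

End flow_measurability.

Section parametric_integrals.
Context {R : realType}.
Notation mu := (@lebesgue_measure R).
Context {d : measure_display} {T : measurableType d}.

(** Tonelli's theorem, with the varying domain moved into the integrand. *)
Lemma measurable_fun_integral_pred (p : T * R -> bool) (F : T * R -> \bar R) :
  measurable_fun setT p -> measurable_fun setT F -> (forall z, 0 <= F z)%E ->
  measurable_fun setT (fun t => \int[mu]_(s in [set s | p (t, s)]) F (t, s))%E.
Proof.
move=> mp mF F0.
pose G z : \bar R := if p z then F z else 0%E.
have mG : measurable_fun setT G by apply: measurable_fun_ifT => //; exact: measurable_cst.
have G0 z : (0 <= G z)%E by rewrite /G; case: ifP.
have := @measurable_fun_fubini_tonelli_F _ _ _ _ _ mu G mG G0.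
congr measurable_fun; apply/funext => t; rewrite /fubini_F [RHS]integral_mkcond.
apply: eq_integral => s _; rewrite /patch /G.
case: ifPn => pts; first by rewrite mem_set.
by rewrite memNset//=; exact/negP.
Qed.

Lemma measurable_fun_integral_segment (a b : T -> R) (F : T * R -> \bar R) :
  measurable_fun setT a -> measurable_fun setT b ->
  measurable_fun setT F -> (forall z, 0 <= F z)%E ->
  measurable_fun setT (fun t => \int[mu]_(s in `[a t, b t]) F (t, s))%E.
Proof.
move=> ma mb mF F0.
have mp : measurable_fun setT (fun z : T * R => (a z.1 <= z.2) && (z.2 <= b z.1)).
  apply: measurable_and; apply: measurable_fun_ler; mfun.
    by apply: (measurableT_comp ma); mfun.
  by apply: (measurableT_comp mb); mfun.
have := measurable_fun_integral_pred mp mF F0.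
by congr measurable_fun; apply/funext => t; congr integral;
  apply/seteqP; split => s /=; rewrite in_itv.
Qed.

Lemma measurable_fun_integral_halfline (F : T * R -> \bar R) :
  measurable_fun setT F -> (forall z, 0 <= F z)%E ->
  measurable_fun setT (fun t => \int[mu]_(s in `[0%R, +oo[) F (t, s))%E.
Proof.
move=> mF F0.
have mp : measurable_fun setT (fun z : T * R => 0 <= z.2).
  by apply: measurable_fun_ler; mfun.
have := measurable_fun_integral_pred mp mF F0.
congr measurable_fun; apply/funext => t; congr integral.
by apply/seteqP; split => s /=; rewrite in_itv/= andbT.
Qed.

Lemma measurable_fun_Rintegral_segment (a b : T -> R) (F : T * R -> R) :
  measurable_fun setT a -> measurable_fun setT b ->
  measurable_fun setT F -> (forall z, 0 <= F z) ->
  measurable_fun setT (fun t => \int[mu]_(s in `[a t, b t]) F (t, s)).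
Proof.
move=> ma mb mF F0; rewrite /Rintegral.
apply: measurableT_comp; first exact: fine_measurable.
apply: (measurable_fun_integral_segment ma mb (F := EFin \o F)) => //.
exact/measurable_EFinP.
Qed.

End parametric_integrals.

(** * Survival functions of the waiting times *)

Record bounded_intensity {R : realType} (C : R) (g : nat * R -> R) : Prop := BoundedIntensity {
  intensity_meas : measurable_fun setT g ;
  intensity_ge0 : forall y, 0 <= g y ;
  intensity_le : forall y, g y <= C }.

Section survival.
Context {R : realType}.
Notation mu := (@lebesgue_measure R).
Variables (g : nat * R -> R) (C : R).
Hypothesis Ig : bounded_intensity C g.
Let mg := intensity_meas Ig. Let g0 := intensity_ge0 Ig. Let gC := intensity_le Ig.
Implicit Types (y : nat * R) (r z : R).

Definition hazard y z := \int[mu]_(s in `[0, z]) g (shift y s).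

Definition survival y z := expR (- hazard y z).

Lemma measurable_along_flow y : measurable_fun setT (fun s => g (shift y s)).
Proof.
apply: (measurableT_comp mg).
by apply: (measurableT_comp measurable_shift (g := fun s => (y, s))); mfun.
Qed.

Let gbound y z : `|g (shift y z)| <= C.
Proof. by rewrite ger0_norm. Qed.

Let C0 : 0 <= C. Proof. exact: le_trans (g0 (0%N, 0)) (gC _). Qed.

Lemma hazard_ge0 y z : 0 <= hazard y z.
Proof. by apply: Rintegral_ge0. Qed.

Lemma hazard_le y z : 0 <= z -> hazard y z <= C * z.
Proof.
move=> z0; apply: le_trans (ler_norm _) _.
rewrite -[z in leRHS]subr0; apply: le_normr_segment => // .
exact: measurable_along_flow.
Qed.

Lemma hazardD y a b : 0 <= a -> 0 <= b ->
  hazard y (a + b) = hazard y a + hazard (shift y a) b.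
Proof.
move=> a0 b0; rewrite /hazard (@Rintegral_segmentD _ _ C 0 a)//; last 2 first.
- by rewrite lerDl.
- exact: measurable_along_flow.
congr (_ + _); rewrite -{1}[a]addr0 Rintegral_translate; last exact: measurable_along_flow.
by apply: eq_Rintegral => s _; rewrite shift_shift.
Qed.

Lemma survival_gt0 y z : 0 < survival y z.
Proof. exact: expR_gt0. Qed.

Lemma survival_le1 y z : survival y z <= 1.
Proof. by rewrite -expR0 ler_expR oppr_le0 hazard_ge0. Qed.

Lemma survival_ge_expR y z : 0 <= z -> expR (- (C * z)) <= survival y z.
Proof. by move=> z0; rewrite ler_expR lerN2 hazard_le. Qed.

Lemma survival_ge y z : 0 <= z -> 1 - C * z <= survival y z.
Proof.
move=> z0; apply: le_trans (survival_ge_expR y z0).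
exact: expR_ge1Dx.
Qed.

Lemma survivalD y a b : 0 <= a -> 0 <= b ->
  survival y (a + b) = survival y a * survival (shift y a) b.
Proof. by move=> a0 b0; rewrite /survival hazardD// opprD expRD. Qed.

Lemma survival0 y : survival y 0 = 1.
Proof. by rewrite /survival /hazard set_itv1 Rintegral_set1 oppr0 expR0. Qed.

Lemma measurable_survival :
  measurable_fun setT (fun p : (nat * R) * R => survival p.1 p.2).
Proof.
apply: measurableT_comp; first exact: measurable_expR.
apply: measurable_funN.
apply: (measurable_fun_Rintegral_segment (a := cst 0) (b := snd)
  (F := fun q : ((nat * R) * R) * R => g (shift q.1.1 q.2))) => //.
apply: (measurableT_comp mg).
apply: (measurableT_comp measurable_shift (g := fun q : ((nat * R) * R) * R => (q.1.1, q.2))).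
mfun.
Qed.

Lemma measurable_wait_density :
  measurable_fun setT (fun p : (nat * R) * R => wait_density g p.1 p.2).
Proof.
apply: measurable_funM; last exact: measurable_survival.
exact: (measurableT_comp mg measurable_shift).
Qed.

Lemma wait_densityE y z : wait_density g y z = g (shift y z) * survival y z.
Proof. by []. Qed.

Lemma wait_density_ge0 y z : 0 <= wait_density g y z.
Proof. by rewrite wait_densityE mulr_ge0// ltW// survival_gt0. Qed.

Lemma wait_density_le y z : wait_density g y z <= C.
Proof.
by rewrite wait_densityE -[leRHS]mulr1 ler_pM// ?survival_le1// ltW// survival_gt0.
Qed.

Let expR_le1 (x : R) : 0 <= x -> `|expR (- x) - 1 + x| <= x ^+ 2.
Proof.
move=> x0; have h1 := expR_ge1Dx (- x); have h2 := expR_ge1Dx x.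
have e : expR (- x) * expR x = 1 by rewrite -expRD addNr expR0.
have p1 := expR_gt0 (- x); have p2 := expR_gt0 x.
rewrite ger0_norm; last lra.
nra.
Qed.

(** The density need not be continuous, so [survival] need not be differentiable; but the
    increments of the sum of [survival] and of the integral of the density are quadratic in the
    length of the interval, hence this sum is constant. *)
Lemma Rintegral_wait_density y r : 0 <= r ->
  \int[mu]_(z in `[0, r]) wait_density g y z = 1 - survival y r.
Proof.
move=> r0.
have md : measurable_fun setT (wait_density g y).
  exact: (measurable_fun_pair2 y measurable_wait_density).
have db z : `|wait_density g y z| <= C.
  by rewrite ger0_norm ?wait_density_ge0// wait_density_le.
pose F z := survival y z + \int[mu]_(s in `[0, z]) wait_density g y s.
suff : F r = F 0.
  rewrite /F survival0 set_itv1 Rintegral_set1 addr0 => <-; lra.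
apply: (@quadratic_increments_const _ _ (2 * C ^+ 2)) => // a b a0 ab _.
have dab : 0 <= b - a by rewrite subr_ge0.
pose v := hazard (shift y a) (b - a).
have v0 : 0 <= v by exact: hazard_ge0.
have vC : v <= C * (b - a) by exact: hazard_le.
have Sb : survival y b = survival y a * expR (- v).
  by rewrite -[in LHS](subrK a b) addrC survivalD.
have vE : v = \int[mu]_(s in `[a, b]) g (shift y s).
  rewrite /v /hazard.
  rewrite -[X in `[X, b]]addr0 -[X in `[_, X]](subrK a b) [X in `[_, X]]addrC.
  rewrite Rintegral_translate; last exact: measurable_along_flow.
  by apply: eq_Rintegral => s _; rewrite shift_shift.
have FE : F b - F a = survival y a * (expR (- v) - 1 + v) +
    \int[mu]_(s in `[a, b]) (g (shift y s) * (survival y s - survival y a)).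
  rewrite /F (@Rintegral_segmentD _ _ C 0 a b)//.
  have -> : \int[mu]_(s in `[a, b]) (g (shift y s) * (survival y s - survival y a)) =
      \int[mu]_(s in `[a, b]) (wait_density g y s) - survival y a * v.
    rewrite vE -RintegralZl//; last exact: (bounded_integrable_segment (M := C) (measurable_along_flow y)).
    rewrite -RintegralB//; first last.
    - apply: (@bounded_integrable_segment _ (fun s => survival y a * g (shift y s)) C).
        by apply: measurable_funM => //; exact: measurable_along_flow.
      move=> x _; rewrite normrM (ger0_norm (ltW (survival_gt0 _ _))) -[leRHS]mul1r.
      by rewrite ler_pM//; [exact/ltW/survival_gt0|exact: survival_le1].
    - exact: (bounded_integrable_segment (M := C)).
    by apply: eq_Rintegral => s _; rewrite wait_densityE mulrBr [survival y a * _]mulrC.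
  rewrite Sb; ring.
rewrite FE; apply: le_trans (ler_normD _ _) _.
have -> : 2 * C ^+ 2 * (b - a) ^+ 2 = (C * (b - a)) ^+ 2 + (C * (C * (b - a))) * (b - a).
  by ring.
apply: lerD.
  rewrite normrM (ger0_norm (ltW (survival_gt0 _ _))) -[leRHS]mul1r.
  rewrite ler_pM//; [exact/ltW/survival_gt0|exact: survival_le1|].
  apply: le_trans (expR_le1 v0) _.
  by rewrite lerXn2r// nnegrE// mulr_ge0.
apply: le_normr_segment => //.
  apply: measurable_funM; first exact: measurable_along_flow.
  apply: measurable_funB => //.
  exact: (measurable_fun_pair2 y measurable_survival).
move=> s /andP[sa sb]; rewrite normrM ler_pM//.
have sa0 : 0 <= s - a by rewrite subr_ge0.
have Ss : survival y s = survival y a * survival (shift y a) (s - a).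
  by have := survivalD y a0 sa0; rewrite [a + _]addrC subrK.
have h1 := survival_ge (shift y a) sa0.
have h5 : C * (s - a) <= C * (b - a) by rewrite ler_wpM2l// lerB.
rewrite Ss distrC -[X in X - _]mulr1 -mulrBr normrM (ger0_norm (ltW (survival_gt0 _ _))).
rewrite ger0_norm ?subr_ge0 ?survival_le1// -[leRHS]mul1r.
rewrite ler_pM ?subr_ge0 ?survival_le1//; first exact/ltW/survival_gt0.
by rewrite lerBlDr -lerBlDl (le_trans _ h1)// lerB.
Qed.

Lemma integral_wait_density y r : 0 <= r ->
  (\int[mu]_(z in `[0%R, r]) (wait_density g y z)%:E)%E = (1 - survival y r)%:E.
Proof.
move=> r0; rewrite -Rintegral_wait_density// /Rintegral fineK//.
apply: integrable_fin_num => //.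
apply: (bounded_integrable_segment (M := C)).
  exact: (measurable_fun_pair2 y measurable_wait_density).
by move=> z _; rewrite ger0_norm ?wait_density_ge0// wait_density_le.
Qed.

End survival.

(** * Positive functionals on measurable functions *)

Section positive_functionals.
Context {R : realType} {d : measure_display} {S : measurableType d}.
Implicit Types (I : (S -> \bar R) -> \bar R) (f g : S -> \bar R).
Import HBNNSimple.
Local Open Scope ereal_scope.

(** Integration against a law, against a law with a random parameter, or in a mixture of such
    laws has these properties, and two functionals that have them can be compared without first
    being turned into measures. *)
Record posfun I : Prop := PosFun {
  posfun_ge0 : forall f, (forall x, 0 <= f x) -> 0 <= I f ;
  le_posfun : forall f g, measurable_fun setT f -> measurable_fun setT g ->
    (forall x, 0 <= f x) -> (forall x, f x <= g x) -> I f <= I g ;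
  posfunD : forall f g, measurable_fun setT f -> measurable_fun setT g ->
    (forall x, 0 <= f x) -> (forall x, 0 <= g x) ->
    I (fun x => f x + g x) = I f + I g ;
  posfunZ : forall (c : R) f, (0 <= c)%R -> measurable_fun setT f ->
    (forall x, 0 <= f x) -> I (fun x => c%:E * f x) = c%:E * I f ;
  posfun_cvg : forall (f_ : nat -> S -> \bar R) f,
    (forall n, measurable_fun setT (f_ n)) -> (forall n x, 0 <= f_ n x) ->
    (forall x, {homo f_ ^~ x : n m / (n <= m)%N >-> n <= m}) ->
    (forall x, f_ n x @[n --> \oo] --> f x) ->
    I (f_ n) @[n --> \oo] --> I f }.

Lemma posfun_eval (x : S) : posfun (fun f => f x).
Proof. by split => // [f|f_ f _ _ _]; apply. Qed.

Lemma posfun0 I : posfun I -> I (cst 0) = 0.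
Proof.
move=> pI.
have := posfunZ pI (lexx 0%R) (@measurable_cst _ _ _ _ setT (0 : \bar R)) (fun=> lexx _).
rewrite mul0e => e0; rewrite -[RHS]e0; congr I.
by apply/funext => x; rewrite /cst mul0e.
Qed.

Lemma posfun_sum I (f_ : nat -> S -> \bar R) n : posfun I ->
  (forall n, measurable_fun setT (f_ n)) -> (forall n x, 0 <= f_ n x) ->
  I (fun x => \sum_(0 <= i < n) f_ i x) = \sum_(0 <= i < n) I (f_ i).
Proof.
move=> pI mf f0; elim: n => [|n IH].
  rewrite big_nil -[RHS](posfun0 pI); congr I; apply/funext => x.
  by rewrite big_nil.
rewrite big_nat_recr//= -IH -posfunD//.
- by congr I; apply/funext => x; rewrite big_nat_recr.
- by apply: emeasurable_sum.
- by move=> x; exact: sume_ge0.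
Qed.

Lemma posfun_semi_sigma_additive I : posfun I ->
  semi_sigma_additive (fun D : set S => I (fun x => (\1_D x)%:E)).
Proof.
move=> pI F mF tF mUF.
have m1 i : measurable_fun setT (fun x => (\1_(F i) x)%:E : \bar R).
  by apply/measurable_EFinP; exact: measurable_indic.
have p1 i x : 0 <= (\1_(F i) x)%:E :> \bar R by rewrite lee_fin.
have -> : (fun n => \sum_(0 <= i < n) I (fun x => (\1_(F i) x)%:E)) =
    (fun n => I (fun x => \sum_(0 <= i < n) (\1_(F i) x)%:E)).
  by apply/funext => n; rewrite posfun_sum.
apply: (posfun_cvg pI).
- by move=> n; exact: emeasurable_sum.
- by move=> n x; exact: sume_ge0.
- by move=> x; apply/ereal_nondecreasing_series.
- move=> x; rewrite indic_bigcup//.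
  exact: is_cvg_nneseries.
Qed.

(** Every nonnegative measurable function is an increasing limit of simple functions. *)
Lemma posfun_eq_indic I1 I2 : posfun I1 -> posfun I2 ->
  (forall D, measurable D ->
    I1 (fun x => (\1_D x)%:E) = I2 (fun x => (\1_D x)%:E)) ->
  forall f, measurable_fun setT f -> (forall x, 0 <= f x) -> I1 f = I2 f.
Proof.
move=> p1 p2 I12 f mf f0.
pose s_ := nnsfun_approx measurableT mf.
have sI n : I1 (EFin \o s_ n) = I2 (EFin \o s_ n).
  have sE : EFin \o s_ n = fun x => \sum_(i <- finmap.enum_fset (fset_set (range (s_ n))))
      (i%:E * (\1_(s_ n @^-1` [set i]) x)%:E).
    apply/funext => x /=; rewrite [in LHS]fimfunE fsbig_finite//= -sumEFin.
    by apply: eq_bigr => i _; rewrite EFinM.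
  rewrite sE.
  have : forall i, i \in finmap.enum_fset (fset_set (range (s_ n))) -> (0 <= i)%R.
    move=> i; rewrite in_fset_set// inE => -[x _ <-]; exact: fun_ge0.
  elim: (finmap.enum_fset _) => [_|i r IH].
    have -> : (fun x => \sum_(i <- [::]) (i%:E * (\1_(s_ n @^-1` [set i]) x)%:E)) = cst 0.
      by apply/funext => x; rewrite big_nil.
    by rewrite !posfun0.
  move=> r0.
  have i0 : (0 <= i)%R by apply: r0; rewrite mem_head.
  have r0' j : j \in r -> (0 <= j)%R by move=> jr; apply: r0; rewrite inE jr orbT.
  have mi j : measurable_fun setT (fun x => (\1_(s_ n @^-1` [set j]) x)%:E : \bar R).
    by apply/measurable_EFinP; apply: measurable_indic; exact: measurable_funPTI.
  under eq_fun do rewrite big_cons.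
  have mr : measurable_fun setT
      (fun x => \sum_(j <- r) (j%:E * (\1_(s_ n @^-1` [set j]) x)%:E)).
    by apply: emeasurable_sum => j; exact: measurable_funeM.
  have pr x : 0 <= \sum_(j <- r) (j%:E * (\1_(s_ n @^-1` [set j]) x)%:E).
    rewrite big_seq; apply: sume_ge0 => j jr; rewrite mule_ge0 ?lee_fin//.
    exact: r0'.
  have pi x : 0 <= i%:E * (\1_(s_ n @^-1` [set i]) x)%:E.
    by rewrite mule_ge0 ?lee_fin.
  have mm : measurable_fun setT (fun x => i%:E * (\1_(s_ n @^-1` [set i]) x)%:E).
    exact: measurable_funeM.
  rewrite (posfunD p1)// (posfunD p2)// IH//; congr (_ + _).
  by rewrite (posfunZ p1)// (posfunZ p2)// I12//; exact: measurable_funPTI.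
have h I : posfun I -> I (EFin \o s_ n) @[n --> \oo] --> I f.
  move=> pI; apply: (posfun_cvg pI).
  - by move=> n; exact/measurable_EFinP.
  - by move=> n x; rewrite lee_fin; exact: fun_ge0.
  - by move=> x n m nm; rewrite lee_fin; exact/lefP/nd_nnsfun_approx.
  - by move=> x; exact: cvg_nnsfun_approx.
have c1 := h _ p1; have c2 := h _ p2.
have e12 : (fun n => I1 (EFin \o s_ n)) = (fun n => I2 (EFin \o s_ n)).
  by apply/funext => n; exact: sI.
rewrite e12 in c1.
exact: (cvg_unique _ c1 c2).
Qed.

(** On indicators the two functionals are measures, and these agree on a system of sets that is
    stable under intersection. *)
Lemma posfun_unique I1 I2 (G : set (set S)) (g_ : nat -> set S) :
  posfun I1 -> posfun I2 ->
  measurable = <<s G >> -> setI_closed G -> (forall n, G (g_ n)) ->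
  \bigcup_n g_ n = setT ->
  (forall A, G A -> I1 (fun x => (\1_A x)%:E) = I2 (fun x => (\1_A x)%:E)) ->
  (forall n, I1 (fun x => (\1_(g_ n) x)%:E) < +oo) ->
  forall f, measurable_fun setT f -> (forall x, 0 <= f x) -> I1 f = I2 f.
Proof.
move=> p1 p2 mG GI Gg gT I12 Ioo; apply: posfun_eq_indic => // D mD.
have mu0 I : posfun I -> I (fun x => (\1_(@set0 S) x)%:E) = 0.
  by move=> pI; rewrite indic0 -(posfun0 pI); congr I.
have mu_ge0 I : posfun I -> forall A, 0 <= I (fun x => (\1_A x)%:E).
  by move=> pI A; apply: posfun_ge0 => // x; rewrite lee_fin.
pose m1 := HB.pack_for {measure set S -> \bar R} (fun D : set S => I1 (fun x => (\1_D x)%:E))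
  (isMeasure.Build _ _ _ _ (mu0 _ p1) (mu_ge0 _ p1) (posfun_semi_sigma_additive p1)).
pose m2 := HB.pack_for {measure set S -> \bar R} (fun D : set S => I2 (fun x => (\1_D x)%:E))
  (isMeasure.Build _ _ _ _ (mu0 _ p2) (mu_ge0 _ p2) (posfun_semi_sigma_additive p2)).
exact: (measure_unique G g_ mG GI Gg gT m1 m2).
Qed.

End positive_functionals.

Lemma indicX {R : pzRingType} {T1 T2 : Type} (D : set T1) (E : set T2) x q :
  \1_(D `*` E) (x, q) = \1_D x * \1_E q :> R.
Proof.
rewrite !indicE -natrM mulnb; congr (nat_of_bool _)%:R.
by apply/idP/andP => [/set_mem[/= Dx Eq]|[/set_mem Dx /set_mem Eq]];
  [split; exact: mem_set|exact: mem_set].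
Qed.

Section posfun_product.
Context {R : realType} {d1 d2 : measure_display}
  {S1 : measurableType d1} {S2 : measurableType d2}.
Local Open Scope ereal_scope.

Lemma posfun_unique_prod (I1 I2 : (S1 * S2 -> \bar R) -> \bar R) :
  posfun I1 -> posfun I2 ->
  (forall A B, measurable A -> measurable B ->
    I1 (fun x => (\1_(A `*` B) x)%:E) = I2 (fun x => (\1_(A `*` B) x)%:E)) ->
  I1 (cst 1) < +oo ->
  forall f, measurable_fun setT f -> (forall x, 0 <= f x) -> I1 f = I2 f.
Proof.
move=> p1 p2 I12 Ioo.
apply: (@posfun_unique _ _ _ _ _
  [set A `*` B | A in d1.-measurable & B in d2.-measurable] (fun=> setT)) => //.
- exact: measurable_prod_measurableType.
- move=> _ _ [A1 mA1 [B1 mB1 <-]] [A2 mA2 [B2 mB2 <-]]; rewrite -setXI.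
  exists (A1 `&` A2); first exact: measurableI.
  by exists (B1 `&` B2) => //; exact: measurableI.
- by move=> _; exists setT => //; exists setT => //; rewrite setXTT.
- by rewrite bigcup_const//; exists 0%N.
- by move=> _ [A mA [B mB <-]]; exact: I12.
- by move=> _; rewrite indicT.
Qed.

Lemma posfun_pair1 (I : (S2 -> \bar R) -> \bar R) (x : S1) : posfun I ->
  posfun (fun f : S1 * S2 -> \bar R => I (fun y => f (x, y))).
Proof.
move=> pI; split.
- by move=> f f0; apply: posfun_ge0.
- by move=> f g mf mg f0 fg; apply: le_posfun => //; exact: measurable_fun_pair2.
- by move=> f g mf mg f0 g0; apply: posfunD => //; exact: measurable_fun_pair2.
- by move=> c f c0 mf f0; apply: (posfunZ pI) => //; exact: measurable_fun_pair2.
- move=> f_ f mf f0 ndf cf; apply: (posfun_cvg pI) => //.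
  by move=> n; exact: measurable_fun_pair2.
Qed.

End posfun_product.

Section posfun_mix.
Context {R : realType} {d d' : measure_display}
  {S : measurableType d} {T : measurableType d'}.
Local Open Scope ereal_scope.

(** The expectation of a conditional expectation is of this form. *)
Lemma posfun_mix (J : (T -> \bar R) -> \bar R) (K : T -> (S -> \bar R) -> \bar R) :
  posfun J -> (forall t, posfun (K t)) ->
  (forall f, measurable_fun setT f -> (forall x, 0 <= f x) ->
    measurable_fun setT (fun t => K t f)) ->
  posfun (fun f => J (fun t => K t f)).
Proof.
move=> pJ pK mK; split.
- by move=> f f0; apply: posfun_ge0 => // t; exact: posfun_ge0.
- move=> f g mf mg f0 fg.
  have g0 x : 0 <= g x by apply: le_trans (fg x).
  apply: (le_posfun pJ) => [| | |t]; [exact: mK|exact: mK| |exact: le_posfun].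
  by move=> t; exact: posfun_ge0.
- move=> f g mf mg f0 g0.
  rewrite -(posfunD pJ)//; [|exact: mK|exact: mK|by move=> t; exact: posfun_ge0
    |by move=> t; exact: posfun_ge0].
  by congr J; apply/funext => t; rewrite (posfunD (pK t)).
- move=> c f c0 mf f0.
  rewrite -(posfunZ pJ)//; [|exact: mK|by move=> t; exact: posfun_ge0].
  by congr J; apply/funext => t; rewrite (posfunZ (pK t)).
- move=> f_ f mf f0 ndf cf; apply: (posfun_cvg pJ).
  + by move=> n; exact: mK.
  + by move=> n t; exact: posfun_ge0.
  + by move=> t m n mn; apply: le_posfun => // x; exact: ndf.
  + by move=> t; exact: (posfun_cvg (pK t)).
Qed.

Lemma posfun_integral (mu : {measure set T -> \bar R}) (D : set T) :
  measurable D -> posfun (fun f => \int[mu]_(t in D) f t).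
Proof.
move=> mD; split.
- by move=> f f0; apply: integral_ge0.
- by move=> f g mf mg f0 fg; apply: ge0_le_integral => //; exact: measurable_funTS.
- by move=> f g mf mg f0 g0; rewrite ge0_integralD//; exact: measurable_funTS.
- by move=> c f c0 mf f0; rewrite ge0_integralZl_EFin//; exact: measurable_funTS.
- move=> f_ f mf f0 ndf cf.
  have -> : f = fun x => limn (f_ ^~ x).
    by apply/funext => x; apply/esym/cvg_lim => //; exact: cf.
  apply: cvg_monotone_convergence => //.
  by move=> n; exact: measurable_funTS.
Qed.

End posfun_mix.

(** * Integration against the law of a waiting time *)

Section waiting_expectation.
Context {R : realType}.
Notation mu := (@lebesgue_measure R).
Variables (g : nat * R -> R) (C : R).
Hypothesis Ig : bounded_intensity C g.
Let mg := intensity_meas Ig. Let g0 := intensity_ge0 Ig. Let gC := intensity_le Ig.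
Implicit Types (y : nat * R) (f : \bar R -> \bar R).
Local Open Scope ereal_scope.

Definition wait_total y : \bar R :=
  \int[mu]_(z in `[0%R, +oo[) (wait_density g y z)%:E.

Definition wait_defect y : \bar R := 1 - wait_total y.

(** The integral against [wait_law g y]: [wait_defect y] is its mass at [+oo]. *)
Definition wait_expect y f : \bar R :=
  \int[mu]_(z in `[0%R, +oo[) (f z%:E * (wait_density g y z)%:E) +
  wait_defect y * f +oo.

Let md y : measurable_fun setT (wait_density g y).
Proof. exact: (measurable_fun_pair2 y (measurable_wait_density Ig)). Qed.

Let d0 y z : (0 <= wait_density g y z)%R.
Proof. exact: wait_density_ge0. Qed.

Lemma wait_total_ge0 y : 0 <= wait_total y.
Proof. by apply: integral_ge0 => z _; rewrite lee_fin. Qed.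

Lemma wait_total_le1 y : wait_total y <= 1.
Proof.
rewrite /wait_total ge0_integral_ereal_sup//.
apply: ge_ereal_sup => _ [n _ <-].
rewrite (integral_wait_density Ig)// lee_fin lerBlDr lerDl.
exact/ltW/survival_gt0.
Qed.

Lemma wait_total_fin y : wait_total y \is a fin_num.
Proof.
rewrite ge0_fin_numE ?wait_total_ge0//.
exact: le_lt_trans (wait_total_le1 y) (ltry _).
Qed.

Lemma wait_defect_ge0 y : 0 <= wait_defect y.
Proof. by rewrite sube_ge0 ?wait_total_le1// wait_total_fin. Qed.

Lemma wait_defect_fin y : wait_defect y \is a fin_num.
Proof. by rewrite fin_numB /= wait_total_fin. Qed.

Lemma posfun_wait_expect y : posfun (wait_expect y).
Proof.
have mfd f : measurable_fun setT f ->
    measurable_fun (`[0%R, +oo[%classic : set R) (fun z : R => f z%:E * (wait_density g y z)%:E).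
  move=> mf; apply: measurable_funTS; apply: emeasurable_funM.
    by apply: (measurableT_comp mf); exact: EFin_measurable.
  exact/measurable_EFinP.
have fd0 f : (forall b, 0 <= f b) -> forall z, 0 <= f z%:E * (wait_density g y z)%:E.
  by move=> f0 z; rewrite mule_ge0// lee_fin.
split.
- move=> f f0; apply: adde_ge0; last by rewrite mule_ge0// wait_defect_ge0.
  by apply: integral_ge0 => z _; exact: fd0.
- move=> f h mf mh f0 fh.
  have h0 b : 0 <= h b by exact: le_trans (fh b).
  apply: leeD; last by rewrite lee_wpmul2l// wait_defect_ge0.
  apply: ge0_le_integral => //.
  + by move=> z _; exact: fd0.
  + exact: mfd.
  + exact: mfd.
  + by move=> z _; rewrite lee_wpmul2r// lee_fin.
- move=> f h mf mh f0 h0; rewrite /wait_expect.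
  rewrite ge0_muleDr// [RHS]addeACA; congr (_ + _).
  rewrite -ge0_integralD//; [|by move=> z _; exact: fd0|exact: mfd
    |by move=> z _; exact: fd0|exact: mfd].
  by apply: eq_integral => z _; rewrite ge0_muleDl.
- move=> c f c0 mf f0; rewrite /wait_expect muleDr//; last first.
    by apply: ge0_adde_def; rewrite inE;
      [apply: integral_ge0 => z _; exact: fd0|rewrite mule_ge0// wait_defect_ge0].
  congr (_ + _); last by rewrite muleCA.
  rewrite -ge0_integralZl_EFin//; [|by move=> z _; exact: fd0|exact: mfd].
  by apply: eq_integral => z _; rewrite muleA.
- move=> f_ f mf f0 ndf cf.
  have flim0 b : 0 <= f b.
    rewrite -(cvg_lim _ (cf b))//; apply: lime_ge; last exact: nearW.
    by apply/cvg_ex; exists (f b); exact: cf.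
  apply: cvgeD.
  + by apply: ge0_adde_def; rewrite inE;
      [apply: integral_ge0 => z _; exact: fd0|rewrite mule_ge0// wait_defect_ge0].
  + have cfd (z : R) : f_ n z%:E * (wait_density g y z)%:E @[n --> \oo] -->
        f z%:E * (wait_density g y z)%:E by exact: cvgeZr.
    have -> : \int[mu]_(z in `[0%R, +oo[) (f z%:E * (wait_density g y z)%:E) =
        \int[mu]_(z in `[0%R, +oo[) limn (fun n => f_ n z%:E * (wait_density g y z)%:E).
      by apply: eq_integral => z _; apply/esym/cvg_lim.
    apply: cvg_monotone_convergence => //.
    * by move=> n; exact: mfd.
    * by move=> n z _; exact: fd0.
    * by move=> z _ n m nm; rewrite lee_wpmul2r ?lee_fin//; exact: ndf.
  + by apply: cvgeZl => //; exact: wait_defect_fin.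
Qed.

Lemma wait_expect_indic y (A : set \bar R) : measurable A ->
  wait_expect y (fun b => (\1_A b)%:E) = wait_law g y A.
Proof.
move=> mA; rewrite /wait_expect /wait_law; congr (_ + _).
rewrite integral_mkcondr; apply: eq_integral => z _.
rewrite /patch indicE; case: ifPn => zA.
  by rewrite mem_set ?mul1e//; exact: set_mem zA.
by rewrite memNset ?mul0e//; move: zA; rewrite notin_setE.
Qed.

Lemma wait_expect1 y : wait_expect y (cst 1) = 1.
Proof.
rewrite /wait_expect mule1 /wait_defect.
under eq_integral do rewrite mul1e.
by rewrite -/(wait_total y) addeC subeK// wait_total_fin.
Qed.

Lemma wait_law_ge0 y (A : set \bar R) : measurable A -> 0 <= wait_law g y A.
Proof.
move=> mA; rewrite -wait_expect_indic//.
by apply: (posfun_ge0 (posfun_wait_expect y)) => b; rewrite lee_fin.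
Qed.

Lemma wait_law_fin y (A : set \bar R) : measurable A -> wait_law g y A \is a fin_num.
Proof.
move=> mA; rewrite ge0_fin_numE ?wait_law_ge0//.
apply: le_lt_trans (ltry 1); rewrite -(wait_expect1 y) -wait_expect_indic//.
apply: (le_posfun (posfun_wait_expect y)) => [| |b|b].
- by apply/measurable_EFinP; exact: measurable_indic.
- exact: measurable_cst.
- by rewrite lee_fin.
- by rewrite lee_fin /= indicE; case: (_ \in _).
Qed.

Lemma measurable_wait_total : measurable_fun setT wait_total.
Proof.
apply: (measurable_fun_integral_halfline
  (F := fun p : (nat * R) * R => (wait_density g p.1 p.2)%:E)).
  by apply/measurable_EFinP; exact: measurable_wait_density.
by move=> z; rewrite lee_fin.
Qed.

Lemma measurable_wait_expect {d} {T : measurableType d} (yy : T -> nat * R)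
    (F : T * \bar R -> \bar R) :
  measurable_fun setT yy -> measurable_fun setT F -> (forall p, 0 <= F p) ->
  measurable_fun setT (fun t => wait_expect (yy t) (fun b => F (t, b))).
Proof.
move=> my mF F0; apply: emeasurable_funD.
  apply: (measurable_fun_integral_halfline
    (F := fun p : T * R => F (p.1, p.2%:E) * (wait_density g (yy p.1) p.2)%:E)).
    apply: emeasurable_funM.
      apply: (measurableT_comp mF); apply: measurable_fun_pair; first by mfun.
      exact/measurable_EFinP.
    apply/measurable_EFinP.
    apply: (measurableT_comp (measurable_wait_density Ig)
      (g := fun p : T * R => (yy p.1, p.2))).
    apply: measurable_fun_pair; last by mfun.
    by apply: (measurableT_comp my); mfun.
  by move=> z; rewrite mule_ge0// lee_fin.
apply: emeasurable_funM.
  apply: emeasurable_funB; first by mfun.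
  exact: (measurableT_comp measurable_wait_total).
exact: measurable_fun_pair1.
Qed.

(** Up to [r] the density has mass [1 - survival g y r], and the mass at [+oo] completes the
    total to 1. *)
Lemma wait_expect_gt y (r : R) : (0 <= r)%R ->
  wait_expect y (fun b => if r%:E < b then 1 else 0) = (survival g y r)%:E.
Proof.
move=> r0; rewrite /wait_expect ltry mule1 /wait_defect.
have -> : \int[mu]_(z in `[0%R, +oo[) ((if r%:E < z%:E then 1 else 0) * (wait_density g y z)%:E) =
    \int[mu]_(z in `]r, +oo[) (wait_density g y z)%:E.
  rewrite [RHS](_ : _ = \int[mu]_(z in `[0%R, +oo[ `&` `]r, +oo[) (wait_density g y z)%:E).
    rewrite integral_mkcondr; apply: eq_integral => z _; rewrite /patch.
    by rewrite mem_setE in_itv/= andbT lte_fin; case: ltP; rewrite ?mul1e ?mul0e.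
  congr integral; apply/seteqP; split => z /=; rewrite !in_itv/= !andbT.
    by move=> rz; split => //; apply: ltW; exact: le_lt_trans rz.
  by case.
have : wait_total y = \int[mu]_(z in `[0%R, r]) (wait_density g y z)%:E +
    \int[mu]_(z in `]r, +oo[) (wait_density g y z)%:E.
  rewrite -ge0_integral_setU//.
  - by rewrite -itv_bndbnd_setU ?bnd_simp.
  - by apply/measurable_EFinP; apply: measurable_funTS; exact: md.
  - by move=> z _; rewrite lee_fin.
  - apply/disj_setPS => z [/=]; rewrite !in_itv/= andbT => /andP[_ zr] rz.
    by have := le_lt_trans zr rz; rewrite ltxx.
rewrite (integral_wait_density Ig)// => e.
set I := \int[mu]_(z in `]r, +oo[) _ in e *.
have fI : I \is a fin_num.
  rewrite ge0_fin_numE; last by apply: integral_ge0 => z _; rewrite lee_fin.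
  apply: le_lt_trans (ltry (fine (wait_total y))).
  rewrite fineK ?wait_total_fin// e leeDr// lee_fin subr_ge0.
  exact: survival_le1.
by move: I fI e => [i| |]// _ ->; congr (_%:E); ring.
Qed.

Lemma wait_law_gt y (r : R) : (0 <= r)%R ->
  wait_law g y `]r%:E, +oo] = (survival g y r)%:E.
Proof.
move=> r0; rewrite -wait_expect_indic; last exact: emeasurable_itv.
rewrite -wait_expect_gt//; congr wait_expect; apply/funext => b.
by rewrite indicE mem_setE in_itv/= leey andbT; case: ifP.
Qed.

(** The waiting-time law has no atom at a finite time. *)
Lemma wait_expect_ge y (r : R) : (0 <= r)%R ->
  wait_expect y (fun b => if r%:E <= b then 1 else 0) = (survival g y r)%:E.
Proof.
move=> r0; rewrite -wait_expect_gt// /wait_expect leey ltry.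
congr (_ + _).
have mdE : measurable_fun setT (fun z : R => (wait_density g y z)%:E) by exact/measurable_EFinP.
apply: ae_eq_integral => //.
- apply: measurable_funTS; apply: emeasurable_funM => //.
  by apply: measurable_fun_ifT => //; apply: measurable_fun_ler; mfun.
- apply: measurable_funTS; apply: emeasurable_funM => //.
  by apply: measurable_fun_ifT => //; apply: measurable_fun_ltr; mfun.
- exists [set r]; split => //; first exact: lebesgue_measure_set1.
  move=> z /= H; apply: contrapT => zr; apply: H => _.
  by rewrite lee_fin lte_fin lt_neqAle eq_sym (introN eqP zr).
Qed.

Lemma wait_expectZl y (c : \bar R) f : 0 <= c -> measurable_fun setT f -> (forall b, 0 <= f b) ->
  wait_expect y (fun b => c * f b) = c * wait_expect y f.
Proof.
move=> c0 mf f0; rewrite /wait_expect ge0_muleDr//; last 2 first.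
- by apply: integral_ge0 => z _; rewrite mule_ge0// lee_fin.
- by rewrite mule_ge0// wait_defect_ge0.
rewrite [in RHS]muleCA -ge0_integralZl//.
- by congr (_ + _); apply: eq_integral => z _; rewrite muleA.
- apply: measurable_funTS; apply: emeasurable_funM.
    by apply: (measurableT_comp mf); exact: EFin_measurable.
  by apply/measurable_EFinP; exact: md.
- by move=> z _; rewrite mule_ge0// lee_fin.
Qed.

Lemma wait_expect_fine y (f : R -> \bar R) (k : \bar R -> \bar R) :
  (forall z, (0 <= z)%R -> k z%:E = f z) -> k +oo = 0 ->
  wait_expect y k =
  \int[mu]_(z in `[0%R, +oo[) (f z * (wait_density g y z)%:E).
Proof.
move=> kf koo; rewrite /wait_expect koo mule0 adde0.
apply: eq_integral => z; rewrite inE/= in_itv/= andbT => z0.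
by rewrite kf.
Qed.

End waiting_expectation.

(** * Conditional independence of the two candidate waiting times *)

Section freezing.
Context {R : realType}.
Notation mu := (@lebesgue_measure R).
Variables (lam h : nat * R -> R) (C : R).
Hypotheses (Il : bounded_intensity C lam) (Ih : bounded_intensity C h).
Let lam_meas := intensity_meas Il. Let h_meas := intensity_meas Ih.
Let lam_ge0 := intensity_ge0 Il. Let h_ge0 := intensity_ge0 Ih.
Let lam_le := intensity_le Il. Let h_le := intensity_le Ih.
Local Open Scope ereal_scope.

Definition wait2_expect y (f : \bar R * \bar R -> \bar R) : \bar R :=
  wait_expect lam y (fun a => wait_expect h y (fun b => f (a, b))).

Lemma posfun_wait2_expect y : posfun (wait2_expect y).
Proof.
apply: (posfun_mix (K := fun a f => wait_expect h y (fun b => f (a, b)))).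
- exact: (posfun_wait_expect Il).
- by move=> a; apply: posfun_pair1; exact: (posfun_wait_expect Ih).
- move=> f mf f0.
  exact: (measurable_wait_expect Ih (yy := cst y)).
Qed.

Lemma wait2_expect_rectangle y (A B : set (\bar R)) : measurable A -> measurable B ->
  wait2_expect y (fun p => (\1_(A `*` B) p)%:E) = wait_law lam y A * wait_law h y B.
Proof.
move=> mA mB; rewrite /wait2_expect.
have lB0 := wait_law_ge0 Ih y mB.
have lBf := wait_law_fin Ih y mB.
have m1 (D : set (\bar R)) : measurable D ->
    measurable_fun setT (fun b => (\1_D b)%:E : \bar R).
  by move=> mD; apply/measurable_EFinP; exact: measurable_indic.
have p1 (D : set (\bar R)) b : 0 <= (\1_D b)%:E :> \bar R by rewrite lee_fin.
have -> : (fun a => wait_expect h y (fun b => (\1_(A `*` B) (a, b))%:E)) =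
    (fun a => (fine (wait_law h y B))%:E * (\1_A a)%:E).
  apply/funext => a.
  have -> : (fun b => (\1_(A `*` B) (a, b))%:E) =
      (fun b => (\1_A a)%:E * (\1_B b)%:E) :> (_ -> \bar R).
    by apply/funext => b; rewrite indicX EFinM.
  rewrite (posfunZ (posfun_wait_expect Ih y) _ (m1 _ mB) (p1 _))//.
  rewrite (wait_expect_indic h y mB) muleC.
  by congr (_ * _); exact/esym/fineK.
rewrite (posfunZ (posfun_wait_expect Il y) _ (m1 _ mA) (p1 _))//; last first.
  exact: fine_ge0.
by rewrite (wait_expect_indic lam y mA) muleC; congr (_ * _); exact: fineK.
Qed.

Context {d d' : measure_display} {Omega : measurableType d} {T : measurableType d'}.

Lemma measurable_wait2_expect (yy : T -> nat * R) (F : T * (\bar R * \bar R) -> \bar R) :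
  measurable_fun setT yy -> measurable_fun setT F -> (forall p, 0 <= F p) ->
  measurable_fun setT (fun t => wait2_expect (yy t) (fun p => F (t, p))).
Proof.
move=> my mF F0.
apply: (measurable_wait_expect Il (F := fun p : T * \bar R =>
  wait_expect h (yy p.1) (fun b => F (p.1, (p.2, b))))) => //.
- apply: (measurable_wait_expect Ih (yy := yy \o fst)
    (F := fun q : (T * \bar R) * \bar R => F (q.1.1, (q.1.2, q.2)))) => //.
    exact: measurableT_comp.
  by apply: (measurableT_comp mF); mfun.
- move=> p; apply: (posfun_ge0 (posfun_wait_expect Ih _)) => b.
  exact: F0.
Qed.

Variables (P : probability Omega R) (Z : Omega -> T) (yy : T -> nat * R).
Variables (U V : Omega -> \bar R) (G : set Omega).
Hypotheses (mG : measurable G) (mZ : measurable_fun setT Z).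
Hypothesis myy : measurable_fun setT yy.
Hypotheses (mU : measurable_fun setT U) (mV : measurable_fun setT V).
Hypothesis rectangles : forall D A B, measurable D -> measurable A -> measurable B ->
  P ((G `&` Z @^-1` D) `&` (U @^-1` A `&` V @^-1` B)) =
  \int[P]_(w in G `&` Z @^-1` D)
    (wait_law lam (yy (Z w)) A * wait_law h (yy (Z w)) B).

Let integral1_lty (D : set Omega) : measurable D -> \int[P]_(w in D) 1 < +oo.
Proof.
move=> mD; rewrite integral_cst// mul1e.
by apply: le_lt_trans (ltry 1); exact: probability_le1.
Qed.

(** A positive functional on a product is determined by its values on
    rectangles, so the conditional law of [(U, V)] integrates every function of
    [(Z, (U, V))], with [Z] held fixed. *)
Lemma freezing (F : T * (\bar R * \bar R) -> \bar R) :
  measurable_fun setT F -> (forall p, 0 <= F p) ->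
  \int[P]_(w in G) F (Z w, (U w, V w)) =
  \int[P]_(w in G) wait2_expect (yy (Z w)) (fun p => F (Z w, p)).
Proof.
have pP : posfun (fun f : Omega -> \bar R => \int[P]_(w in G) f w).
  exact: posfun_integral.
have mZUV : measurable_fun setT (fun w => (Z w, (U w, V w))).
  by apply: measurable_fun_pair => //; exact: measurable_fun_pair.
have p1 : posfun (fun F : T * (\bar R * \bar R) -> \bar R =>
    \int[P]_(w in G) F (Z w, (U w, V w))).
  apply: (posfun_mix (K := fun w F => F (Z w, (U w, V w))) pP).
    by move=> w; exact: posfun_eval.
  by move=> f mf _; exact: (measurableT_comp mf).
have p2 : posfun (fun F : T * (\bar R * \bar R) -> \bar R =>
    \int[P]_(w in G) wait2_expect (yy (Z w)) (fun p => F (Z w, p))).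
  apply: (posfun_mix (K := fun w F => wait2_expect (yy (Z w)) (fun p => F (Z w, p))) pP).
    by move=> w; apply: posfun_pair1; exact: posfun_wait2_expect.
  by move=> f mf f0; apply: (measurableT_comp (measurable_wait2_expect myy mf f0)).
move: F; apply: (posfun_unique_prod p1 p2); last first.
  exact: integral1_lty.
move=> D E mD mE.
have mGD : measurable (G `&` Z @^-1` D).
  by apply: measurableI => //; rewrite -[_ @^-1` _]setTI; exact: mZ.
have indX (x : T) (q : \bar R * \bar R) : (\1_(D `*` E) (x, q))%:E =
    (\1_D x)%:E * (\1_E q)%:E :> \bar R.
  by rewrite -EFinM indicX.
have q1 : posfun (fun F : (\bar R * \bar R) -> \bar R =>
    \int[P]_(w in G `&` Z @^-1` D) F (U w, V w)).
  apply: (posfun_mix (K := fun w F => F (U w, V w)) (posfun_integral P mGD)).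
    by move=> w; exact: posfun_eval.
  by move=> f mf _; apply: (measurableT_comp mf); exact: measurable_fun_pair.
have q2 : posfun (fun F : (\bar R * \bar R) -> \bar R =>
    \int[P]_(w in G `&` Z @^-1` D) wait2_expect (yy (Z w)) F).
  apply: (posfun_mix (K := fun w F => wait2_expect (yy (Z w)) F) (posfun_integral P mGD)).
    by move=> w; exact: posfun_wait2_expect.
  move=> f mf f0; apply: (measurableT_comp (measurable_wait2_expect myy
    (F := fun p => f p.2) _ _)) => //.
  by apply: (measurableT_comp mf); mfun.
have e1 : \int[P]_(w in G) (\1_(D `*` E) (Z w, (U w, V w)))%:E =
    \int[P]_(w in G `&` Z @^-1` D) (\1_E (U w, V w))%:E.
  rewrite integral_mkcondr; apply: eq_integral => w _; rewrite indX /patch indicE.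
  case: ifPn => wD; first by rewrite mem_set ?mul1e//; exact: set_mem wD.
  by rewrite memNset ?mul0e//; move: wD; rewrite notin_setE.
have e2 : \int[P]_(w in G) wait2_expect (yy (Z w)) (fun p => (\1_(D `*` E) (Z w, p))%:E) =
    \int[P]_(w in G `&` Z @^-1` D) wait2_expect (yy (Z w)) (fun p => (\1_E p)%:E).
  rewrite integral_mkcondr; apply: eq_integral => w _; rewrite /patch.
  under eq_fun do rewrite indX indicE.
  case: ifPn => wD.
    rewrite mem_set; last exact: set_mem wD.
    by under eq_fun do rewrite mul1e.
  rewrite memNset; last by move: wD; rewrite notin_setE.
  under eq_fun do rewrite mul0e.
  exact: (posfun0 (posfun_wait2_expect _)).
rewrite e1 e2.
apply: (posfun_unique_prod q1 q2 _ _ (f := fun q => (\1_E q)%:E)).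
- move=> A B mA mB.
  have mAB : measurable ((fun w => (U w, V w)) @^-1` (A `*` B)).
    rewrite -[_ @^-1` _]setTI.
    exact: (measurable_fun_pair mU mV measurableT (measurableX mA mB)).
  transitivity (P ((G `&` Z @^-1` D) `&` (U @^-1` A `&` V @^-1` B))).
    rewrite [LHS](_ : _ = \int[P]_(w in G `&` Z @^-1` D)
        (\1_((fun w => (U w, V w)) @^-1` (A `*` B)) w)%:E); last first.
      by apply: eq_integral => w _; rewrite !indicE.
    by rewrite (integral_indic _ mGD mAB) setIC.
  rewrite (rectangles mD mA mB); apply: eq_integral => w _.
  by rewrite wait2_expect_rectangle.
- exact: integral1_lty.
- by apply/measurable_EFinP; exact: measurable_indic.
- by move=> x; rewrite lee_fin.
Qed.

End freezing.

(** * The law of one step of the construction *)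

Section one_step.
Context {R : realType}.
Notation mu := (@lebesgue_measure R).
Variables (lam h : nat * R -> R) (C : R).
Hypotheses (Il : bounded_intensity C lam) (Ih : bounded_intensity C h).
Let lam_meas := intensity_meas Il. Let h_meas := intensity_meas Ih.
Let lam_ge0 := intensity_ge0 Il. Let h_ge0 := intensity_ge0 Ih.
Let lam_le := intensity_le Il. Let h_le := intensity_le Ih.
Local Open Scope ereal_scope.

Definition no_jump (y : nat * R) (z : R) : R := (survival lam y z * survival h y z)%R.

Definition jump_op (v : nat * R -> \bar R) (y : nat * R) : \bar R :=
  (lam y)%:E * v (up y) + (h y)%:E * v (down y).

Lemma wait2_expectZl y (c : \bar R) (F : \bar R * \bar R -> \bar R) : 0 <= c ->
  measurable_fun setT F -> (forall p, 0 <= F p) ->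
  wait2_expect lam h y (fun p => c * F p) = c * wait2_expect lam h y F.
Proof.
move=> c0 mF F0; rewrite /wait2_expect -(wait_expectZl Il)//.
- congr wait_expect; apply/funext => a.
  by rewrite (wait_expectZl Ih)//; exact: measurable_fun_pair2.
- exact: (measurable_wait_expect Ih (yy := cst y)).
- move=> a; apply: (posfun_ge0 (posfun_wait_expect Ih y)) => b.
  exact: F0.
Qed.

(** Both orders of integration are positive functionals, and they agree on rectangles. *)
Lemma wait2_expect_swap y (F : \bar R * \bar R -> \bar R) :
  measurable_fun setT F -> (forall p, 0 <= F p) ->
  wait2_expect lam h y F =
  wait_expect h y (fun b => wait_expect lam y (fun a => F (a, b))).
Proof.
move=> mF F0.
have -> : wait_expect h y (fun b => wait_expect lam y (fun a => F (a, b))) =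
   wait2_expect h lam y (fun p => F (p.2, p.1)) by [].
pose I2 F := wait2_expect h lam y (fun p => F (p.2, p.1)).
have p2 : posfun I2.
  apply: (posfun_mix (K := fun p F => F (p.2, p.1))
    (posfun_wait2_expect Ih Il y)).
  - by move=> t; exact: posfun_eval.
  - by move=> f mf _; apply: (measurableT_comp mf); mfun.
have p1 := posfun_wait2_expect Il Ih y.
suff : wait2_expect lam h y F = I2 F by [].
move: F mF F0; apply: (posfun_unique_prod p1 p2).
- move=> A B mA mB.
  rewrite (wait2_expect_rectangle Il Ih)// /I2.
  rewrite muleC -(wait2_expect_rectangle Ih Il)//.
  by congr wait2_expect; apply/funext => -[a b] /=; rewrite !indicX mulrC.
- rewrite /wait2_expect (_ : (fun a => _) = cst 1).
    by rewrite (wait_expect1 Il) ltry.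
  by apply/funext => a; rewrite (wait_expect1 Ih).
Qed.

Lemma wait2_expect_gt y (r : R) : (0 <= r)%R ->
  wait2_expect lam h y (fun p => if r%:E < mine p.1 p.2 then 1 else 0) =
  (no_jump y r)%:E.
Proof.
move=> r0; rewrite /no_jump EFinM.
rewrite -(wait_law_gt Il)// -(wait_law_gt Ih)//.
rewrite -(wait2_expect_rectangle Il Ih); [|exact: emeasurable_itv..].
congr wait2_expect; apply/funext => -[a b].
rewrite indicX !indicE !mem_setE !in_itv/= !leey !andbT lt_min.
by case: (r%:E < a); case: (r%:E < b); rewrite ?mul0r ?mul1r.
Qed.

Lemma measurable_no_jump : measurable_fun setT (fun p : (nat * R) * R => no_jump p.1 p.2).
Proof. by apply: measurable_funM; exact: measurable_survival. Qed.

Lemma no_jump_ge0 y z : (0 <= no_jump y z)%R.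
Proof. by rewrite mulr_ge0// ltW// survival_gt0. Qed.

Lemma no_jump_le1 y z : (no_jump y z <= 1)%R.
Proof.
rewrite -[leRHS]mulr1; apply: ler_pM; [exact/ltW/survival_gt0|exact/ltW/survival_gt0| |].
  exact: (survival_le1 Il).
exact: (survival_le1 Ih).
Qed.

Lemma no_jump_ge y z : (0 <= z)%R -> (1 - 2 * C * z <= no_jump y z)%R.
Proof.
move=> z0.
have h1 := survival_ge Il y z0.
have h2 := survival_ge Ih y z0.
have h3 := survival_le1 Il y z; have h4 := survival_le1 Ih y z.
have h5 := survival_gt0 lam y z; have h6 := survival_gt0 h y z.
rewrite /no_jump; nra.
Qed.

Lemma no_jump_ge_expR y z : (0 <= z)%R -> (expR (- (2 * C * z)) <= no_jump y z)%R.
Proof.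
move=> z0; have -> : (- (2 * C * z) = - (C * z) + - (C * z))%R by ring.
rewrite expRD /no_jump ler_pM ?expR_ge0//; exact: survival_ge_expR.
Qed.

Lemma no_jumpD y a b : (0 <= a)%R -> (0 <= b)%R ->
  no_jump y (a + b) = (no_jump y a * no_jump (shift y a) b)%R.
Proof.
move=> a0 b0; rewrite /no_jump (survivalD Il y a0 b0) (survivalD Ih y a0 b0).
exact: mulrACA.
Qed.

Lemma measurable_jump_op {d} {T : measurableType d} (yy : T -> nat * R)
    (v : T * (nat * R) -> \bar R) :
  measurable_fun setT yy -> measurable_fun setT v ->
  measurable_fun setT (fun t => jump_op (fun y' => v (t, y')) (yy t)).
Proof.
move=> my mv; apply: emeasurable_funD; apply: emeasurable_funM.
- by apply/measurable_EFinP; exact: (measurableT_comp lam_meas).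
- apply: (measurableT_comp mv); apply: measurable_fun_pair => //.
  exact: (measurableT_comp measurable_up).
- by apply/measurable_EFinP; exact: (measurableT_comp h_meas).
- apply: (measurableT_comp mv); apply: measurable_fun_pair => //.
  exact: (measurableT_comp measurable_down).
Qed.

Lemma jump_op_ge0 v y : (forall y, 0 <= v y) -> 0 <= jump_op v y.
Proof. by move=> v0; rewrite adde_ge0// mule_ge0// lee_fin. Qed.

(** The first of the two candidate times has hazard rate [lam + h] along the
    flow, and given that time the jump goes up or down in proportion to the
    two intensities. *)
Lemma wait2_expect_step y (F : R * (nat * R) -> \bar R) :
  measurable_fun setT F -> (forall p, 0 <= F p) ->
  wait2_expect lam h y (fun p => if mine p.1 p.2 == +oo then 0 else
    F (fine (mine p.1 p.2), next_state y p.1 p.2)) =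
  \int[mu]_(z in `[0%R, +oo[)
    (jump_op (fun y' => F (z, y')) (shift y z) * (no_jump y z)%:E).
Proof.
move=> mF F0.
pose fu z := F (z, up (shift y z)); pose fd z := F (z, down (shift y z)).
have mshift : measurable_fun setT (shift y).
  exact: (measurable_fun_pair2 y (@measurable_shift R)).
have mfu : measurable_fun setT fu.
  apply: (measurableT_comp mF); apply: measurable_fun_pair => //.
  exact: (measurableT_comp measurable_up).
have mfd : measurable_fun setT fd.
  apply: (measurableT_comp mF); apply: measurable_fun_pair => //.
  exact: (measurableT_comp measurable_down).
pose A (p : \bar R * \bar R) : \bar R := if p.1 < p.2 then fu (fine p.1) else 0.
pose B (p : \bar R * \bar R) : \bar R :=
  if (p.2 <= p.1) && (p.2 < +oo) then fd (fine p.2) else 0.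
have mA : measurable_fun setT A.
  apply: measurable_fun_ifT.
  - exact: measurable_fun_lte.
  - apply: (measurableT_comp mfu); apply: measurableT_comp => //; exact: fine_measurable.
  - exact: measurable_cst.
have mB : measurable_fun setT B.
  apply: measurable_fun_ifT.
  - by apply: measurable_and; [exact: measurable_fun_lee|exact: measurable_fun_lte].
  - apply: (measurableT_comp mfd); apply: measurableT_comp => //; exact: fine_measurable.
  - exact: measurable_cst.
have A0 p : 0 <= A p by rewrite /A /fu; case: ifP.
have B0 p : 0 <= B p by rewrite /B /fd; case: ifP.
have mlam z : measurable_fun setT (fun z : R => (wait_density lam y z)%:E).
  by apply/measurable_EFinP; exact: (measurable_fun_pair2 y (measurable_wait_density Il)).
have mh z : measurable_fun setT (fun z : R => (wait_density h y z)%:E).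
  by apply/measurable_EFinP; exact: (measurable_fun_pair2 y (measurable_wait_density Ih)).
have -> : (fun p : \bar R * \bar R => if mine p.1 p.2 == +oo then 0 else
    F (fine (mine p.1 p.2), next_state y p.1 p.2)) = (fun p => A p + B p).
  apply/funext => -[a b]; rewrite /A /B /next_state /= /fu /fd.
  have [ab|ba] := ltP a b.
    by rewrite lt_eqF ?adde0//; apply: lt_le_trans ab _; exact: leey.
  by rewrite ltey add0e; case: eqP.
rewrite (posfunD (posfun_wait2_expect Il Ih y))//.
rewrite (wait2_expect_swap _ mB B0) /wait2_expect.
have -> : wait_expect lam y (fun a => wait_expect h y (fun b => A (a, b))) =
    \int[mu]_(z in `[0%R, +oo[)
      ((lam (shift y z))%:E * fu z * (no_jump y z)%:E).
  rewrite (@wait_expect_fine _ lam _ (fun z => fu z * (survival h y z)%:E)).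
  - apply: eq_integral => z _; rewrite wait_densityE /no_jump !EFinM.
    by rewrite [RHS]muleACA muleC.
  - move=> z z0; rewrite -(wait_expect_gt Ih)//.
    rewrite -(wait_expectZl Ih)//.
    + congr wait_expect; apply/funext => b; rewrite /A /=.
      by case: ifP; rewrite ?mule1 ?mule0.
    + by apply: F0.
    + by apply: measurable_fun_ifT => //; apply: measurable_fun_lte; mfun.
    + by move=> b; case: ifP.
  - rewrite (_ : (fun b => A (+oo, b)) = cst 0).
      exact: (posfun0 (posfun_wait_expect Ih y)).
    by apply/funext => b; rewrite /A /= ltNge leey.
have -> : wait_expect h y (fun b => wait_expect lam y (fun a => B (a, b))) =
    \int[mu]_(z in `[0%R, +oo[)
      ((h (shift y z))%:E * fd z * (no_jump y z)%:E).
  rewrite (@wait_expect_fine _ h _ (fun z => fd z * (survival lam y z)%:E)).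
  - apply: eq_integral => z _; rewrite wait_densityE /no_jump !EFinM.
    by rewrite [X in _ = _ * X]muleC [RHS]muleACA muleC.
  - move=> z z0; rewrite -(wait_expect_ge Il)//.
    rewrite -(wait_expectZl Il)//.
    + congr wait_expect; apply/funext => a; rewrite /B /= ltry andbT.
      by case: ifP; rewrite ?mule1 ?mule0.
    + by apply: F0.
    + by apply: measurable_fun_ifT => //; apply: measurable_fun_lee; mfun.
    + by move=> b; case: ifP.
  - rewrite (_ : (fun a => B (a, +oo)) = cst 0).
      exact: (posfun0 (posfun_wait_expect Il y)).
    by apply/funext => a; rewrite /B /= ltxx andbF.
have mflow (g : nat * R -> R) : measurable_fun setT g ->
    measurable_fun setT (fun z => (g (shift y z))%:E).
  by move=> mg; apply/measurable_EFinP; exact: (measurableT_comp mg).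
have mS : measurable_fun setT (fun z => (no_jump y z)%:E).
  by apply/measurable_EFinP; exact: (measurable_fun_pair2 y measurable_no_jump).
rewrite -ge0_integralD//.
- by apply: eq_integral => z _; rewrite /jump_op ge0_muleDl// mule_ge0// ?lee_fin//; exact: F0.
- by move=> z _; rewrite !mule_ge0 ?lee_fin ?no_jump_ge0//; exact: F0.
- by apply: measurable_funTS; do 2 (apply: emeasurable_funM => //); exact: mflow.
- by move=> z _; rewrite !mule_ge0 ?lee_fin ?no_jump_ge0//; exact: F0.
- by apply: measurable_funTS; do 2 (apply: emeasurable_funM => //); exact: mflow.
Qed.

End one_step.

(** * The jump chain and its past *)

Section chain_measurability.
Context {R : realType}.

Lemma measurable_next_state : measurable_fun setT
  (fun q : (nat * R) * (\bar R * \bar R) => next_state q.1 q.2.1 q.2.2).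
Proof.
have mfst : measurable_fun setT (fun q : (nat * R) * (\bar R * \bar R) => q.2.1) by mfun.
have msnd : measurable_fun setT (fun q : (nat * R) * (\bar R * \bar R) => q.2.2) by mfun.
have mshift (g : (nat * R) * (\bar R * \bar R) -> \bar R) : measurable_fun setT g ->
    measurable_fun setT (fun q => shift q.1 (fine (g q))).
  move=> mg; apply: (measurableT_comp (measurable_shift)
    (g := fun q => (q.1, fine (g q)))).
  apply: measurable_fun_pair; first by mfun.
  by apply: measurableT_comp => //; exact: fine_measurable.
apply: measurable_fun_ifT; [|by mfun|].
  rewrite (_ : (fun q => _) = (fun q : (nat * R) * (\bar R * \bar R) =>
      ~~ (mine q.2.1 q.2.2 < +oo)%E)); last first.
    by apply/funext => q; rewrite ltey negbK.
  by apply: measurable_neg; apply: measurable_fun_lte => //; exact: measurable_mine.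
apply: measurable_fun_ifT; first exact: measurable_fun_lte.
  by apply: (measurableT_comp measurable_up); exact: mshift.
by apply: (measurableT_comp measurable_down); exact: mshift.
Qed.

Context {d : measure_display} {T : measurableType d}.
Variables (x : nat * R) (u v : nat -> T -> \bar R).

Lemma measurable_jump_time k :
  (forall j, (j < k)%N -> measurable_fun setT (u j) /\ measurable_fun setT (v j)) ->
  measurable_fun setT (fun w => jump_time (u ^~ w) (v ^~ w) k).
Proof.
move=> uv; rewrite /jump_time.
rewrite (_ : (fun w => _) =
    (fun w => \sum_(i <- index_enum 'I_k) mine (u i w) (v i w))%E) //.
apply: emeasurable_sum => i.
by have [mu mv] := uv i (ltn_ord i); exact: measurable_mine.
Qed.

Lemma measurable_jump_state k :
  (forall j, (j < k)%N -> measurable_fun setT (u j) /\ measurable_fun setT (v j)) ->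
  measurable_fun setT (fun w => jump_state x (u ^~ w) (v ^~ w) k).
Proof.
elim: k => [_|k IH uv]; first exact: measurable_cst.
have [mu mv] := uv k (ltnSn k).
apply: (measurableT_comp measurable_next_state
  (g := fun w => (jump_state x (u ^~ w) (v ^~ w) k, (u k w, v k w)))).
apply: measurable_fun_pair; last exact: measurable_fun_pair.
by apply: IH => j jk; apply: uv; exact: ltnW.
Qed.

End chain_measurability.

Section chain_paths.
Context {R : realType}.
Variables (x : nat * R) (u v : nat -> \bar R).
Hypotheses (u0 : forall k, (0 <= u k)%E) (v0 : forall k, (0 <= v k)%E).

Lemma jump_time0 : jump_time u v 0 = 0%E.
Proof. by rewrite /jump_time big_ord0. Qed.

Lemma jump_timeS k : jump_time u v k.+1 = (jump_time u v k + mine (u k) (v k))%E.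
Proof. by rewrite /jump_time big_ord_recr. Qed.

Lemma mine_wait_ge0 k : (0 <= mine (u k) (v k))%E.
Proof. by rewrite le_min u0 v0. Qed.

Lemma jump_time_ge0 k : (0 <= jump_time u v k)%E.
Proof. by apply: sume_ge0 => i _; exact: mine_wait_ge0. Qed.

Lemma le_jump_timeS k : (jump_time u v k <= jump_time u v k.+1)%E.
Proof. by rewrite jump_timeS leeDl// mine_wait_ge0. Qed.

Lemma le_jump_time : {homo jump_time u v : j k / (j <= k)%N >-> (j <= k)%E}.
Proof.
by apply: homo_leq => [t|t1 t2 t3|k]; [exact: lexx|exact: le_trans|exact: le_jump_timeS].
Qed.

Lemma statespace_next_state (y : nat * R) a b : statespace y -> (0 <= a)%E -> (0 <= b)%E ->
  statespace (next_state y a b).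
Proof.
move=> sy a0 b0; rewrite /next_state; case: ifP => // _.
case: ifP => _; last exact: statespace_down.
by apply: statespace_up; apply: statespace_shift => //; exact: fine_ge0.
Qed.

Lemma statespace_jump_state k : statespace x -> statespace (jump_state x u v k).
Proof. by move=> sx; elim: k => //= k IH; exact: statespace_next_state. Qed.

End chain_paths.

Section chain_law.
Context {R : realType}.
Notation mu := (@lebesgue_measure R).
Variables (lam h : nat * R -> R) (C : R).
Hypotheses (Il : bounded_intensity C lam) (Ih : bounded_intensity C h).
Let lam_meas := intensity_meas Il. Let h_meas := intensity_meas Ih.
Let lam_ge0 := intensity_ge0 Il. Let h_ge0 := intensity_ge0 Ih.
Let lam_le := intensity_le Il. Let h_le := intensity_le Ih.
Context {d : measure_display} {Omega : measurableType d}.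
Variables (P : probability Omega R) (x : nat * R) (U V : nat -> Omega -> \bar R).
Hypothesis mUV : forall k, measurable_fun setT (U k) /\ measurable_fun setT (V k).
Hypothesis UV0 : forall k w, (0 <= U k w)%E /\ (0 <= V k w)%E.
Let U0 w k : (0 <= U k w)%E. Proof. by have [] := UV0 k w. Qed.
Let V0 w k : (0 <= V k w)%E. Proof. by have [] := UV0 k w. Qed.
Hypothesis UV_law : forall k (A B : set (\bar R)), measurable A -> measurable B ->
  is_cond_prob P (past U V k) (U k @^-1` A `&` V k @^-1` B)
    (fun w => let y := jump_state x (U ^~ w) (V ^~ w) k in
       wait_law lam y A * wait_law h y B)%E.
Local Open Scope ereal_scope.

Let T_ k w := jump_time (U ^~ w) (V ^~ w) k.
Let Y_ k w := jump_state x (U ^~ w) (V ^~ w) k.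
Let W_ k w := mine (U k w) (V k w).
Let Z_ k w := (fine (T_ k w), Y_ k w).

(** [past U V k] is the sigma-algebra of a measurable type, so that the closure properties of
    measurable functions hold with respect to the past. *)
Definition past_generators k : set (set Omega) :=
  [set E | exists j (B : set (\bar R)),
     [/\ (j < k)%N, measurable B & E = U j @^-1` B \/ E = V j @^-1` B]].

Definition pastType k := g_sigma_algebraType (past_generators k).

Lemma measurable_past_UV k j : (j < k)%N ->
  measurable_fun setT (U j : pastType k -> \bar R) /\
  measurable_fun setT (V j : pastType k -> \bar R).
Proof.
move=> jk; split => _ B mB; rewrite setTI; apply: sub_sigma_algebra.
  by exists j, B; split => //; left.
by exists j, B; split => //; right.
Qed.

Lemma measurable_past_time k : measurable_fun setT (T_ k : pastType k -> \bar R).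
Proof. by apply: measurable_jump_time => j; exact: measurable_past_UV. Qed.

Lemma measurable_past_state k : measurable_fun setT (Y_ k : pastType k -> nat * R).
Proof. by apply: measurable_jump_state => j; exact: measurable_past_UV. Qed.

Lemma measurable_past_point k : measurable_fun setT (Z_ k : pastType k -> R * (nat * R)).
Proof.
apply: measurable_fun_pair; last exact: measurable_past_state.
by apply: measurableT_comp; [exact: fine_measurable|exact: measurable_past_time].
Qed.

Lemma measurable_time k : measurable_fun setT (T_ k).
Proof. by apply: measurable_jump_time => j _; exact: mUV. Qed.

Lemma measurable_state k : measurable_fun setT (Y_ k).
Proof. by apply: measurable_jump_state => j _; exact: mUV. Qed.

Lemma measurable_point k : measurable_fun setT (Z_ k).
Proof.
apply: measurable_fun_pair; last exact: measurable_state.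
by apply: measurableT_comp; [exact: fine_measurable|exact: measurable_time].
Qed.

Lemma sub_past k : past U V k `<=` measurable.
Proof.
apply: smallest_sub; first exact: sigma_algebra_measurable.
move=> E [j [B [_ mB]]]; have [mU mV] := mUV j.
by case=> ->; rewrite -[_ @^-1` _]setTI; [exact: mU|exact: mV].
Qed.

Lemma past_S k : past U V k `<=` past U V k.+1.
Proof.
apply: smallest_sub; first exact: smallest_sigma_algebra.
move=> E [j [B [jk mB EB]]]; apply: sub_sigma_algebra.
by exists j, B; split => //; exact: ltnW.
Qed.

Lemma pastI k A B : past U V k A -> past U V k B -> past U V k (A `&` B).
Proof. exact: (@measurableI _ (pastType k)). Qed.

Lemma past_point k (D : set (R * (nat * R))) : measurable D -> past U V k (Z_ k @^-1` D).
Proof.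
by move=> mD; have := @measurable_past_point k measurableT D mD; rewrite setTI.
Qed.

Lemma past_time k (D : set (\bar R)) : measurable D -> past U V k (T_ k @^-1` D).
Proof.
by move=> mD; have := @measurable_past_time k measurableT D mD; rewrite setTI.
Qed.

Lemma past_time_le k (s : R) : past U V k [set w | T_ k w <= s%:E].
Proof.
have := @past_time k `]-oo, s%:E] (emeasurable_itv _).
congr (past U V k _); apply/seteqP; split => w /=; by rewrite in_itv.
Qed.

(** The conditional law of the candidate times drawn at step [k], in integrated form. *)
Lemma past_freezing k G (F : (R * (nat * R)) * (\bar R * \bar R) -> \bar R) :
  past U V k G -> measurable_fun setT F -> (forall p, 0 <= F p) ->
  \int[P]_(w in G) F (Z_ k w, (U k w, V k w)) =
  \int[P]_(w in G) wait2_expect lam h (Y_ k w) (fun p => F (Z_ k w, p)).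
Proof.
move=> pG mF F0; have [mU mV] := mUV k.
apply: (@freezing _ lam h C Il Ih _ _ _ _ P
  (Z_ k) snd (U k) (V k) G _ _ _ mU mV) => //.
- exact: sub_past pG.
- exact: measurable_point.
- move=> D A B mD mA mB; have [_ _ ->//] := UV_law k mA mB.
  by apply: pastI => //; exact: past_point.
Qed.

(** The threshold [r] may depend on the past: in the applications it is the time left from the
    last jump to a fixed time. *)
Lemma chain_tail k G (r : R * (nat * R) -> R) (f : R * (nat * R) -> \bar R) :
  past U V k G -> measurable_fun setT r -> (forall z, (0 <= r z)%R) ->
  measurable_fun setT f -> (forall z, 0 <= f z) ->
  \int[P]_(w in G) (if (r (Z_ k w))%:E < W_ k w then f (Z_ k w) else 0) =
  \int[P]_(w in G) (f (Z_ k w) * (no_jump lam h (Y_ k w) (r (Z_ k w)))%:E).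
Proof.
move=> pG mr r0 mf f0.
have mW : measurable_fun setT (fun p : (R * (nat * R)) * (\bar R * \bar R) => mine p.2.1 p.2.2).
  by apply: measurable_mine; mfun.
have mrE : measurable_fun setT (fun p : (R * (nat * R)) * (\bar R * \bar R) => (r p.1)%:E).
  by apply/measurable_EFinP; apply: (measurableT_comp mr); mfun.
have := @past_freezing k G (fun p => f p.1 * (if (r p.1)%:E < mine p.2.1 p.2.2 then 1 else 0)) pG.
rewrite (eq_integral (fun w => if (r (Z_ k w))%:E < W_ k w then f (Z_ k w) else 0)); last first.
  by move=> w _ /=; rewrite /W_; case: ifP; rewrite ?mule1 ?mule0.
move=> ->.
- apply: eq_integral => w _; rewrite -(wait2_expect_gt Il Ih)//.
  rewrite -(wait2_expectZl Il Ih)//.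
  + by apply: measurable_fun_ifT => //; apply: measurable_fun_lte => //; apply: measurable_mine; mfun.
  + by move=> p; case: ifP.
- apply: emeasurable_funM; first by apply: (measurableT_comp mf); mfun.
  by apply: measurable_fun_ifT => //; exact: measurable_fun_lte.
- by move=> p; rewrite mule_ge0//; case: ifP.
Qed.

Lemma chain_step k G (F : (R * (nat * R)) * (R * (nat * R)) -> \bar R) :
  past U V k G -> measurable_fun setT F -> (forall p, 0 <= F p) ->
  \int[P]_(w in G) (if W_ k w == +oo then 0 else F (Z_ k w, (fine (W_ k w), Y_ k.+1 w))) =
  \int[P]_(w in G) \int[mu]_(z in `[0%R, +oo[)
    (jump_op lam h (fun y => F (Z_ k w, (z, y))) (shift (Y_ k w) z) *
     (no_jump lam h (Y_ k w) z)%:E).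
Proof.
move=> pG mF F0.
pose F' p := if mine p.2.1 p.2.2 == +oo then 0 else
  F (p.1, (fine (mine p.2.1 p.2.2), next_state p.1.2 p.2.1 p.2.2)).
have mW : measurable_fun setT (fun p : (R * (nat * R)) * (\bar R * \bar R) => mine p.2.1 p.2.2).
  by apply: measurable_mine; mfun.
have := @past_freezing k G F' pG; rewrite /F'/=.
rewrite (eq_integral (fun w => if W_ k w == +oo then 0 else F (Z_ k w, (fine (W_ k w), Y_ k.+1 w)))) // => ->.
- apply: eq_integral => w _.
  have mFw := measurable_fun_pair2 (Z_ k w) mF.
  by rewrite -(wait2_expect_step Il Ih _ mFw).
- apply: measurable_fun_ifT => //.
    rewrite (_ : (fun q => _) = (fun q : (R * (nat * R)) * (\bar R * \bar R) =>
        ~~ (mine q.2.1 q.2.2 < +oo)%E)); last first.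
      by apply/funext => q; rewrite ltey negbK.
    by apply: measurable_neg; apply: measurable_fun_lte.
  apply: (measurableT_comp mF); apply: measurable_fun_pair; first by mfun.
  apply: measurable_fun_pair.
    by apply: measurableT_comp => //; exact: fine_measurable.
  apply: (measurableT_comp measurable_next_state
    (g := fun q : (R * (nat * R)) * (\bar R * \bar R) => (q.1.2, q.2))).
  by mfun.
- by move=> p; case: ifP.
Qed.

End chain_law.

(** * The transition function *)

Lemma integral_ite {d} {T : measurableType d} {R : realType}
    (m : {measure set T -> \bar R}) (D : set T) (p : T -> bool) (f : T -> \bar R) :
  (\int[m]_(t in D) (if p t then f t else 0) = \int[m]_(t in D `&` [set t | p t]) f t)%E.
Proof.
rewrite integral_mkcondr; apply: eq_integral => t _; rewrite /patch.
case: ifPn => pt; first by rewrite mem_set.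
by rewrite memNset//=; exact/negP.
Qed.

Section transition_function.
Context {R : realType}.
Notation mu := (@lebesgue_measure R).
Variables (lam h : nat * R -> R) (C : R).
Hypotheses (Il : bounded_intensity C lam) (Ih : bounded_intensity C h).
Let lam_meas := intensity_meas Il. Let h_meas := intensity_meas Ih.
Let lam_ge0 := intensity_ge0 Il. Let h_ge0 := intensity_ge0 Ih.
Let lam_le := intensity_le Il. Let h_le := intensity_le Ih.
Variable f : nat * R -> \bar R.
Hypotheses (mf : measurable_fun setT f) (f0 : forall y, (0 <= f y)%E).
Local Open Scope ereal_scope.

Definition renewal (v : R * (nat * R) -> \bar R) (p : R * (nat * R)) : \bar R :=
  f (shift p.2 p.1) * (no_jump lam h p.2 p.1)%:E +
  \int[mu]_(z in `[0%R, p.1])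
    (jump_op lam h (fun y => v (p.1 - z, y)%R) (shift p.2 z) *
     (no_jump lam h p.2 z)%:E).

(** The expectation of [f] at time [p.1] from the state [p.2], restricted to the
    paths with fewer than [k] jumps before that time. *)
Fixpoint expect_upto (k : nat) : R * (nat * R) -> \bar R :=
  if k is j.+1 then renewal (expect_upto j) else cst 0.

Definition transition (p : R * (nat * R)) : \bar R :=
  limn (fun k => expect_upto k p).

Lemma measurable_renewal_integrand (v : R * (nat * R) -> \bar R) : measurable_fun setT v ->
  measurable_fun setT (fun q : (R * (nat * R)) * R =>
    jump_op lam h (fun y => v (q.1.1 - q.2, y)%R) (shift q.1.2 q.2) *
    (no_jump lam h q.1.2 q.2)%:E).
Proof.
move=> mv; apply: emeasurable_funM.
  apply: (measurable_jump_op Il Ih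
    (v := fun q : ((R * (nat * R)) * R) * (nat * R) => v (q.1.1.1 - q.1.2, q.2)%R)).
    by apply: (measurableT_comp measurable_shift
      (g := fun q : (R * (nat * R)) * R => (q.1.2, q.2))); mfun.
  by apply: (measurableT_comp mv); mfun.
apply/measurable_EFinP; apply: (measurableT_comp (measurable_no_jump Il Ih)
  (g := fun q : (R * (nat * R)) * R => (q.1.2, q.2))); mfun.
Qed.

Lemma renewal_integrand_ge0 (v : nat * R -> \bar R) y y' z : (forall q, 0 <= v q) ->
  0 <= jump_op lam h v y * (no_jump lam h y' z)%:E.
Proof. by move=> v0; rewrite mule_ge0 ?lee_fin ?no_jump_ge0//; exact: jump_op_ge0. Qed.

Lemma renewal_ge0 v p : (forall q, 0 <= v q) -> 0 <= renewal v p.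
Proof.
move=> v0; apply: adde_ge0; first by rewrite mule_ge0// lee_fin no_jump_ge0.
by apply: integral_ge0 => z _; exact: renewal_integrand_ge0.
Qed.

Lemma measurable_renewal v : measurable_fun setT v -> (forall q, 0 <= v q) ->
  measurable_fun setT (renewal v).
Proof.
move=> mv v0; apply: emeasurable_funD.
  apply: emeasurable_funM.
    apply: (measurableT_comp mf).
    by apply: (measurableT_comp measurable_shift (g := fun p : R * (nat * R) => (p.2, p.1))); mfun.
  apply/measurable_EFinP.
  apply: (measurableT_comp (measurable_no_jump Il Ih)
    (g := fun p : R * (nat * R) => (p.2, p.1))); mfun.
apply: (measurable_fun_integral_segment (a := cst 0%R) (b := fst)
  _ _ (measurable_renewal_integrand mv)) => //.
by move=> q; exact: renewal_integrand_ge0.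
Qed.

Lemma expect_upto_ge0 k p : 0 <= expect_upto k p.
Proof. by elim: k p => //= k IH p; exact: renewal_ge0. Qed.

Lemma measurable_expect_upto k : measurable_fun setT (expect_upto k).
Proof.
elim: k => //= k IH; apply: measurable_renewal => //.
exact: expect_upto_ge0.
Qed.

Let mint (v : R * (nat * R) -> \bar R) (p : R * (nat * R)) : measurable_fun setT v ->
  measurable_fun `[0%R, p.1] (fun z : R => jump_op lam h (fun y => v (p.1 - z, y)%R)
    (shift p.2 z) * (no_jump lam h p.2 z)%:E).
Proof.
move=> mv; apply: measurable_funTS.
exact: (measurable_fun_pair2 p (measurable_renewal_integrand mv)).
Qed.

Lemma le_jump_op v v' y : (forall y, v y <= v' y) -> jump_op lam h v y <= jump_op lam h v' y.
Proof. by move=> vv; apply: leeD; rewrite lee_wpmul2l// lee_fin. Qed.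

Lemma expect_upto_nd p : {homo expect_upto ^~ p : j k / (j <= k)%N >-> j <= k}.
Proof.
apply: homo_leq => [t|t1 t2 t3|k]; [exact: lexx|exact: le_trans|].
elim: k p => [|k IH] p; first by apply: (expect_upto_ge0 1).
rewrite [leLHS]/= /renewal [leRHS]/= /renewal leeD2l//.
apply: ge0_le_integral => //.
- by move=> z _; apply: renewal_integrand_ge0 => ?; exact: expect_upto_ge0.
- exact: (@mint _ p (measurable_expect_upto k)).
- exact: (@mint _ p (measurable_expect_upto k.+1)).
- move=> z _; rewrite lee_wpmul2r// ?lee_fin ?no_jump_ge0//.
  by apply: le_jump_op => y; exact: (IH (_, _)).
Qed.

Lemma cvg_expect_upto p : expect_upto k p @[k --> \oo] --> transition p.
Proof. exact/ereal_nondecreasing_is_cvgn/expect_upto_nd. Qed.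

Lemma transition_ge0 p : 0 <= transition p.
Proof.
apply: lime_ge; first exact: cvg_expect_upto.
by apply: nearW => k; exact: expect_upto_ge0.
Qed.

Lemma measurable_transition : measurable_fun setT transition.
Proof.
apply: (emeasurable_fun_cvg expect_upto); first exact: measurable_expect_upto.
by move=> p _; exact: cvg_expect_upto.
Qed.

Lemma cvg_jump_op (v_ : nat -> nat * R -> \bar R) v y :
  (forall n y, 0 <= v_ n y) ->
  (forall y, v_ n y @[n --> \oo] --> v y) ->
  jump_op lam h (v_ n) y @[n --> \oo] --> jump_op lam h v y.
Proof.
move=> v0 cv.
have vl0 y' : 0 <= v y'.
  rewrite -(cvg_lim _ (cv y'))//; apply: lime_ge; last exact: nearW.
  by apply/cvg_ex; exists (v y').
apply: cvgeD; [|exact: cvgeZl|exact: cvgeZl].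
by apply: ge0_adde_def; rewrite inE mule_ge0// lee_fin.
Qed.

(** The renewal operator is continuous along increasing sequences, so the limit of its iterates
    is a fixed point. *)
Lemma transition_renewal p : transition p = renewal transition p.
Proof.
have cS : expect_upto k.+1 p @[k --> \oo] --> transition p.
  by rewrite (cvg_shiftS (fun k => expect_upto k p)); exact: cvg_expect_upto.
rewrite -(cvg_lim _ cS)//; apply/cvg_lim => //.
rewrite /= /renewal; apply: cvgeD.
- apply: ge0_adde_def; rewrite inE; first by rewrite mule_ge0// lee_fin no_jump_ge0.
  apply: integral_ge0 => z _; apply: renewal_integrand_ge0 => ?; exact: transition_ge0.
- exact: cvg_cst.
have cz (z : R) : jump_op lam h (fun y => expect_upto k (p.1 - z, y)%R) (shift p.2 z) *
    (no_jump lam h p.2 z)%:E @[k --> \oo] -->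
    jump_op lam h (fun y => transition (p.1 - z, y)%R) (shift p.2 z) *
    (no_jump lam h p.2 z)%:E.
  apply: cvgeZr => //; apply: cvg_jump_op => [n y|y]; first exact: expect_upto_ge0.
  exact: cvg_expect_upto.
rewrite [X in _ --> X](_ : _ = \int[mu]_(z in `[0%R, p.1]) limn (fun k =>
    jump_op lam h (fun y => expect_upto k (p.1 - z, y)%R) (shift p.2 z) *
    (no_jump lam h p.2 z)%:E)); last first.
  by apply: eq_integral => z _; apply/esym/cvg_lim.
apply: cvg_monotone_convergence => //.
- by move=> n; exact: (@mint _ p (measurable_expect_upto n)).
- move=> n z _; apply: renewal_integrand_ge0 => ?; exact: expect_upto_ge0.
- move=> z _ n m nm; rewrite lee_wpmul2r// ?lee_fin ?no_jump_ge0//.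
  by apply: le_jump_op => y; exact: expect_upto_nd.
Qed.

(** As [no_jump] is multiplicative along the flow, the part of the renewal equation that lies
    after time [r] is a renewal equation from the state reached at [r]. *)
Lemma renewal_shift (r s : R) y (v := transition) : (0 <= r)%R -> (0 <= s)%R ->
  f (shift y (r + s)) * (no_jump lam h y (r + s))%:E +
  \int[mu]_(z in `[r, (r + s)%R])
    (jump_op lam h (fun y' => v (r + s - z, y')%R) (shift y z) * (no_jump lam h y z)%:E) =
  transition (s, shift y r) * (no_jump lam h y r)%:E.
Proof.
move=> r0 s0; rewrite [in RHS]transition_renewal /renewal /=.
rewrite ge0_muleDl; last 2 first.
- by rewrite mule_ge0// lee_fin no_jump_ge0.
- apply: integral_ge0 => z _; apply: renewal_integrand_ge0 => ?; exact: transition_ge0.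
apply: (f_equal2 (fun a b => a + b)).
  rewrite shift_shift -muleA -EFinM; congr (_ * _%:E).
  by rewrite (no_jumpD Il Ih y r0 s0) mulrC.
rewrite muleC -ge0_integralZl//; last 3 first.
- exact: (@mint v (s, shift y r) measurable_transition).
- move=> z _; apply: renewal_integrand_ge0 => ?; exact: transition_ge0.
- by rewrite lee_fin no_jump_ge0.
rewrite -[X in `[X, _]](addr0 r) ge0_integral_translate; last 2 first.
- exact: (measurable_fun_pair2 ((r + s)%R, y) (measurable_renewal_integrand measurable_transition)).
- move=> z; apply: renewal_integrand_ge0 => ?; exact: transition_ge0.
apply: eq_integral => z; rewrite inE/= in_itv/= => /andP[z0 _].
rewrite muleCA; congr (_ * _).
  rewrite shift_shift; congr jump_op; apply/funext => y'; congr (v (_, _)); ring.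
rewrite -EFinM; congr EFin.
by rewrite (no_jumpD Il Ih y r0 z0).
Qed.

End transition_function.

(** * The Markov property at deterministic times *)

Section process_law.
Context {R : realType}.
Notation mu := (@lebesgue_measure R).
Variables (lam h : nat * R -> R) (C : R).
Hypotheses (Il : bounded_intensity C lam) (Ih : bounded_intensity C h).
Let lam_meas := intensity_meas Il. Let h_meas := intensity_meas Ih.
Let lam_ge0 := intensity_ge0 Il. Let h_ge0 := intensity_ge0 Ih.
Let lam_le := intensity_le Il. Let h_le := intensity_le Ih.
Context {d : measure_display} {Omega : measurableType d}.
Variables (P : probability Omega R) (x : nat * R) (U V : nat -> Omega -> \bar R).
Hypothesis mUV : forall k, measurable_fun setT (U k) /\ measurable_fun setT (V k).
Hypothesis UV0 : forall k w, (0 <= U k w)%E /\ (0 <= V k w)%E.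
Hypothesis UV_law : forall k (A B : set (\bar R)), measurable A -> measurable B ->
  is_cond_prob P (past U V k) (U k @^-1` A `&` V k @^-1` B)
    (fun w => let y := jump_state x (U ^~ w) (V ^~ w) k in
       wait_law lam y A * wait_law h y B)%E.
Variable X : R -> Omega -> nat * R.
Hypothesis mX : forall t, 0 <= t -> measurable_fun setT (X t).
Hypothesis X_follows : {ae P, forall w, follows_jumps x (U ^~ w) (V ^~ w) (X ^~ w)}.
Local Open Scope ereal_scope.

Let T_ k w := jump_time (U ^~ w) (V ^~ w) k.
Let Y_ k w := jump_state x (U ^~ w) (V ^~ w) k.
Let W_ k w := mine (U k w) (V k w).
Let Z_ k w := (fine (T_ k w), Y_ k w).

Let U0 w k : 0 <= U k w. Proof. by have [] := UV0 k w. Qed.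
Let V0 w k : 0 <= V k w. Proof. by have [] := UV0 k w. Qed.
Let mT k : measurable_fun setT (T_ k). Proof. exact: measurable_time. Qed.
Let mY k : measurable_fun setT (Y_ k). Proof. exact: measurable_state. Qed.
Let mZ k : measurable_fun setT (Z_ k). Proof. exact: measurable_point. Qed.
Let mW k : measurable_fun setT (W_ k).
Proof. by have [mU mV] := mUV k; exact: measurable_mine. Qed.
Let T0 k w : 0 <= T_ k w.
Proof. by apply: jump_time_ge0 => i; [exact: U0|exact: V0]. Qed.
Let TS k w : T_ k.+1 w = T_ k w + W_ k w. Proof. exact: jump_timeS. Qed.
Let leT w j k : (j <= k)%N -> T_ j w <= T_ k w.
Proof. by apply: le_jump_time => i; [exact: U0|exact: V0]. Qed.
Let tail k G (r : R * (nat * R) -> R) (f : R * (nat * R) -> \bar R) :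
  past U V k G -> measurable_fun setT r -> (forall z, (0 <= r z)%R) ->
  measurable_fun setT f -> (forall z, 0 <= f z) ->
  \int[P]_(w in G) (if (r (Z_ k w))%:E < W_ k w then f (Z_ k w) else 0) =
  \int[P]_(w in G) (f (Z_ k w) * (no_jump lam h (Y_ k w) (r (Z_ k w)))%:E).
Proof. exact: (chain_tail Il Ih mUV UV_law). Qed.

Let step k G (F : (R * (nat * R)) * (R * (nat * R)) -> \bar R) :
  past U V k G -> measurable_fun setT F -> (forall p, 0 <= F p) ->
  \int[P]_(w in G) (if W_ k w == +oo then 0 else F (Z_ k w, (fine (W_ k w), Y_ k.+1 w))) =
  \int[P]_(w in G) \int[mu]_(z in `[0%R, +oo[)
    (jump_op lam h (fun y => F (Z_ k w, (z, y))) (shift (Y_ k w) z) *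
     (no_jump lam h (Y_ k w) z)%:E).
Proof. exact: (chain_step Il Ih mUV UV_law). Qed.

Let past_m k G : past U V k G -> measurable G.
Proof. by move=> pG; exact: (sub_past mUV pG). Qed.

Let mT_le k (s : R) : measurable [set w | T_ k w <= s%:E].
Proof. by rewrite -[X in measurable X]setTI; exact: measurable_lee. Qed.

Let T_fin j w (s : R) : T_ j w <= s%:E -> T_ j w = (fine (T_ j w))%:E.
Proof.
move=> Ts; rewrite fineK// ge0_fin_numE//.
exact: le_lt_trans Ts (ltry _).
Qed.

(** Given the past, each step lasts longer than [t] with probability at least
    [expR (- (2 * C * t))]. *)
Lemma prob_jump_time_le k (t : R) : (0 <= t)%R ->
  P [set w | T_ k w <= t%:E] <= ((1 - expR (- (2 * C * t))) ^+ k)%:E.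
Proof.
move=> t0; set e := expR _.
have e1 : (e <= 1)%R.
  rewrite -expR0 ler_expR oppr_le0 !mulr_ge0//.
  exact: le_trans (lam_ge0 (0%N, 0%R)) (lam_le _).
have e0 : (0 < e)%R := expR_gt0 _.
elim: k => [|k IH]; first by rewrite expr0 probability_le1//; exact: mT_le.
pose G := [set w | T_ k w <= t%:E].
have pG : past U V k G by exact: past_time_le.
have mG := past_m pG.
have mGt : measurable (G `&` [set w | t%:E < W_ k w]).
  by apply: measurableI => //; rewrite -[X in measurable X]setTI; exact: measurable_lte.
have mGc : measurable (G `&` [set w | W_ k w <= t%:E]).
  by apply: measurableI => //; rewrite -[X in measurable X]setTI; exact: measurable_lee.
have PG : P G = P (G `&` [set w | W_ k w <= t%:E]) + P (G `&` [set w | t%:E < W_ k w]).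
  rewrite -measureU//.
    by congr (P _); apply/seteqP; split => [w Gw|w [[]|[]]//] /=;
      case: (leP (W_ k w) t%:E) => ?; [left|right].
  by rewrite -subset0 => w [[_ /= a] [_ /= b]]; have := lt_le_trans b a; rewrite ltxx.
have tailG : e%:E * P G <= P (G `&` [set w | t%:E < W_ k w]).
  have -> : P (G `&` [set w | t%:E < W_ k w]) =
      \int[P]_(w in G) (1 * (no_jump lam h (Y_ k w) t)%:E).
    rewrite -(tail pG (measurable_cst t) (fun=> t0) (measurable_cst (1 : \bar R)) (fun=> lee01)).
    by rewrite integral_ite integral_cst ?mul1e.
  rewrite -integral_cst//; apply: ge0_le_integral => //.
  - by move=> w _; rewrite lee_fin ltW.
  - apply: measurable_funTS; under eq_fun do rewrite mul1e.
    apply/measurable_EFinP; apply: (measurableT_comp (measurable_no_jump Il Ih)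
      (g := fun w => (Y_ k w, t))); exact: measurable_fun_pair.
  - by move=> w _; rewrite mul1e lee_fin; exact: (no_jump_ge_expR Il Ih).
apply: (@le_trans _ _ (P (G `&` [set w | W_ k w <= t%:E]))).
  apply: le_measure; rewrite ?inE//.
  move=> w /=; rewrite TS => Ht; split.
    by apply: le_trans Ht; rewrite leeDl// le_min U0 V0.
  by apply: le_trans Ht; rewrite leeDr.
have fG : P G \is a fin_num by exact: fin_num_measure.
have -> : P (G `&` [set w | W_ k w <= t%:E]) = P G - P (G `&` [set w | t%:E < W_ k w]).
  by rewrite PG addeK// fin_num_measure.
rewrite exprS EFinM; apply: (@le_trans _ _ ((1 - e)%:E * P G)).
  rewrite EFinB muleBl//; first by rewrite mul1e leeB.
by rewrite lee_wpmul2l// lee_fin subr_ge0.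
Qed.

Lemma nonexplosion : {ae P, forall w, forall t : R, exists k, t%:E < T_ k w}.
Proof.
pose B (n : nat) := \bigcap_k [set w | T_ k w <= n%:R%:E].
have mB n : measurable (B n).
  by apply: bigcapT_measurable => k; exact: mT_le.
have B0 n : P (B n) = 0.
  pose e := expR (- (2 * C * n%:R)).
  have e0 : (0 < e)%R := expR_gt0 _.
  have le k : (fine (P (B n)) <= (1 - e) ^+ k)%R.
    rewrite -lee_fin fineK ?fin_num_measure//.
    apply: le_trans (prob_jump_time_le k (ler0n R n)).
    by apply: le_measure; rewrite ?inE//; exact: bigcap_inf.
  have e1 : (e <= 1)%R.
    by have := le 1%N; rewrite expr1 => /(le_trans (fine_ge0 _)) h1; rewrite -subr_ge0; exact: h1.
  have c0 : ((1 - e) ^+ k @[k --> \oo] --> (0 : R))%R.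
    by apply: cvg_expr; rewrite ger0_norm ?subr_ge0// ltrBlDr ltrDl.
  have : (fine (P (B n)) <= 0)%R.
    rewrite -(cvg_lim _ c0)//; apply: limr_ge; last exact: nearW.
    by apply/cvg_ex; exists 0%R.
  move=> p0; apply/eqP; rewrite -measure_le0 -[X in X <= _]fineK ?fin_num_measure//.
exists (\bigcup_n B n); split.
- exact: bigcupT_measurable.
- apply/eqP; rewrite -measure_le0.
  apply: le_trans (generalized_Boole_inequality _ _ _) _ => //; first exact: bigcupT_measurable.
  by rewrite eseries0// => n _ _; exact: B0.
- move=> w /= H.
  have [t Ht] : exists t : R, forall k, T_ k w <= t%:E.
    move/existsNP : H => [t /forallNP Ht]; exists t => k.
    by rewrite leNgt; apply/negP; exact: Ht.
  exists (Num.bound t) => // k _ /=.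
  apply: le_trans (Ht k) _; rewrite lee_fin.
  have t0 : (0 <= t)%R by rewrite -lee_fin; apply: le_trans (Ht 0%N).
  by apply/ltW/archi_boundP.
Qed.

Lemma cvg_before_jumps G (t : R) (f : Omega -> \bar R) (j : nat) : measurable G ->
  measurable_fun setT f -> (forall w, 0 <= f w) ->
  \int[P]_(w in G) (if t%:E < T_ (j + k)%N w then f w else 0) @[k --> \oo] -->
  \int[P]_(w in G) f w.
Proof.
move=> mG mf f0.
have mlt k : measurable_fun setT (fun w => t%:E < T_ k w) by exact: measurable_fun_lte.
have mg k : measurable_fun G (fun w => if t%:E < T_ (j + k)%N w then f w else 0).
  by apply: measurable_funTS; apply: measurable_fun_ifT.
have g0 k w : 0 <= (if t%:E < T_ (j + k)%N w then f w else 0) by case: ifP.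
have gnd w : {homo (fun k => if t%:E < T_ (j + k)%N w then f w else 0) : m n / (m <= n)%N >-> m <= n}.
  move=> m n mn; case: ifPn => tm; last by case: ifP.
  by rewrite (lt_le_trans tm)//; apply: leT; rewrite leq_add2l.
have -> : \int[P]_(w in G) f w =
    \int[P]_(w in G) limn (fun k => if t%:E < T_ (j + k)%N w then f w else 0).
  apply: ae_eq_integral => //; first exact: measurable_funTS.
    apply: (emeasurable_fun_cvg (fun k w => if t%:E < T_ (j + k)%N w then f w else 0)) => //.
    by move=> w _; apply: ereal_nondecreasing_is_cvgn.
  have := nonexplosion; apply: filterS => w /(_ t)[k tk] _.
  apply/esym/cvg_lim => //; apply: cvg_near_cst.
  exists k => // m /= km; rewrite (lt_le_trans tk)//; apply: leT.
  exact: leq_trans km (leq_addl _ _).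
by apply: cvg_monotone_convergence => // w _; exact: gnd.
Qed.

Section expectations.
Variable f : nat * R -> \bar R.
Hypotheses (mf : measurable_fun setT f) (f0 : forall y, 0 <= f y).
Let mfX (s : R) : (0 <= s)%R -> measurable_fun setT (fun w => f (X s w)).
Proof. by move=> s0; apply: (measurableT_comp mf); exact: mX. Qed.
Notation p_ := (transition lam h f).
Let mp : measurable_fun setT p_. Proof. exact: measurable_transition. Qed.
Let p0 q : 0 <= p_ q. Proof. exact: transition_ge0. Qed.

Let measurable_remaining (s : R) j :
  measurable_fun setT (fun w => (s - fine (T_ j w), Y_ j w)%R).
Proof.
apply: measurable_fun_pair => //; apply: measurable_funB => //.
by apply: measurableT_comp => //; exact: fine_measurable.
Qed.

Let lt_TS j w (s : R) : T_ j w <= s%:E ->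
  (s%:E < T_ j.+1 w) = ((s - fine (T_ j w))%:E < W_ j w).
Proof.
move=> Ts; rewrite TS (T_fin Ts) /= EFinB lteBlDl//.
Qed.

Lemma no_jump_part j G (s : R) : past U V j G -> (forall w, G w -> T_ j w <= s%:E) ->
  (0 <= s)%R ->
  \int[P]_(w in G) (if s%:E < T_ j.+1 w then f (X s w) else 0) =
  \int[P]_(w in G) (f (shift (Y_ j w) (s - fine (T_ j w))) *
    (no_jump lam h (Y_ j w) (s - fine (T_ j w)))%:E).
Proof.
move=> pG GT s0; have mG := past_m pG.
pose r (z : R * (nat * R)) : R := (if 0 <= s - z.1 then s - z.1 else 0)%R.
have rE w : G w -> r (Z_ j w) = (s - fine (T_ j w))%R.
  move=> Gw; rewrite /r/= subr_ge0 -lee_fin -(T_fin (GT _ Gw)).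
  by rewrite GT.
have mr : measurable_fun setT r by apply: measurable_fun_ifT; mfun.
have r0 z : (0 <= r z)%R by rewrite /r; case: ifP.
have mfr : measurable_fun setT (fun z : R * (nat * R) => f (shift z.2 (r z))).
  apply: (measurableT_comp mf).
  by apply: (measurableT_comp measurable_shift (g := fun z => (z.2, r z))); mfun.
rewrite [RHS](eq_integral (fun w => f (shift (Z_ j w).2 (r (Z_ j w))) *
    (no_jump lam h (Y_ j w) (r (Z_ j w)))%:E)); last first.
  by move=> w; rewrite inE => Gw; rewrite rE.
rewrite -(tail pG mr r0 mfr (fun=> f0 _)).
apply: ae_eq_integral => //.
- apply: measurable_funTS; apply: measurable_fun_ifT => //; last exact: mfX.
  exact: measurable_fun_lte.
- apply: measurable_funTS; apply: measurable_fun_ifT => //.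
    apply: measurable_fun_lte => //; apply/measurable_EFinP.
    exact: (measurableT_comp mr).
  exact: (measurableT_comp mfr).
- move: X_follows; apply: filterS => w Xw Gw.
  rewrite rE// -lt_TS; last exact: GT.
  case: ifPn => // sT; congr f; rewrite (Xw j)// sT andbT; exact: GT.
Qed.

(** The next jump restarts the process. The bound [t] from below serves the Markov property, where
    that jump comes after the present time [t]. *)
Lemma jump_part j G (t s : R) (phi : Omega -> \bar R) (v : R * (nat * R) -> \bar R)
    (E := G `&` [set w | t%:E < T_ j.+1 w <= s%:E]) :
  past U V j G -> (forall w, G w -> T_ j w <= s%:E) ->
  measurable_fun setT v -> (forall q, 0 <= v q) ->
  \int[P]_(w in E) phi w = \int[P]_(w in E) v (s - fine (T_ j.+1 w), Y_ j.+1 w)%R ->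
  \int[P]_(w in G) (if t%:E < T_ j.+1 w <= s%:E then phi w else 0) =
  \int[P]_(w in G) \int[mu]_(z in `[0%R, +oo[ `&`
      [set z | (t < fine (T_ j w) + z <= s)%R])
    (jump_op lam h (fun y => v (s - fine (T_ j w) - z, y)%R) (shift (Y_ j w) z) *
     (no_jump lam h (Y_ j w) z)%:E).
Proof.
move=> pG GT mv v0 Ev; rewrite integral_ite Ev -integral_ite.
pose F (q : (R * (nat * R)) * (R * (nat * R))) : \bar R :=
  if (t < q.1.1 + q.2.1 <= s)%R then v (s - q.1.1 - q.2.1, q.2.2)%R else 0.
have mF : measurable_fun setT F.
  apply: measurable_fun_ifT => //; first by mfun.
  by apply: (measurableT_comp mv); mfun.
have F0 q : 0 <= F q by rewrite /F; case: ifP.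
transitivity (\int[P]_(w in G)
    (if W_ j w == +oo then 0 else F (Z_ j w, (fine (W_ j w), Y_ j.+1 w)))).
  apply: eq_integral => w; rewrite inE => Gw.
  rewrite TS {1 2 3}(T_fin (GT _ Gw)).
  have : 0 <= W_ j w by rewrite le_min U0 V0.
  case: (W_ j w) => [z| |]// _ /=.
    rewrite /F /= lte_fin lee_fin; case: ifP => // _; congr (v (_, _)); ring.
  by rewrite leye_eq andbF.
rewrite (step pG mF F0); apply: eq_integral => w _.
rewrite -integral_ite; apply: eq_integral => z _; rewrite /F /=.
case: ifP => // _.
by rewrite /jump_op !mule0 adde0 mul0e.
Qed.

(** Either there is no jump after the [j]-th one, or the next jump leaves [k] - 1 jumps. *)
Lemma integral_expect_upto (s : R) : (0 <= s)%R -> forall k j G, past U V j G ->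
  (forall w, G w -> T_ j w <= s%:E) ->
  \int[P]_(w in G) (if s%:E < T_ (j + k)%N w then f (X s w) else 0) =
  \int[P]_(w in G) expect_upto lam h f k (s - fine (T_ j w), Y_ j w)%R.
Proof.
move=> s0; elim=> [|k IH] j G pG GT.
  apply: eq_integral => w; rewrite inE => Gw.
  by rewrite addn0 ltNge GT.
have mG := past_m pG.
have mlt (t : R) i : measurable_fun setT (fun w => t%:E < T_ i w) by exact: measurable_fun_lte.
have mle (t : R) i : measurable_fun setT (fun w => T_ i w <= t%:E) by exact: measurable_fun_lee.
pose phi w := if s%:E < T_ (j.+1 + k)%N w then f (X s w) else 0.
have mphi : measurable_fun setT phi by apply: measurable_fun_ifT => //; exact: mfX.
have phi0 w : 0 <= phi w by rewrite /phi; case: ifP.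
have mfk : measurable_fun setT (fun w => if s%:E < T_ j.+1 w then f (X s w) else 0).
  by apply: measurable_fun_ifT => //; exact: mfX.
have -> : \int[P]_(w in G) (if s%:E < T_ (j + k.+1)%N w then f (X s w) else 0) =
  \int[P]_(w in G) ((if s%:E < T_ j.+1 w then f (X s w) else 0) +
     (if (-1)%:E < T_ j.+1 w <= s%:E then phi w else 0)).
  (* jump times are nonnegative, so the lower bound -1 is no condition *)
  apply: eq_integral => w _; rewrite /phi addSnnS.
  have -> : (-1)%:E < T_ j.+1 w by apply: lt_le_trans (T0 _ _); rewrite lte_fin ltrN10.
  have [Ts|sT] := leP (T_ j.+1 w) s%:E; first by rewrite /= add0e.
  by rewrite /= adde0 (lt_le_trans sT)//; apply: leT; rewrite -addSnnS leq_addr.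
rewrite ge0_integralD//; last 4 first.
- by move=> w _; case: ifP.
- exact: measurable_funTS.
- by move=> w _; case: ifP.
- by apply: measurable_funTS; apply: measurable_fun_ifT => //; exact: measurable_and.
rewrite no_jump_part// (jump_part (v := expect_upto lam h f k))//; last 3 first.
- exact: measurable_expect_upto.
- exact: expect_upto_ge0.
- apply: IH; last by move=> w [_ /andP[]].
  apply: pastI; first exact: past_S.
  have := @past_time _ _ _ U V j.+1 `](-1)%:E, s%:E] (emeasurable_itv _).
  by congr (past U V _ _); apply/seteqP; split => w /=; rewrite in_itv.
pose q w := (s - fine (T_ j w), Y_ j w)%R.
pose A w := f (shift (q w).2 (q w).1) * (no_jump lam h (q w).2 (q w).1)%:E.
pose B w := \int[mu]_(z in `[0%R, (q w).1])
    (jump_op lam h (fun y => expect_upto lam h f k ((q w).1 - z, y)%R) (shift (q w).2 z) *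
     (no_jump lam h (q w).2 z)%:E).
have mq : measurable_fun setT q by exact: measurable_remaining.
have mA : measurable_fun setT A.
  apply: emeasurable_funM.
    apply: (measurableT_comp mf); apply: (measurableT_comp measurable_shift
      (g := fun w => ((q w).2, (q w).1))).
    by apply: measurable_fun_pair; apply: measurableT_comp mq.
  apply/measurable_EFinP.
  apply: (measurableT_comp (measurable_no_jump Il Ih)
    (g := fun w => ((q w).2, (q w).1))).
  by apply: measurable_fun_pair; apply: measurableT_comp mq.
have mB : measurable_fun setT B.
  have mE := measurable_expect_upto Il Ih mf f0 k.
  have mI := measurable_renewal_integrand Il Ih mE.
  apply: (measurableT_comp _ mq (f := fun p : R * (nat * R) => \int[mu]_(z in `[0%R, p.1])
    (jump_op lam h (fun y => expect_upto lam h f k (p.1 - z, y)%R) (shift p.2 z) *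
     (no_jump lam h p.2 z)%:E))).
  apply: (measurable_fun_integral_segment (a := cst 0%R) (b := fst) _ _ mI) => //.
  by move=> p; apply: renewal_integrand_ge0 => // y; exact: expect_upto_ge0.
have -> : \int[P]_(w in G) expect_upto lam h f k.+1 (q w) = \int[P]_(w in G) (A w + B w) by [].
have A0 w : G w -> 0 <= A w by rewrite mule_ge0 ?lee_fin ?no_jump_ge0.
have B0 w : G w -> 0 <= B w.
  move=> _; apply: integral_ge0 => z _.
  by apply: renewal_integrand_ge0 => // y; exact: expect_upto_ge0.
rewrite (ge0_integralD P mG A0 (measurable_funTS mA) B0 (measurable_funTS mB)).
congr (_ + _); apply: eq_integral => w; rewrite inE => Gw.
congr integral; apply/seteqP; split => z /=; rewrite !in_itv/= ?andbT.
  by move=> [z0 /andP[_]]; rewrite z0 lerBrDl.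
move=> /andP[z0]; rewrite lerBrDl => ->; split => //; rewrite andbT.
have : (0 <= fine (T_ j w))%R by exact: fine_ge0.
lra.
Qed.

Lemma integral_transition (s : R) j G : (0 <= s)%R -> past U V j G ->
  (forall w, G w -> T_ j w <= s%:E) ->
  \int[P]_(w in G) f (X s w) =
  \int[P]_(w in G) p_ (s - fine (T_ j w), Y_ j w)%R.
Proof.
move=> s0 pG GT; have mG := past_m pG.
have c1 := @cvg_before_jumps G s _ j mG (mfX s0) (fun w => f0 _).
have c2 : \int[P]_(w in G) expect_upto lam h f k (s - fine (T_ j w), Y_ j w)%R @[k --> \oo] -->
    \int[P]_(w in G) p_ (s - fine (T_ j w), Y_ j w)%R.
  apply: cvg_monotone_convergence => //.
  - move=> k; apply: measurable_funTS.
    exact: (measurableT_comp (measurable_expect_upto Il Ih mf f0 k)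
      (measurable_remaining s j)).
  - by move=> k w _; apply: expect_upto_ge0.
  - by move=> w _; apply: expect_upto_nd.
have e12 : (fun k => \int[P]_(w in G) (if s%:E < T_ (j + k)%N w then f (X s w) else 0)) =
    (fun k => \int[P]_(w in G) expect_upto lam h f k (s - fine (T_ j w), Y_ j w)%R).
  by apply/funext => k; exact: integral_expect_upto.
rewrite e12 in c1.
exact: (cvg_unique _ c1 c2).
Qed.

Lemma transition_expectation (s : R) : (0 <= s)%R ->
  \int[P]_w f (X s w) = p_ (s, x).
Proof.
move=> s0.
have pT : past U V 0 setT by exact: (@measurableT _ (pastType U V 0)).
rewrite (integral_transition s0 pT); last by move=> w _; rewrite /T_ jump_time0.
rewrite (eq_integral (fun=> p_ (s, x))); last first.
  by move=> w _; rewrite /T_ jump_time0 /= subr0.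
by rewrite integral_cst//= probability_setT mule1.
Qed.

(** While the [j]-th jump is the last one, the state is a function of the past of the chain, and
    [renewal_shift] describes what follows the time [t]. *)
Lemma markov_between_jumps j G (t s : R) : past U V j G ->
  (forall w, G w -> T_ j w <= t%:E) -> (0 <= t)%R -> (0 <= s)%R ->
  \int[P]_(w in G) (if t%:E < T_ j.+1 w then f (X (t + s)%R w) else 0) =
  \int[P]_(w in G) (if t%:E < T_ j.+1 w then p_ (s, X t w) else 0).
Proof.
move=> pG GT t0 s0; have mG := past_m pG.
have ts0 : (0 <= t + s)%R by exact: addr_ge0.
have tts : t%:E <= (t + s)%:E by rewrite lee_fin lerDl.
have GTs w : G w -> T_ j w <= (t + s)%:E by move=> Gw; exact: le_trans (GT _ Gw) tts.
have mlt (r : R) i : measurable_fun setT (fun w => r%:E < T_ i w) by exact: measurable_fun_lte.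
have mle (r : R) i : measurable_fun setT (fun w => T_ i w <= r%:E) by exact: measurable_fun_lee.
have mfts := mfX ts0.
pose A w := if (t + s)%:E < T_ j.+1 w then f (X (t + s)%R w) else 0.
pose B w := if t%:E < T_ j.+1 w <= (t + s)%:E then f (X (t + s)%R w) else 0.
have mA : measurable_fun setT A by exact: measurable_fun_ifT.
have mB : measurable_fun setT B.
  by apply: measurable_fun_ifT => //; exact: measurable_and.
have A0 w : G w -> 0 <= A w by rewrite /A; case: ifP.
have B0 w : G w -> 0 <= B w by rewrite /B; case: ifP.
transitivity (\int[P]_(w in G) (A w + B w)).
  apply: eq_integral => w _; rewrite /A /B.
  have [Tts|tsT] := leP (T_ j.+1 w) (t + s)%:E; first by rewrite andbT add0e.
  by rewrite andbF adde0 (le_lt_trans tts tsT).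
rewrite (ge0_integralD P mG A0 (measurable_funTS mA) B0 (measurable_funTS mB)).
rewrite /A /B no_jump_part// (jump_part (v := p_))//; last first.
  apply: integral_transition => //; last by move=> w [_ /andP[]].
  apply: pastI; first exact: past_S.
  have := @past_time _ _ _ U V j.+1 `]t%:E, (t + s)%:E] (emeasurable_itv _).
  by congr (past U V _ _); apply/seteqP; split => w /=; rewrite in_itv.
pose r (z : R * (nat * R)) : R := (if 0 <= t - z.1 then t - z.1 else 0)%R.
have rE w : G w -> r (Z_ j w) = (t - fine (T_ j w))%R.
  move=> Gw; rewrite /r/= subr_ge0 -lee_fin -(T_fin (GT _ Gw)).
  by rewrite GT.
have mr : measurable_fun setT r by apply: measurable_fun_ifT; mfun.
have r0 z : (0 <= r z)%R by rewrite /r; case: ifP.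
pose g (z : R * (nat * R)) := p_ (s, shift z.2 (r z)).
have mg : measurable_fun setT g.
  apply: (measurableT_comp mp); apply: measurable_fun_pair; first by mfun.
  by apply: (measurableT_comp measurable_shift (g := fun z => (z.2, r z))); mfun.
have g0 z : 0 <= g z by exact: p0.
transitivity (\int[P]_(w in G) (g (Z_ j w) * (no_jump lam h (Y_ j w) (r (Z_ j w)))%:E)); last first.
  rewrite -(tail pG mr r0 mg g0).
  apply: ae_eq_integral => //.
  - apply: measurable_funTS; apply: measurable_fun_ifT => //.
      apply: measurable_fun_lte => //; apply/measurable_EFinP.
      exact: (measurableT_comp mr).
    exact: (measurableT_comp mg).
  - apply: measurable_funTS; apply: measurable_fun_ifT => //.
    by apply: (measurableT_comp mp); apply: measurable_fun_pair => //; exact: mX.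
  - move: X_follows; apply: filterS => w Xw Gw.
    rewrite rE// -lt_TS; last exact: GT.
    case: ifPn => // tT; rewrite /g rE//; congr (p_ (_, _)); rewrite (Xw j)// tT andbT; exact: GT.
pose q w := ((t + s) - fine (T_ j w), Y_ j w)%R.
pose A' w := f (shift (Y_ j w) (t + s - fine (T_ j w))) *
  (no_jump lam h (Y_ j w) (t + s - fine (T_ j w)))%:E.
pose B' w := \int[mu]_(z in `[(t - fine (T_ j w))%R, (t - fine (T_ j w) + s)%R])
    (jump_op lam h (fun y => p_ (t + s - fine (T_ j w) - z, y)%R) (shift (Y_ j w) z) *
     (no_jump lam h (Y_ j w) z)%:E).
have mq : measurable_fun setT q by exact: measurable_remaining.
have mA' : measurable_fun setT A'.
  apply: emeasurable_funM.
    apply: (measurableT_comp mf); apply: (measurableT_comp measurable_shift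
      (g := fun w => ((q w).2, (q w).1))).
    by apply: measurable_fun_pair; apply: measurableT_comp mq.
  apply/measurable_EFinP.
  apply: (measurableT_comp (measurable_no_jump Il Ih)
    (g := fun w => ((q w).2, (q w).1))).
  by apply: measurable_fun_pair; apply: measurableT_comp mq.
have mB' : measurable_fun setT B'.
  have mI := measurable_renewal_integrand Il Ih mp.
  apply: (measurable_fun_integral_segment
    (a := fun w => (t - fine (T_ j w))%R) (b := fun w => (t - fine (T_ j w) + s)%R)
    (F := fun p : Omega * R => jump_op lam h (fun y => p_ ((q p.1).1 - p.2, y)%R)
       (shift (q p.1).2 p.2) * (no_jump lam h (q p.1).2 p.2)%:E)).
  - by have := measurable_remaining t j => /measurable_fun_pairP[].
  - apply: measurable_funD => //.
    by have := measurable_remaining t j => /measurable_fun_pairP[].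
  - apply: (measurableT_comp mI (g := fun p : Omega * R => (q p.1, p.2))).
    by apply: measurable_fun_pair; [exact: measurableT_comp|mfun].
  - by move=> p; apply: renewal_integrand_ge0.
have A'0 w : G w -> 0 <= A' w by rewrite mule_ge0 ?lee_fin ?no_jump_ge0.
have B'0 w : G w -> 0 <= B' w.
  by move=> _; apply: integral_ge0 => z _; exact: renewal_integrand_ge0.
transitivity (\int[P]_(w in G) (A' w + B' w)).
  rewrite (ge0_integralD P mG A'0 (measurable_funTS mA') B'0 (measurable_funTS mB')).
  congr (_ + _); apply: eq_integral => w; rewrite inE => Gw.
  have tT : (fine (T_ j w) <= t)%R by rewrite -lee_fin -(T_fin (GT _ Gw)); exact: GT.
  rewrite /B' -integral_itv_obnd_cbnd.
    congr integral; apply/seteqP; split => z /=; rewrite !in_itv/= ?andbT.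
      by move=> [z0 /andP[h1 h2]]; apply/andP; split; lra.
    by move=> /andP[h1 h2]; split; [lra|apply/andP; split; lra].
  apply: measurable_funTS.
  exact: (measurable_fun_pair2 (q w) (measurable_renewal_integrand Il Ih mp)).
apply: eq_integral => w; rewrite inE => Gw.
have tT : (0 <= t - fine (T_ j w))%R.
  by rewrite subr_ge0 -lee_fin -(T_fin (GT _ Gw)); exact: GT.
rewrite /g rE// -(renewal_shift Il Ih mf f0 _ tT s0).
by rewrite /A' /B' addrAC.
Qed.

End expectations.

(** The path stopped from jumping after its [j]-th jump, a function of the first [j] steps. *)
Fixpoint stopped_path (r : R) (j : nat) (w : Omega) : nat * R :=
  let y := shift (Y_ j w) (r - fine (T_ j w)) in
  if j is i.+1 then if r%:E < T_ j w then stopped_path r i w else y else y.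

Lemma stopped_pathE r j w : (0 <= r)%R -> follows_jumps x (U ^~ w) (V ^~ w) (X ^~ w) ->
  r%:E < T_ j.+1 w -> stopped_path r j w = X r w.
Proof.
move=> r0 Xw; elim: j => [|j IH] rT /=.
  by rewrite (Xw 0%N)// rT /T_ jump_time0 lee_fin r0.
by case: ltP => [|Tr]; [exact: IH|rewrite (Xw j.+1)// Tr].
Qed.

Lemma measurable_stopped_path r j k : (j <= k)%N ->
  measurable_fun setT (stopped_path r j : pastType U V k -> nat * R).
Proof.
move=> jk.
have mTk i : (i <= k)%N -> measurable_fun setT (T_ i : pastType U V k -> \bar R).
  move=> ik; apply: measurable_jump_time => l li.
  by apply: measurable_past_UV; exact: leq_trans ik.
have mYk i : (i <= k)%N -> measurable_fun setT (Y_ i : pastType U V k -> nat * R).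
  move=> ik; apply: measurable_jump_state => l li.
  by apply: measurable_past_UV; exact: leq_trans ik.
have my i : (i <= k)%N -> measurable_fun setT
    ((fun w => shift (Y_ i w) (r - fine (T_ i w))%R) : pastType U V k -> nat * R).
  move=> ik; apply: (measurableT_comp measurable_shift
    (g := fun w : pastType U V k => (Y_ i w, (r - fine (T_ i w))%R))).
  apply: measurable_fun_pair; first exact: mYk.
  apply: measurable_funB => //; apply: measurableT_comp; last exact: mTk.
  exact: fine_measurable.
elim: j jk => [|j IH] jk; first exact: (my 0%N).
apply: measurable_fun_ifT; [|by apply: IH; exact: ltnW|exact: my].
by apply: measurable_fun_lte => //; exact: mTk.
Qed.

(** Before the jump [j + 1], the path coincides with its stopped version. *)
Lemma natural_filtration_past (t : R) G : natural_filtration X t G ->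
  exists Gj : nat -> set Omega, (forall j, past U V j (Gj j)) /\
    forall w, follows_jumps x (U ^~ w) (V ^~ w) (X ^~ w) ->
      forall j, t%:E < T_ j.+1 w -> (G w <-> Gj j w).
Proof.
move: G; apply: smallest_sub.
  split.
  - exists (fun=> set0); split=> [j|w _ j _] //.
    exact: (@measurable0 _ (pastType U V j)).
  - move=> A [Aj [pA hA]]; exists (fun j => ~` Aj j); split=> [j|w Xw j tT].
      by have := @measurableC _ (pastType U V j) _ (pA j).
    by rewrite setTD; split => nA /(hA _ Xw _ tT).
  - move=> A hA; have /choice[Aj hAj] := hA.
    exists (fun j => \bigcup_n Aj n j); split=> [j|w Xw j tT].
      by apply: (@bigcupT_measurable _ (pastType U V j)) => n; exact: (hAj n).1.
    by split=> -[n _ An]; exists n => //; apply/((hAj n).2 _ Xw _ tT).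
move=> E [r [A [/=]]]; rewrite in_itv/= => /andP[r0 rt] mA ->.
exists (fun j => stopped_path r j @^-1` A); split=> [j|w Xw j tT].
  by have := measurable_stopped_path r (leqnn j) measurableT mA; rewrite setTI.
rewrite /preimage /= stopped_pathE//.
by apply: le_lt_trans tT; rewrite lee_fin.
Qed.

Lemma sub_natural_filtration (t : R) : natural_filtration X t `<=` measurable.
Proof.
apply: smallest_sub; first exact: sigma_algebra_measurable.
move=> E [r [A [/=]]]; rewrite in_itv/= => /andP[r0 rt] mA ->.
by rewrite -[_ @^-1` _]setTI; exact: mX.
Qed.

(** By [nonexplosion], almost every path has a last jump before [t]. If it is the [j]-th one, [G] may
    be replaced by an event of the past of the first [j] steps. *)
Theorem markov (f : nat * R -> \bar R) (t s : R) G :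
  measurable_fun setT f -> (forall y, 0 <= f y) -> (0 <= t)%R -> (0 <= s)%R ->
  natural_filtration X t G ->
  \int[P]_(w in G) f (X (t + s)%R w) =
  \int[P]_(w in G) transition lam h f (s, X t w).
Proof.
move=> mf f0 t0 s0 FG; have mG := sub_natural_filtration FG.
have mp := measurable_transition Il Ih mf f0.
have p0 := transition_ge0 Il Ih mf f0.
have [Gj [pGj GGj]] := natural_filtration_past FG.
pose phi w := f (X (t + s)%R w); pose psi w := transition lam h f (s, X t w).
have mphi : measurable_fun setT phi.
  by apply: (measurableT_comp mf); apply: mX; exact: addr_ge0.
have mpsi : measurable_fun setT psi.
  by apply: (measurableT_comp mp); apply: measurable_fun_pair => //; exact: mX.
have mlt (r : R) i : measurable_fun setT (fun w => r%:E < T_ i w) by exact: measurable_fun_lte.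
have mle (r : R) i : measurable_fun setT (fun w => T_ i w <= r%:E) by exact: measurable_fun_lee.
have split_last (g : Omega -> \bar R) k : measurable_fun setT g -> (forall w, 0 <= g w) ->
    \int[P]_(w in G) (if t%:E < T_ k.+1 w then g w else 0) =
    \int[P]_(w in G) (if t%:E < T_ k w then g w else 0) +
    \int[P]_(w in Gj k `&` [set w | T_ k w <= t%:E]) (if t%:E < T_ k.+1 w then g w else 0).
  move=> mg g0.
  have mGk : measurable (Gj k `&` [set w | T_ k w <= t%:E]).
    by apply: measurableI => //; exact: past_m (pGj k).
  have -> : \int[P]_(w in Gj k `&` [set w | T_ k w <= t%:E])
      (if t%:E < T_ k.+1 w then g w else 0) =
    \int[P]_(w in G) (if (T_ k w <= t%:E) && (t%:E < T_ k.+1 w) then g w else 0).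
    rewrite integral_mkcond [RHS]integral_mkcond; apply: ae_eq_integral => //.
    - apply/(measurable_restrictT _ mGk); apply: measurable_funTS.
      exact: measurable_fun_ifT.
    - apply/(measurable_restrictT _ mG); apply: measurable_funTS.
      by apply: measurable_fun_ifT => //; exact: measurable_and.
    - move: X_follows; apply: filterS => w Xw _; rewrite /patch.
      have [tT|tT] := boolP (t%:E < T_ k.+1 w); last by rewrite andbF; do 2 case: ifP.
      rewrite andbT; have GE := GGj _ Xw _ tT.
      have [Gw|Gw] := pselect (G w).
        rewrite [in RHS]mem_set//; case: ifPn => [/set_mem[_ /= ->]//|].
        rewrite notin_setE => nG; case: ifPn => // Tt; exfalso; apply: nG; split => //.
        exact/GE.
      rewrite [in RHS]memNset//; case: ifPn => // /set_mem[/= Gk _].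
      by exfalso; apply: Gw; exact/GE.
  rewrite -ge0_integralD//; last 4 first.
  - by move=> w _; case: ifP.
  - by apply: measurable_funTS; exact: measurable_fun_ifT.
  - by move=> w _; case: ifP.
  - by apply: measurable_funTS; apply: measurable_fun_ifT => //; exact: measurable_and.
  apply: eq_integral => w _.
  have [Tt|tT] := leP (T_ k w) t%:E; first by rewrite add0e.
  by rewrite /= adde0 (lt_le_trans tT)//; exact: leT.
have eqk k : \int[P]_(w in G) (if t%:E < T_ k w then phi w else 0) =
    \int[P]_(w in G) (if t%:E < T_ k w then psi w else 0).
  elim: k => [|k IH].
    apply: eq_integral => w _; rewrite /T_ jump_time0 lte_fin ltNge t0.
    by [].
  rewrite (split_last phi k mphi (fun w => f0 _)) IH (split_last psi k mpsi (fun w => p0 _)).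
  congr (_ + _); apply: markov_between_jumps => //; last by move=> w [].
  by apply: pastI => //; exact: past_time_le.
have c1 := @cvg_before_jumps G t phi 0 mG mphi (fun w => f0 _).
have c2 := @cvg_before_jumps G t psi 0 mG mpsi (fun w => p0 _).
have e12 : (fun k => \int[P]_(w in G) (if t%:E < T_ (0 + k)%N w then phi w else 0)) =
    (fun k => \int[P]_(w in G) (if t%:E < T_ (0 + k)%N w then psi w else 0)).
  by apply/funext => k; exact: eqk.
rewrite e12 in c1.
exact: (cvg_unique _ c1 c2).
Qed.

End process_law.

(** * Short-time bounds for the transition function *)

Lemma bounded_intensityD {R : realType} (C C' : R) g g' : bounded_intensity C g ->
  bounded_intensity C' g' -> bounded_intensity (C + C') (fun y => g y + g' y).
Proof.
move=> [mg g0 gC] [mg' g'0 g'C]; split; first exact: measurable_funD.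
  by move=> y; exact: addr_ge0.
by move=> y; exact: lerD.
Qed.

Section transition_bounds.
Context {R : realType}.
Notation mu := (@lebesgue_measure R).
Variables (lam h : nat * R -> R) (C : R).
Hypotheses (Il : bounded_intensity C lam) (Ih : bounded_intensity C h).
Let lam_meas := intensity_meas Il. Let h_meas := intensity_meas Ih.
Let lam_ge0 := intensity_ge0 Il. Let h_ge0 := intensity_ge0 Ih.
Let lam_le := intensity_le Il. Let h_le := intensity_le Ih.
Local Open Scope ereal_scope.

Let q y : R := (lam y + h y)%R.
Let Iq : bounded_intensity (C + C) q. Proof. exact: bounded_intensityD. Qed.

Lemma no_jumpE y z : no_jump lam h y z = survival q y z.
Proof.
rewrite /no_jump /survival -expRD -opprD; congr (expR (- _)).
rewrite /hazard -RintegralD//.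
- apply: (bounded_integrable_segment (M := C)); first exact: measurable_along_flow.
  by move=> w _; rewrite ger0_norm.
- apply: (bounded_integrable_segment (M := C)); first exact: measurable_along_flow.
  by move=> w _; rewrite ger0_norm.
Qed.

Lemma jump_op_cst (c : \bar R) y : 0 <= c -> jump_op lam h (cst c) y = (q y)%:E * c.
Proof. by move=> c0; rewrite /jump_op /cst -ge0_muleDl ?lee_fin// EFinD. Qed.

Section bounded_function.
Variables (f : nat * R -> \bar R) (M : R).
Hypotheses (mf : measurable_fun setT f) (f0 : forall y, 0 <= f y).
Hypothesis fM : forall y, f y <= M%:E.

Let M0 : (0 <= M)%R.
Proof. by rewrite -lee_fin; apply: le_trans (fM (0%N, 0%R)). Qed.

(** The total jump rate times [no_jump] is the density of the first jump time. *)
Lemma le_integral_jump (v : R * (nat * R) -> \bar R) (s : R) y : (0 <= s)%R ->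
  measurable_fun setT v -> (forall p, 0 <= v p) -> (forall p, v p <= M%:E) ->
  \int[mu]_(z in `[0%R, s]) (jump_op lam h (fun y' => v (s - z, y')%R) (shift y z) *
     (no_jump lam h y z)%:E) <= M%:E * (1 - no_jump lam h y s)%:E.
Proof.
move=> s0 mv v0 vM.
have md : measurable_fun setT (fun z : R => (wait_density q y z)%:E).
  by apply/measurable_EFinP; exact: (measurable_fun_pair2 y (measurable_wait_density Iq)).
have mM : measurable_fun setT (fun z : R => M%:E * (wait_density q y z)%:E).
  by apply: emeasurable_funM => //; exact: measurable_cst.
have -> : M%:E * (1 - no_jump lam h y s)%:E =
    \int[mu]_(z in `[0%R, s]) (M%:E * (wait_density q y z)%:E).
  rewrite ge0_integralZl_EFin//.
  - by rewrite (integral_wait_density Iq)// no_jumpE.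
  - by move=> z _; rewrite lee_fin (wait_density_ge0 Iq).
  - exact: measurable_funTS.
apply: ge0_le_integral => //.
- by move=> z _; exact: renewal_integrand_ge0.
- apply: measurable_funTS.
  exact: (measurable_fun_pair2 (s, y) (measurable_renewal_integrand Il Ih mv)).
- exact: measurable_funTS.
- move=> z _; rewrite wait_densityE -no_jumpE (EFinM (q (shift y z))) muleA.
  apply: lee_wpmul2r; first by rewrite lee_fin no_jump_ge0.
  by rewrite muleC -jump_op_cst ?lee_fin//; exact: (le_jump_op Il Ih).
Qed.

Lemma expect_upto_le k (p : R * (nat * R)) : (0 <= p.1)%R -> expect_upto lam h f k p <= M%:E.
Proof.
elim: k p => [|k IH] [s y] /= s0; first by rewrite lee_fin.
pose v (p : R * (nat * R)) := if (0 <= p.1)%R then expect_upto lam h f k p else 0.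
have mv : measurable_fun setT v.
  apply: measurable_fun_ifT => //; first by apply: measurable_fun_ler; mfun.
  exact: measurable_expect_upto.
have v0 p : 0 <= v p by rewrite /v; case: ifP => // _; exact: expect_upto_ge0.
have vM p : v p <= M%:E by rewrite /v; case: ifPn => [/IH//|_]; rewrite lee_fin.
have H := le_integral_jump y s0 mv v0 vM.
rewrite (_ : integral _ _ _ = \int[mu]_(z in `[0%R, s]) (jump_op lam h
    (fun y' => expect_upto lam h f k (s - z, y')%R) (shift y z) *
    (no_jump lam h y z)%:E)) in H; last first.
  apply: eq_integral => z; rewrite inE/= in_itv/= => /andP[_ zs].
  by congr (_ * _); congr jump_op; apply/funext => y'; rewrite /v /= subr_ge0 zs.
rewrite /renewal /=.
apply: le_trans (leeD (lee_wpmul2r _ (fM _)) H) _; first by rewrite lee_fin no_jump_ge0.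
by rewrite -!EFinM -EFinD lee_fin -mulrDr addrC subrK mulr1.
Qed.

Lemma transition_le (p : R * (nat * R)) : (0 <= p.1)%R -> transition lam h f p <= M%:E.
Proof.
move=> p0; apply: lime_le; first apply/cvg_ex.
  exists (transition lam h f p); exact: cvg_expect_upto.
by apply: nearW => k; exact: expect_upto_le.
Qed.

Lemma transition_fin (p : R * (nat * R)) : (0 <= p.1)%R -> transition lam h f p \is a fin_num.
Proof.
move=> p0; rewrite ge0_fin_numE; last exact: (transition_ge0 Il Ih mf f0).
exact: le_lt_trans (transition_le p0) (ltry _).
Qed.

(** Up to an error of order [s], no jump occurs before time [s]. *)
Lemma transition_short_time (s : R) y : (0 <= s)%R ->
  (`|fine (transition lam h f (s, y)) - fine (f (shift y s))| <= 2 * C * M * s)%R.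
Proof.
move=> s0.
have tf := @transition_fin (s, y) s0.
have ff : f (shift y s) \is a fin_num.
  by rewrite ge0_fin_numE//; exact: le_lt_trans (fM _) (ltry _).
have tr := transition_renewal Il Ih mf f0 (s, y).
rewrite /renewal /= in tr.
set J := \int[mu]_(z in _) _ in tr.
pose v (p : R * (nat * R)) := if (0 <= p.1)%R then transition lam h f p else 0.
have mv : measurable_fun setT v.
  apply: measurable_fun_ifT => //; first by apply: measurable_fun_ler; mfun.
  exact: measurable_transition.
have t0 p : 0 <= transition lam h f p by exact: transition_ge0.
have v0 p : 0 <= v p by rewrite /v; case: ifP.
have vM p : v p <= M%:E by rewrite /v; case: ifPn => [/transition_le//|_]; rewrite lee_fin.
have J0 : 0 <= J by apply: integral_ge0 => z _; exact: renewal_integrand_ge0.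
have JM : J <= M%:E * (1 - no_jump lam h y s)%:E.
  have := le_integral_jump y s0 mv v0 vM; congr (_ <= _).
  apply: eq_integral => z; rewrite inE/= in_itv/= => /andP[_ zs].
  by congr (_ * _); congr jump_op; apply/funext => y'; rewrite /v /= subr_ge0 zs.
have Jf : J \is a fin_num.
  by rewrite ge0_fin_numE//; apply: le_lt_trans JM _; rewrite -EFinM ltry.
have S0 := no_jump_ge0 lam h y s.
have S1 := no_jump_le1 Il Ih y s.
have SC := no_jump_ge Il Ih y s0.
move: JM J0 tr (f0 (shift y s)) (fM (shift y s)); rewrite -(fineK Jf) -(fineK tf) -(fineK ff).
rewrite -!EFinM !lee_fin => JM J0 [->] a0 aM /=.
set S := no_jump lam h y s in S0 S1 SC JM *; set a := fine (f _) in a0 aM *.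
have h1 : (M * (1 - S) <= 2 * C * M * s)%R.
  have : (M * (1 - S) <= M * (2 * C * s))%R by rewrite ler_wpM2l//; lra.
  lra.
have h2 : (a * (1 - S) <= M * (1 - S))%R by rewrite ler_wpM2r//; lra.
have h3 : (0 <= a * (1 - S))%R by rewrite mulr_ge0//; lra.
rewrite ler_norml; apply/andP; split; lra.
Qed.

End bounded_function.

Lemma transition0 (f : nat * R -> \bar R) (mf : measurable_fun setT f)
  (f0 : forall y, 0 <= f y) y : transition lam h f (0%R, y) = f y.
Proof.
rewrite (transition_renewal Il Ih mf f0) /renewal /=.
by rewrite set_itv1 integral_set1 shift0 /no_jump !survival0// mulr1 mule1 adde0.
Qed.

End transition_bounds.

(** * The queue under all its initial laws *)

Section queue.
Context {R : realType}.
Notation mu := (@lebesgue_measure R).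
Variables (lam h : nat * R -> R) (C : R).
Hypotheses (Il : bounded_intensity C lam) (Ih : bounded_intensity C h).
Let lam_meas := intensity_meas Il. Let h_meas := intensity_meas Ih.
Let lam_ge0 := intensity_ge0 Il. Let h_ge0 := intensity_ge0 Ih.
Let lam_le := intensity_le Il. Let h_le := intensity_le Ih.
Context {d : measure_display} {Omega : measurableType d}.
Variables (P : nat * R -> probability Omega R) (X : R -> Omega -> nat * R).
Hypothesis X_queue : queue_process lam h P X.
Local Open Scope ereal_scope.

Lemma measurable_queue t : (0 <= t)%R -> measurable_fun setT (X t).
Proof. by case: X_queue => + _ _ _ _; apply. Qed.

Lemma queue_statespace t w : (0 <= t)%R -> statespace (X t w).
Proof. by case: X_queue => _ + _ _ _; apply. Qed.

Lemma queue_transition x (f : nat * R -> \bar R) s : statespace x ->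
  measurable_fun setT f -> (forall y, 0 <= f y) -> (0 <= s)%R ->
  \int[P x]_w f (X s w) = transition lam h f (s, x).
Proof.
case: X_queue => mX _ _ _ cX sx mf f0 s0; have [U [V [mUV UV0 law XP]]] := cX x sx.
exact: (transition_expectation Il Ih mUV UV0 law mX XP).
Qed.

Lemma queue_markov x (f : nat * R -> \bar R) t s G : statespace x ->
  measurable_fun setT f -> (forall y, 0 <= f y) -> (0 <= t)%R -> (0 <= s)%R ->
  natural_filtration X t G ->
  \int[P x]_(w in G) f (X (t + s)%R w) =
  \int[P x]_(w in G) transition lam h f (s, X t w).
Proof.
case: X_queue => mX _ _ _ cX sx mf f0 t0 s0 FG; have [U [V [mUV UV0 law XP]]] := cX x sx.
exact: (markov Il Ih mUV UV0 law mX XP).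
Qed.

(** By [nonexplosion], almost surely each time lies strictly before the next jump. *)
Lemma queue_local_flow x : statespace x ->
  {ae P x, forall w, forall t, (0 <= t)%R -> exists2 e : R, (0 < e)%R &
    forall r, (0 <= r)%R -> (r < e)%R -> X (t + r)%R w = shift (X t w) r}.
Proof.
case: X_queue => mX _ _ _ cX sx; have [U [V [mUV UV0 law XP]]] := cX x sx.
have NE := nonexplosion Il Ih mUV UV0 law.
apply: filterS2 XP NE => w Xw NEw t t0.
have U0 i : 0 <= U i w by have [] := UV0 i w.
have V0 i : 0 <= V i w by have [] := UV0 i w.
pose T_ k := jump_time (U ^~ w) (V ^~ w) k.
have [k Tk kmin] : exists2 k, t%:E < T_ k.+1 & T_ k <= t%:E.
  have /ex_minnP[k tk kmin] := NEw t.
  case: k => [|k] in tk kmin *.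
    by move: tk; rewrite jump_time0 lte_fin ltNge t0.
  exists k => //; rewrite leNgt; apply/negP => /kmin.
  by rewrite ltnn.
have Tf : T_ k = (fine (T_ k))%:E.
  rewrite fineK// ge0_fin_numE; last exact: jump_time_ge0.
  exact: le_lt_trans kmin (ltry _).
have [e e0 eT] : exists2 e : R, (0 < e)%R & (t + e)%:E <= T_ k.+1.
  move: Tk; case: (T_ k.+1) => [b| |]//; last by exists 1%R; rewrite ?leey.
  by rewrite lte_fin => tb; exists (b - t)%R; rewrite ?subr_gt0// addrC subrK.
exists e => // r r0 re.
have Ttr : T_ k <= (t + r)%:E by apply: le_trans kmin _; rewrite lee_fin lerDl.
have trT : (t + r)%:E < T_ k.+1 by apply: lt_le_trans eT; rewrite lte_fin ltrD2l.
rewrite (Xw k t); last by rewrite kmin Tk.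
rewrite (Xw k (t + r)%R); last by rewrite Ttr trT.
by rewrite shift_shift; congr shift; ring.
Qed.

End queue.

(** * Reading a process at a random time *)

Section grid.
Context {R : realType}.

Definition grid_index (n : nat) (r : R) : nat := Num.truncn (n.+1%:R * r).

Definition grid_point (n i : nat) : R := i.+1%:R / n.+1%:R.

(** Strictly beyond [r], so that the event that a stopping time has a given successor on the grid is
    known at that successor. *)
Definition grid (n : nat) (r : R) : R := grid_point n (grid_index n r).

Lemma grid_point_ge0 n i : 0 <= grid_point n i.
Proof. by rewrite divr_ge0. Qed.

Lemma grid_gt n r : 0 <= r -> r < grid n r.
Proof.
move=> r0; rewrite /grid /grid_point ltr_pdivlMr// mulrC.
by have /andP[] := truncn_itv (mulr_ge0 (ler0n R n.+1) r0).
Qed.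

Lemma grid_le n r : 0 <= r -> grid n r <= r + n.+1%:R^-1.
Proof.
move=> r0; rewrite /grid /grid_point ler_pdivrMr// mulrDl mulVf// -natr1 lerD2r mulrC.
by have /andP[] := truncn_itv (mulr_ge0 (ler0n R n.+1) r0).
Qed.

Lemma cvg_grid r : 0 <= r -> grid n r @[n --> \oo] --> r.
Proof.
move=> r0; apply: (@squeeze_cvgr _ _ _ _ (cst r) (fun n => r + n.+1%:R^-1)).
- by near=> n; rewrite (ltW (grid_gt n r0)) grid_le.
- exact: cvg_cst.
- rewrite -[X in _ --> X]addr0; apply: cvgD; first exact: cvg_cst.
  exact: (@cvg_harmonic R).
Unshelve. all: by end_near. Qed.

Lemma grid_indexP n i r : 0 <= r ->
  (grid_index n r == i) = (i%:R / n.+1%:R <= r) && (r < grid_point n i).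
Proof.
move=> r0; rewrite /grid_point ler_pdivrMr// ltr_pdivlMr// ![r * _]mulrC.
apply/eqP/idP => [<-|]; last exact: truncn_def.
exact: (truncn_itv (mulr_ge0 (ler0n R n.+1) r0)).
Qed.

End grid.

Section clock.
Context {R : realType} {d : measure_display} {T : measurableType d}.

Lemma measurable_fun_nat_cases (k : T -> nat) d' (T' : measurableType d') (G : nat -> T -> T') :
  (forall i, measurable (k @^-1` [set i])) -> (forall i, measurable_fun setT (G i)) ->
  measurable_fun setT (fun w => G (k w) w).
Proof.
move=> mk mG _ B mB.
rewrite (_ : _ `&` _ = \bigcup_i (k @^-1` [set i] `&` (setT `&` G i @^-1` B))); last first.
  apply/seteqP; split=> w /=; first by move=> [_ ?]; exists (k w).
  by move=> [i _ /= [-> []]].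
by apply: bigcupT_measurable => i; apply: measurableI => //; exact: mG.
Qed.

Lemma measurable_fun_to_nat (k : T -> nat) :
  measurable_fun setT (fun w => (k w)%:R : R) -> measurable_fun setT k.
Proof.
move=> mk _ B mB.
rewrite (_ : _ `&` _ = \bigcup_(i in B) (setT `&` (fun w => (k w)%:R : R) @^-1` [set i%:R])).
  by apply: bigcup_measurable => i _; exact: mk.
apply/seteqP; split=> w /=; first by move=> [_ ?]; exists (k w).
by move=> [i Bi /= [_ /eqP]]; rewrite eqr_nat => /eqP ->.
Qed.

Lemma measurable_grid_index (n : nat) (c : T -> R) : measurable_fun setT c ->
  (forall w, 0 <= c w) -> forall i, measurable ((fun w => grid_index n (c w)) @^-1` [set i]).
Proof.
move=> mc c0 i.
rewrite (_ : _ @^-1` _ = setT `&` c @^-1` (`[i%:R / n.+1%:R, grid_point n i[)).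
  by apply: mc => //; exact: measurable_itv.
apply/seteqP; split=> w /=; first by move=> /eqP; rewrite grid_indexP// in_itv.
by move=> [_]; rewrite in_itv/= -grid_indexP// => /eqP.
Qed.

(** The value at [c w] is the limit of the values at the grid times following [c w], and these
    take countably many values. *)
Lemma measurable_at_clock (F : R -> T -> R) (c : T -> R) :
  (forall s, 0 <= s -> measurable_fun setT (F s)) ->
  (forall w, 0 <= c w) -> measurable_fun setT c ->
  (forall w (u : nat -> R), (forall n, c w <= u n) -> u @ \oo --> c w ->
     F (u n) w @[n --> \oo] --> F (c w) w) ->
  measurable_fun setT (fun w => F (c w) w).
Proof.
move=> mF c0 mc Fc.
apply: (@measurable_fun_cvg _ _ _ _ (fun n w => F (grid n (c w)) w)) => //.
- move=> n; apply: (@measurable_fun_nat_cases (fun w => grid_index n (c w)) _ _ (fun i => F (grid_point n i))).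
    exact: measurable_grid_index.
  by move=> i; apply: mF; exact: grid_point_ge0.
- move=> w _; apply: Fc; first by move=> n; exact/ltW/grid_gt.
  exact: cvg_grid.
Qed.

End clock.

Section right_continuous_paths.
Context {R : realType}.

Lemma right_cvg_seq {V : topologicalType} (g : R -> V) (t : R) (u : nat -> R) :
  g s @[s --> t^'+] --> g t -> (forall n, t <= u n) -> u @ \oo --> t ->
  g (u n) @[n --> \oo] --> g t.
Proof.
move=> gt tu ut A /= nA; have := gt _ nA => /= -[e /= e0 He].
move/cvgrPdist_lt : ut => /(_ _ e0); apply: filterS => n /= une.
have := tu n; rewrite le_eqVlt => /orP[/eqP <-|tun]; first exact: nbhs_singleton.
exact: He.
Qed.

Lemma cvg_state (g : nat -> nat * R) (y : nat * R) : g @ \oo --> y ->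
  (\forall n \near \oo, (g n).1 = y.1) /\ (g n).2 @[n --> \oo] --> y.2.
Proof.
move=> gy; split; last exact: (cvg_comp _ _ gy (@cvg_snd _ _ _ _ _)).
have H : nbhs y [set z : nat * R | z.1 = y.1].
  exists ([set y.1], setT) => /=; first by split; [exact/principal_filterP|exact: filterT].
  by move=> [a b] /= [].
exact: (gy _ H).
Qed.

End right_continuous_paths.

Section process_at_clock.
Context {R : realType} {d : measure_display} {T : measurableType d}.

Lemma measurable_process_at_clock (X : R -> T -> nat * R) (c : T -> R) :
  (forall s, 0 <= s -> measurable_fun setT (X s)) ->
  (forall w, 0 <= c w) -> measurable_fun setT c ->
  (forall w (u : nat -> R), (forall n, c w <= u n) -> u @ \oo --> c w ->
     X (u n) w @[n --> \oo] --> X (c w) w) ->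
  measurable_fun setT (fun w => X (c w) w).
Proof.
move=> mX c0 mc Xc.
rewrite (_ : (fun _ => _) = (fun w => ((X (c w) w).1, (X (c w) w).2))); last first.
  by apply/funext => w; rewrite -surjective_pairing.
apply: measurable_fun_pair.
  apply: (@measurable_fun_to_nat R).
  apply: (measurable_at_clock (F := fun s w => (X s w).1%:R)) => //.
    move=> s s0; apply: measurableT_comp => //.
    by apply: measurableT_comp => //; exact: mX.
  move=> w u cu uc; have [E _] := cvg_state (Xc w u cu uc).
  apply: cvg_near_cst; apply: filterS E => n /= -> //.
apply: (measurable_at_clock (F := fun s w => (X s w).2)) => //.
  by move=> s s0; apply: measurableT_comp => //; exact: mX.
by move=> w u cu uc; have [_] := cvg_state (Xc w u cu uc).
Qed.

End process_at_clock.

(** * Stopping times *)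

Section observed_past.
Context {R : realType} {d : measure_display} {Omega : measurableType d}.
Variable X : R -> Omega -> nat * R.

(** [generated_by I X] is the sigma-algebra of a measurable type, so that the closure properties of
    measurable functions apply to it. *)
Definition path_generators (I : set R) : set (set Omega) :=
  [set E | exists s (A : set (nat * R)), [/\ I s, measurable A & E = X s @^-1` A]].

Definition observedType I := g_sigma_algebraType (path_generators I).

Lemma measurable_observed (I : set R) (s : R) : I s ->
  measurable_fun setT (X s : observedType I -> nat * R).
Proof.
by move=> Is _ A mA; rewrite setTI; apply: sub_sigma_algebra; exists s, A.
Qed.

Lemma generated_by_subset (I J : set R) : I `<=` J -> generated_by I X `<=` generated_by J X.
Proof.
move=> IJ; apply: smallest_sub; first exact: smallest_sigma_algebra.
move=> E [s [A [/IJ Js mA ->]]]; apply: sub_sigma_algebra.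
by exists s, A.
Qed.

End observed_past.

Section stopping.
Context {R : realType} {d : measure_display} {Omega : measurableType d}.
Variable X : R -> Omega -> nat * R.
Hypothesis mX : forall t, 0 <= t -> measurable_fun setT (X t).
Hypothesis X_right : forall t w, 0 <= t -> X s w @[s --> t^'+] --> X t w.
Variable tau : Omega -> \bar R.
Hypothesis tau_stop : stopping_time (natural_filtration X) tau.

Let tau0 w : (0 <= tau w)%E. Proof. exact: tau_stop.1. Qed.

Notation stopped t w := (if (tau w <= t%:E)%E then fine (tau w) else t).

Let fine_tau w (t : R) : (tau w <= t%:E)%E -> tau w = (fine (tau w))%:E.
Proof. by move=> tt; rewrite fineK// ge0_fin_numE//; exact: le_lt_trans tt (ltry _). Qed.

Lemma filtration_mono (s t : R) : s <= t -> natural_filtration X s `<=` natural_filtration X t.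
Proof.
move=> st; apply: generated_by_subset => r /=; rewrite !in_itv/= => /andP[-> rs] /=.
exact: le_trans rs st.
Qed.

Lemma filtration_le (s t : R) : 0 <= t -> s <= t ->
  natural_filtration X t [set w | tau w <= s%:E]%E.
Proof.
move=> t0 st; have [s0|s0] := leP 0 s.
  by apply: filtration_mono st _ _; exact: tau_stop.2.
rewrite (_ : mkset _ = set0).
  exact: (@measurable0 _ (observedType X `[0, t])).
apply/seteqP; split=> w //= ts; have := le_trans (tau0 w) ts.
by rewrite lee_fin leNgt s0.
Qed.

Lemma filtration_lt (t : R) : 0 <= t -> natural_filtration X t [set w | tau w < t%:E]%E.
Proof.
move=> t0.
rewrite (_ : mkset _ = \bigcup_n [set w | tau w <= (t - n.+1%:R^-1)%:E]%E).
  apply: (@bigcupT_measurable _ (observedType X `[0, t])) => n.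
  by apply: filtration_le => //; rewrite lerBlDr lerDl invr_ge0.
apply/seteqP; split=> w /=.
  move=> tt; have tf := fine_tau (ltW tt).
  move: tt; rewrite tf lte_fin => tt.
  exists (Num.truncn (t - fine (tau w))^-1) => //=; rewrite tf lee_fin /= lerBrDr -lerBrDl.
  rewrite invf_ple ?posrE ?subr_gt0//.
  exact/ltW/truncnS_gt.
move=> [n _ /=] /le_lt_trans; apply; rewrite lte_fin ltrBlDr ltrDl.
by rewrite invr_gt0.
Qed.

Lemma stopped_ge0 (t : R) w : 0 <= t -> 0 <= stopped t w.
Proof. by move=> t0; case: ifP => // _; rewrite fine_ge0. Qed.

Lemma stopped_le (t : R) w : stopped t w <= t.
Proof. by case: ifP => // tt; rewrite -lee_fin -(fine_tau tt). Qed.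

Lemma measurable_stopped (t : R) : 0 <= t ->
  measurable_fun setT ((fun w => stopped t w) : observedType X `[0, t] -> R).
Proof.
move=> t0; apply: (measurability _ (RGenOInfty.measurableE R)) => _ [_ [r ->] <-].
rewrite setTI.
rewrite (_ : _ @^-1` _ = ~` [set w | stopped t w <= r]); last first.
  by apply/seteqP; split=> w /=; rewrite in_itv/= andbT ltNge => /negP.
apply: (@measurableC _ (observedType X `[0, t])).
have [tr|rt] := leP t r.
  rewrite (_ : [set w | stopped t w <= r] = setT); first exact: (@measurableT _ (observedType X `[0, t])).
  by apply/seteqP; split=> w //= _; exact: le_trans (stopped_le t w) tr.
rewrite (_ : [set w | stopped t w <= r] = [set w | tau w <= r%:E]%E); first exact: (filtration_le t0 (ltW rt)).
apply/seteqP; split=> w /=.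
  case: ifPn => [tt|_]; last by rewrite leNgt rt.
  by rewrite {2}(fine_tau tt) lee_fin.
move=> tr; rewrite ifT; last by apply: le_trans tr _; rewrite lee_fin ltW.
by rewrite -lee_fin -(fine_tau tr).
Qed.

(** Before [t] the stopping time is a random time that the past up to [t] can observe. *)
Lemma measurable_stopped_state (t : R) : 0 <= t ->
  measurable_fun setT ((fun w => X (stopped t w) w) : observedType X `[0, t] -> nat * R).
Proof.
move=> t0.
pose X' s : observedType X `[0, t] -> nat * R := X (if s <= t then s else t).
rewrite (_ : (fun w => _) = (fun w => X' (stopped t w) w)); last first.
  by apply/funext => w; rewrite /X' stopped_le.
apply: (measurable_process_at_clock (X := X')).
- move=> s s0; apply: measurable_observed => /=; rewrite in_itv/=.
  by case: (leP s t) => st; rewrite ?s0 ?st ?t0 ?lexx.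
- by move=> w; exact: stopped_ge0.
- exact: measurable_stopped.
- move=> w u cu uc; rewrite /X' stopped_le.
  apply: (right_cvg_seq (g := fun s => X s w)).
  + by apply: X_right; exact: stopped_ge0.
  + by move=> n; case: (u n <= t) => //; exact: stopped_le.
  + apply: (@squeeze_cvgr _ _ _ _ (cst (stopped t w)) u) => //; last exact: cvg_cst.
    apply: nearW => n /=; case: (leP (u n) t) => ut; first by rewrite cu lexx.
    by rewrite stopped_le (ltW ut).
Qed.

Lemma filtration_stopped_state (t : R) B : 0 <= t -> measurable B ->
  natural_filtration X t ([set w | (tau w <= t%:E)%E] `&` [set w | B (X (fine (tau w)) w)]).
Proof.
move=> t0 mB.
rewrite (_ : _ `&` _ = [set w | (tau w <= t%:E)%E] `&` (fun w => X (stopped t w) w) @^-1` B).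
  apply: (@measurableI _ (observedType X `[0, t])); first exact: tau_stop.2.
  by have := measurable_stopped_state t0 measurableT mB; rewrite setTI.
by apply/seteqP; split=> w /= [tt]; rewrite tt.
Qed.

Lemma finite_stoppingE : [set w | tau w < +oo]%E = \bigcup_n [set w | tau w <= n%:R%:E]%E.
Proof.
apply/seteqP; split=> w /=; last by move=> [n _ /=] /le_lt_trans; apply; exact: ltry.
move=> too; have tf : tau w = (fine (tau w))%:E by rewrite fineK// ge0_fin_numE.
exists (Num.truncn (fine (tau w))).+1 => //=; rewrite tf lee_fin.
exact/ltW/truncnS_gt.
Qed.

Lemma observed_stopping (t : R) : 0 <= t -> generated_by `[0, +oo[ X [set w | tau w <= t%:E]%E.
Proof.
move=> t0; apply: generated_by_subset (tau_stop.2 t t0).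
by move=> r /=; rewrite !in_itv/= => /andP[->].
Qed.

Lemma observed_finite_stopping : generated_by `[0, +oo[ X [set w | tau w < +oo]%E.
Proof.
rewrite finite_stoppingE; apply: (@bigcupT_measurable _ (observedType X `[0, +oo[)) => n.
exact: observed_stopping.
Qed.

(** The conditional probability in the strong Markov property is a function of the state at [tau],
    and a constant where [tau] is infinite. *)
Lemma stopped_past_state (b : bool) B : measurable B ->
  stopped_sigma_algebra X tau
    [set w | if (tau w < +oo)%E then B (X (fine (tau w)) w) else b].
Proof.
move=> mB; set E := mkset _.
have FE (t : R) : 0 <= t -> natural_filtration X t (E `&` [set w | tau w <= t%:E]%E).
  move=> t0; rewrite (_ : E `&` _ =
    [set w | (tau w <= t%:E)%E] `&` [set w | B (X (fine (tau w)) w)]).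
    exact: filtration_stopped_state.
  apply/seteqP; split=> w; rewrite /E /= => -[].
    by move=> + tt; rewrite (le_lt_trans tt (ltry _)).
  by move=> tt ?; rewrite (le_lt_trans tt (ltry _)).
split=> //.
pose fin := [set w | tau w < +oo]%E.
rewrite (_ : E = \bigcup_n (E `&` [set w | tau w <= n%:R%:E]%E) `|`
    (~` fin `&` (if b then setT else set0))).
  apply: (@measurableU _ (observedType X `[0, +oo[)).
    apply: (@bigcupT_measurable _ (observedType X `[0, +oo[)) => n.
    apply: (generated_by_subset _ (FE _ (ler0n _ n))).
    by move=> r /=; rewrite !in_itv/= => /andP[->].
  apply: (@measurableI _ (observedType X `[0, +oo[)).
    by apply: (@measurableC _ (observedType X `[0, +oo[)); exact: observed_finite_stopping.
  by case: b @E FE => *; [exact: measurableT|exact: measurable0].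
rewrite -setI_bigcupr -finite_stoppingE -/fin; apply/seteqP; split=> w /=.
  rewrite /E /fin /=; case: ifPn => tw; first by left.
  by move=> bT; right; split => //; rewrite bT.
move=> [[]//|]; rewrite /E /fin /= => -[/negP/negbTE ->].
by case: b @E FE.
Qed.

Lemma sub_observed (I : set R) : (forall r, I r -> 0 <= r) -> generated_by I X `<=` measurable.
Proof.
move=> I0; apply: smallest_sub; first exact: sigma_algebra_measurable.
by move=> E [r [A [/I0 r0 mA ->]]]; rewrite -[_ @^-1` _]setTI; exact: mX.
Qed.

Lemma measurable_finite_stopping : measurable [set w | tau w < +oo]%E.
Proof. by apply: (sub_observed _ observed_finite_stopping) => r /=; rewrite in_itv/= => /andP[]. Qed.

Lemma measurable_stopping : measurable_fun setT (fun w => fine (tau w)).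
Proof.
apply: (measurability _ (RGenOInfty.measurableE R)) => _ [_ [r ->] <-].
rewrite setTI.
rewrite (_ : _ @^-1` _ = ~` [set w | fine (tau w) <= r]); last first.
  by apply/seteqP; split=> w /=; rewrite in_itv/= andbT ltNge => /negP.
apply: measurableC.
have [r0|r0] := leP 0 r; last first.
  rewrite (_ : mkset _ = set0)//; apply/seteqP; split=> w //= wr.
  by have := le_lt_trans wr r0; rewrite ltNge fine_ge0.
rewrite (_ : mkset _ = [set w | tau w <= r%:E]%E `|` ~` [set w | tau w < +oo]%E).
  apply: measurableU; last by apply: measurableC; exact: measurable_finite_stopping.
  by apply: (sub_natural_filtration mX (t := r)); exact: tau_stop.2.
apply/seteqP; split=> w /=.
  move=> wr; have [too|too] := boolP (tau w < +oo)%E; [left|by right; apply/negP].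
  by rewrite -(@fineK _ (tau w)) ?lee_fin// ge0_fin_numE.
move=> [wr|]; first by rewrite -lee_fin -(fine_tau wr).
move=> /negP; rewrite -leNgt leye_eq => /eqP ->.
by [].
Qed.

Lemma measurable_after_stopping (s : R) : 0 <= s ->
  measurable_fun setT (fun w => X (fine (tau w) + s) w).
Proof.
move=> s0; apply: measurable_process_at_clock => //.
- by move=> w; rewrite addr_ge0// fine_ge0.
- by apply: measurable_funD => //; exact: measurable_stopping.
- move=> w u cu uc; apply: (right_cvg_seq (g := fun s => X s w)) => //.
  by apply: X_right; rewrite addr_ge0// fine_ge0.
Qed.

(** The cell of the grid that contains [tau] is known at the end of that cell. *)
Lemma stopped_grid (G : set Omega) n i : stopped_sigma_algebra X tau G ->
  natural_filtration X (grid_point n i)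
    (G `&` [set w | (i%:R / n.+1%:R)%:E <= tau w]%E `&` [set w | tau w < (grid_point n i)%:E]%E).
Proof.
move=> [_ FG]; have g0 : 0 <= grid_point n i :> R by exact: grid_point_ge0.
have i0 : 0 <= i%:R / n.+1%:R :> R by rewrite divr_ge0.
have ig : i%:R / n.+1%:R <= grid_point n i :> R by rewrite ler_pM2r ?invr_gt0// ler_nat.
rewrite (_ : _ `&` _ `&` _ = (G `&` [set w | tau w <= (grid_point n i)%:E]%E) `&`
  (~` [set w | tau w < (i%:R / n.+1%:R)%:E]%E `&` [set w | tau w < (grid_point n i)%:E]%E)).
  apply: (@measurableI _ (observedType X `[0, grid_point n i])); first exact: FG.
  apply: (@measurableI _ (observedType X `[0, grid_point n i])); last exact: filtration_lt.
  apply: (@measurableC _ (observedType X `[0, grid_point n i])).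
  by apply: (filtration_mono ig); exact: filtration_lt.
apply/seteqP; split=> w /=.
  by move=> [[Gw it] tg]; split; split => //; [exact: ltW|apply/negP; rewrite -leNgt].
by move=> [[Gw _] [/negP]]; rewrite -leNgt => ? ?; split.
Qed.

End stopping.

(** * The strong Markov property *)

Section queue_strong_markov.
Context {R : realType}.
Notation mu := (@lebesgue_measure R).
Variables (lam h : nat * R -> R) (C : R).
Hypotheses (Il : bounded_intensity C lam) (Ih : bounded_intensity C h).
Let lam_meas := intensity_meas Il. Let h_meas := intensity_meas Ih.
Let lam_ge0 := intensity_ge0 Il. Let h_ge0 := intensity_ge0 Ih.
Let lam_le := intensity_le Il. Let h_le := intensity_le Ih.
Context {d : measure_display} {Omega : measurableType d}.
Variables (P : nat * R -> probability Omega R) (X : R -> Omega -> nat * R).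
Hypothesis X_queue : queue_process lam h P X.
Local Open Scope ereal_scope.

Let mX t : (0 <= t)%R -> measurable_fun setT (X t).
Proof. by move=> t0; exact: (measurable_queue X_queue). Qed.

Let X_right t w : (0 <= t)%R -> X s w @[s --> t^'+] --> X t w.
Proof. by case: X_queue => _ _ + _ _; apply. Qed.

Let Xsp t w : (0 <= t)%R -> statespace (X t w).
Proof. by move=> t0; exact: (queue_statespace X_queue). Qed.

Section flow_stable.
Variables (A : set (nat * R)) (s : R).
Hypotheses (mA : measurable A) (s0 : (0 <= s)%R).
Hypothesis A_flow : forall y : nat * R, exists2 e : R, (0 < e)%R &
  forall r, (0 <= r)%R -> (r < e)%R -> A (shift y r) <-> A y.

Let indA (y : nat * R) : \bar R := (\1_A y)%:E.
Let v y := transition lam h indA (s, y).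

Let mind : measurable_fun setT indA.
Proof. by apply/measurable_EFinP; exact: measurable_indic. Qed.

Let ind0 y : 0 <= indA y. Proof. by rewrite lee_fin. Qed.

Let ind1 y : indA y <= 1%:E. Proof. by rewrite lee_fin indicE lern1 leq_b1. Qed.

Let mv : measurable_fun setT v.
Proof.
exact: (measurable_fun_pair2 s (measurable_transition Il Ih mind ind0)).
Qed.

Let v0 y : 0 <= v y. Proof. exact: transition_ge0. Qed.

Let v1 y : v y <= 1%:E.
Proof. by apply: (transition_le Il Ih mind ind0 ind1). Qed.

Let prob_integrable x (D : set Omega) : measurable D -> (P x).-integrable D (cst 1).
Proof.
move=> mD; apply: (integrableS measurableT) => //.
exact: finite_measure_integrable_cst.
Qed.

(** Right after each time the path follows the flow, which does not change membership in [A]. *)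
Lemma flow_stable_path x : statespace x -> {ae P x, forall w,
  forall (t : R) (u : nat -> R), (0 <= t)%R -> (forall n, (t <= u n)%R) -> u @ \oo --> t ->
    (\forall n \near \oo, X (u n) w = shift (X t w) (u n - t)) /\
    (\forall n \near \oo, indA (X (u n) w) = indA (X t w))}.
Proof.
move=> sx.
have := queue_local_flow Il Ih X_queue sx.
apply: filterS => w Xw t u t0 tu ut; have [e e0 He] := Xw t t0.
have near_shift a : (0 < a)%R -> \forall n \near \oo, (u n - t < a)%R.
  move=> a0; move/cvgrPdist_lt : ut => /(_ _ a0); apply: filterS => n.
  by rewrite distrC ger0_norm// subr_ge0.
have E1 n : (u n - t < e)%R -> X (u n) w = shift (X t w) (u n - t).
  by move=> ne; rewrite -He ?subr_ge0// addrC subrK.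
split; first by apply: filterS (near_shift _ e0) => n /E1.
have [e' e'0 Ae'] := A_flow (X t w).
apply: filterS2 (near_shift _ e0) (near_shift _ e'0) => n /E1 -> ne'.
have AE : A (shift (X t w) (u n - t)) <-> A (X t w) by apply: Ae'; rewrite ?subr_ge0.
rewrite /indA !indicE; congr ((nat_of_bool _)%:R%:E).
by apply/idP/idP => /set_mem /AE /mem_set.
Qed.

(** Letting the process run for the time [u n] changes the mean of [v] by [O(u n)] only. By the
    Markov property that mean is the probability of [A] at time [u n + s], which converges by
    [flow_stable_path]. *)
Lemma transition_cvg_flow y (u : nat -> R) : statespace y ->
  (forall n, (0 <= u n)%R) -> u @ \oo --> 0%R -> v (shift y (u n)) @[n --> \oo] --> v y.
Proof.
move=> sy u0 ucv.
have vf z : v z \is a fin_num.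
  by rewrite ge0_fin_numE//; exact: le_lt_trans (v1 z) (ltry _).
have EW n : transition lam h v (u n, y) = \int[P y]_w indA (X (u n + s)%R w).
  rewrite -(queue_transition Il Ih X_queue sy mv v0 (u0 n)).
  apply/esym.
  apply: (queue_markov Il Ih X_queue sy mind ind0 (u0 n) s0).
  exact: (@measurableT _ (observedType X `[0%R, u n])).
have [_ _ cW] : [/\ (P y).-integrable setT (fun w => indA (X s w)),
    [sequence \int[P y]_w `|indA (X (u n + s)%R w) - indA (X s w)|]_n @ \oo --> 0
  & [sequence \int[P y]_w indA (X (u n + s)%R w)]_n @ \oo --> \int[P y]_w indA (X s w)].
  apply: (@dominated_convergence _ _ _ (P y) _ measurableT (fun n w => indA (X (u n + s)%R w)) _ (cst 1)).
  - by move=> n; apply: (measurableT_comp mind); apply: mX; rewrite addr_ge0.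
  - by apply: (measurableT_comp mind); exact: mX.
  - have := flow_stable_path sy; apply: filterS => w /(_ s (fun n => u n + s)%R s0) H _.
    apply: cvg_near_cst; apply: (H _ _).2.
      by move=> n; rewrite lerDr.
    by rewrite -[X in _ --> X]add0r; apply: cvgD => //; exact: cvg_cst.
  - exact: prob_integrable.
  - by apply: aeW => w n _; rewrite gee0_abs.
rewrite /= (queue_transition Il Ih X_queue sy mind ind0 s0) in cW.
rewrite -/(v y) -(fineK (vf y)) in cW *.
have cw : fine (transition lam h v (u n, y)) @[n --> \oo] --> fine (v y).
  under eq_fun do rewrite EW.
  exact: fine_cvg cW.
apply: cvg_EFin; first exact: nearW.
have -> : fine \o (fun n => v (shift y (u n))) =
    (fun n => fine (transition lam h v (u n, y)) - (fine (transition lam h v (u n, y)) - fine (v (shift y (u n)))))%R.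
  by apply/funext => n /=; rewrite subKr.
rewrite -[X in _ --> X]subr0; apply: cvgB; first exact: cw.
apply/cvgr0Pnorm_le => e e0.
have C0 : (0 <= C)%R by apply: le_trans (lam_ge0 y) _.
have : (u n * (2 * C))%R @[n --> \oo] --> 0%R.
  by rewrite -[X in _ --> X](mul0r (2 * C)%R); apply: cvgM => //; exact: cvg_cst.
move/cvgr0Pnorm_le => /(_ _ e0); apply: filterS => n; apply: le_trans.
apply: le_trans (transition_short_time Il Ih mv v0 v1 y (u0 n)) _.
by rewrite mulr1 mulrC ler_norm.
Qed.

Variables (x : nat * R) (tau : Omega -> \bar R) (G : set Omega).
Hypotheses (sx : statespace x) (tau_stop : stopping_time (natural_filtration X) tau).
Hypothesis FG : stopped_sigma_algebra X tau G.

Let c w := fine (tau w).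
Let Gf := G `&` [set w | tau w < +oo].

Let c0 w : (0 <= c w)%R. Proof. by rewrite fine_ge0//; exact: tau_stop.1. Qed.

Let mG : measurable G.
Proof. by apply: (sub_observed mX _ FG.1) => r /=; rewrite in_itv/= => /andP[]. Qed.

Let mGf : measurable Gf.
Proof. by apply: measurableI => //; exact: (measurable_finite_stopping mX tau_stop). Qed.

Let mc : measurable_fun setT c. Proof. exact: (measurable_stopping mX tau_stop). Qed.

(** On each cell of the grid the time following [tau] is a constant, to which the Markov property
    at fixed times applies. *)
Lemma markov_at_grid n (f : nat * R -> \bar R) : measurable_fun setT f -> (forall y, 0 <= f y) ->
  \int[P x]_(w in Gf) f (X (grid n (c w) + s)%R w) =
  \int[P x]_(w in Gf) transition lam h f (s, X (grid n (c w)) w).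
Proof.
move=> mf f0.
pose Gi i := G `&` [set w | (i%:R / n.+1%:R)%R%:E <= tau w] `&` [set w | tau w < (grid_point n i)%:E].
have FGi i : natural_filtration X (grid_point n i) (Gi i) by exact: stopped_grid.
have mGi i : measurable (Gi i) by exact: sub_natural_filtration (FGi i).
have idx i w : Gi i w -> grid_index n (c w) = i.
  move=> [[_ /= it] ti]; apply/eqP; rewrite grid_indexP//.
  have tf : tau w = (c w)%:E.
    by rewrite /c fineK// ge0_fin_numE; [exact: lt_trans ti (ltry _)|exact: tau_stop.1].
  by move: it ti; rewrite tf lee_fin lte_fin => -> ->.
have GfE : Gf = \bigcup_i Gi i.
  apply/seteqP; split=> w.
    move=> [Gw /= too]; exists (grid_index n (c w)) => //.
    have tf : tau w = (c w)%:E by rewrite /c fineK// ge0_fin_numE//; exact: tau_stop.1.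
    have := grid_indexP n (grid_index n (c w)) (c0 w); rewrite eqxx => /esym/andP[h1 h2].
    by split; [split => //=; rewrite tf lee_fin|rewrite /= tf lte_fin].
  move=> [i _ [[Gw it] /= ti]]; split => //=; exact: lt_trans ti (ltry _).
have tGi : trivIset setT Gi.
  by move=> i j _ _ [w [/idx <- /idx]].
have mp := measurable_transition Il Ih mf f0.
have p0 := transition_ge0 Il Ih mf f0.
have mk := measurable_grid_index n mc c0.
have m1 : measurable_fun setT (fun w => f (X (grid n (c w) + s)%R w)).
  apply: (measurableT_comp mf).
  apply: (@measurable_fun_nat_cases _ _ (fun w => grid_index n (c w)) _ _ (fun i => X (grid_point n i + s)%R)) => // i.
  by apply: mX; rewrite addr_ge0// grid_point_ge0.
have m2 : measurable_fun setT (fun w => transition lam h f (s, X (grid n (c w)) w)).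
  apply: (measurableT_comp mp); apply: measurable_fun_pair => //.
  apply: (@measurable_fun_nat_cases _ _ (fun w => grid_index n (c w)) _ _ (fun i => X (grid_point n i))) => // i.
  by apply: mX; rewrite grid_point_ge0.
rewrite GfE (ge0_integral_bigcup _ mGi (measurable_funTS m1))//.
rewrite (ge0_integral_bigcup _ mGi (measurable_funTS m2))//.
apply: eq_eseriesr => i _.
transitivity (\int[P x]_(w in Gi i) f (X (grid_point n i + s)%R w)).
  by apply: eq_integral => w /set_mem /idx iw; rewrite /grid iw.
rewrite (queue_markov Il Ih X_queue sx mf f0
  (grid_point_ge0 n i) s0 (FGi i)).
by apply: eq_integral => w /set_mem /idx iw; rewrite /grid iw.
Qed.

Lemma flow_stable_strong_markov :
  \int[P x]_(w in Gf) indA (X (c w + s)%R w) = \int[P x]_(w in Gf) v (X (c w) w).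
Proof.
have mXc := measurable_after_stopping mX X_right tau_stop.
have mGr (r : R) : (0 <= r)%R -> forall n, measurable_fun setT (fun w => X (grid n (c w) + r)%R w).
  move=> r0 n; apply: measurable_process_at_clock => //.
  - by move=> w; rewrite addr_ge0//; apply: ltW; apply: le_lt_trans (c0 w) (grid_gt n (c0 w)).
  - apply: measurable_funD => //.
    apply: (@measurable_fun_nat_cases _ _ (fun w => grid_index n (c w)) _ _ (fun i => cst (grid_point n i))) => // i.
    exact: measurable_grid_index.
  - move=> w u cu uc; apply: (right_cvg_seq (g := fun s => X s w)) => //.
    apply: X_right; rewrite addr_ge0//; apply: ltW; exact: le_lt_trans (c0 w) (grid_gt n (c0 w)).
have [_ _ c1] : [/\ (P x).-integrable Gf (fun w => indA (X (c w + s)%R w)),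
    [sequence \int[P x]_(w in Gf) `|indA (X (grid n (c w) + s)%R w) - indA (X (c w + s)%R w)|]_n @ \oo --> 0
  & [sequence \int[P x]_(w in Gf) indA (X (grid n (c w) + s)%R w)]_n @ \oo -->
      \int[P x]_(w in Gf) indA (X (c w + s)%R w)].
  apply: (@dominated_convergence _ _ _ (P x) _ mGf (fun n w => indA (X (grid n (c w) + s)%R w)) _ (cst 1)).
  - by move=> n; apply: measurable_funTS; apply: (measurableT_comp mind); exact: mGr.
  - by apply: measurable_funTS; apply: (measurableT_comp mind); exact: mXc.
  - have := flow_stable_path sx; apply: filterS => w H _; apply: cvg_near_cst.
    apply: (H _ (fun n => grid n (c w) + s)%R _ _ _).2; first by rewrite addr_ge0.
      by move=> n; rewrite lerD2r ltW// grid_gt.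
    by apply: cvgD; [exact: cvg_grid|exact: cvg_cst].
  - exact: prob_integrable.
  - by apply: aeW => w n _; rewrite gee0_abs.
have [_ _ c2] : [/\ (P x).-integrable Gf (fun w => v (X (c w) w)),
    [sequence \int[P x]_(w in Gf) `|v (X (grid n (c w)) w) - v (X (c w) w)|]_n @ \oo --> 0
  & [sequence \int[P x]_(w in Gf) v (X (grid n (c w)) w)]_n @ \oo -->
      \int[P x]_(w in Gf) v (X (c w) w)].
  apply: (@dominated_convergence _ _ _ (P x) _ mGf (fun n w => v (X (grid n (c w)) w)) _ (cst 1)).
  - move=> n; apply: measurable_funTS; apply: (measurableT_comp mv).
    by have := mGr _ (lexx 0%R) n; under eq_fun do rewrite addr0.
  - apply: measurable_funTS; apply: (measurableT_comp mv).
    by have := mXc _ (lexx 0%R); under eq_fun do rewrite addr0.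
  - have := flow_stable_path sx; apply: filterS => w H _.
    have gc := cvg_grid (c0 w).
    have gt n : (c w <= grid n (c w))%R by exact/ltW/grid_gt.
    have [near_flow _] := H _ (fun n => grid n (c w)) (c0 w) gt gc.
    have : v (shift (X (c w) w) (grid n (c w) - c w)) @[n --> \oo] --> v (X (c w) w).
      apply: transition_cvg_flow; first exact: Xsp.
        by move=> n; rewrite subr_ge0.
      by rewrite -[X in _ --> X](subrr (c w)); apply: cvgB => //; exact: cvg_cst.
    apply: cvg_trans; apply: near_eq_cvg; apply: filterS near_flow => n ->.
    by [].
  - exact: prob_integrable.
  - by apply: aeW => w n _; rewrite gee0_abs.
have e12 : [sequence \int[P x]_(w in Gf) indA (X (grid n (c w) + s)%R w)]_n =
    [sequence \int[P x]_(w in Gf) v (X (grid n (c w)) w)]_n.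
  by apply/funext => n /=; exact: markov_at_grid.
rewrite e12 in c1.
exact: (cvg_unique _ c1 c2).
Qed.

End flow_stable.

(** The flow never leaves a ray, and it enters a ray only after a positive time. *)
Definition ray (n : nat) (a : R) : set (nat * R) := [set n] `*` `[a, +oo[%classic.

Definition rays : set (set (nat * R)) :=
  [set A | A = set0 \/ exists n a, A = ray n a].

Lemma measurable_ray n a : measurable (ray n a).
Proof. by apply: measurableX => //; exact: measurable_itv. Qed.

Lemma raysI : setI_closed rays.
Proof.
move=> A B [->|[n [a ->]]]; first by left; rewrite set0I.
move=> [->|[m [b ->]]]; first by left; rewrite setI0.
have [nm|/eqP nm] := eqVneq n m; last first.
  by left; apply/seteqP; split=> -[i z] //= [[/= -> _] [/= /nm]].
right; exists n, (if (a <= b)%R then b else a); rewrite -nm /ray -setXI setIid; congr (_ `*` _).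
apply/seteqP; split=> z /=; rewrite !in_itv/= !andbT.
  by case: ifP => _ [].
by case: (leP a b) => ab bz; split => //; [exact: le_trans bz|exact: ltW (lt_le_trans ab bz)].
Qed.

Lemma rays_generate : (measurable : set (set (nat * R))) = <<s rays >>.
Proof.
apply/seteqP; split; last first.
  apply: smallest_sub; first exact: sigma_algebra_measurable.
  by move=> A [->//|[n [a ->]]]; exact: measurable_ray.
pose S := g_sigma_algebraType rays.
have m2 (n : nat) (B : set R) : measurable B -> (measurable : set (set S)) ([set n] `*` B).
  move=> mB0; have mB : (RGenCInfty.G (R:=R)).-sigma.-measurable B by rewrite -RGenCInfty.measurableE.
  pose f (z : nat * R) := if z.1 == n then z.2 else 0%R.
  have mn : (measurable : set (set S)) ([set n] `*` setT).
    rewrite (_ : _ `*` _ = \bigcup_i ray n (- i%:R)).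
      apply: (@bigcupT_measurable _ S) => i; apply: sub_sigma_algebra.
      by right; exists n, (- i%:R)%R.
    apply/seteqP; split=> -[m z] /=; last by move=> [i _ [/= -> _]].
    move=> [-> _]; exists (Num.truncn `|z|).+1 => //; split => //=.
    rewrite in_itv/= andbT lerNl; apply: le_trans (ler_norm _) _.
    by rewrite normrN; exact/ltW/truncnS_gt.
  move: B mB {mB0}; apply: smallest_sub.
    split.
    - by rewrite setX0; exact: (@measurable0 _ S).
    - move=> B mB; rewrite setTD (_ : _ `*` _ = ([set n] `*` setT) `\` ([set n] `*` B)).
        exact: (@measurableD _ S).
      apply/seteqP; split=> -[m z] /=; first by move=> [-> Bz]; split => // -[].
      by move=> [[-> _] nB]; split => // Bz; apply: nB.
    - move=> B mB; rewrite setX_bigcupr; exact: (@bigcupT_measurable _ S).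
  by move=> _ [a ->]; apply: sub_sigma_algebra; right; exists n, a.
rewrite measurable_prod_measurableType; apply: smallest_sub; first exact: smallest_sigma_algebra.
move=> _ [A mA [B mB <-]].
rewrite (_ : A `*` B = \bigcup_(n in A) ([set n] `*` B)).
  by apply: (@bigcup_measurable _ S) => n _; exact: m2.
by apply/seteqP; split=> -[m z] /=; [move=> [Am Bz]; exists m|move=> [n An [/= ->]]].
Qed.

Lemma ray_flow n a (y : nat * R) : exists2 e : R, (0 < e)%R &
  forall r, (0 <= r)%R -> (r < e)%R -> ray n a (shift y r) <-> ray n a y.
Proof.
case: y => m z; rewrite /shift /ray /=; case: eqP => m0; first by exists 1%R.
have [az|za] := leP a z.
  exists 1%R => // r r0 _ /=; rewrite !in_itv/= !andbT; split=> -[mn _]; split => //.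
  by rewrite (le_trans az)// lerDl.
exists (a - z)%R; first by rewrite subr_gt0.
move=> r r0 rz /=; rewrite !in_itv/= !andbT; split=> -[_].
  by rewrite leNgt -ltrBrDl rz.
by rewrite leNgt za.
Qed.

Section at_stopping_time.
Variables (x : nat * R) (tau : Omega -> \bar R) (G : set Omega) (s : R).
Hypotheses (sx : statespace x) (tau_stop : stopping_time (natural_filtration X) tau).
Hypothesis FG : stopped_sigma_algebra X tau G.
Hypothesis s0 : (0 <= s)%R.

Let c w := fine (tau w).
Let Gf := G `&` [set w | tau w < +oo].

(** Both sides are positive functionals of [f], and they agree on the indicators of rays. *)
Lemma strong_markov_expectation (f : nat * R -> \bar R) :
  measurable_fun setT f -> (forall y, 0 <= f y) ->
  \int[P x]_(w in Gf) f (X (c w + s)%R w) =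
  \int[P x]_(w in Gf) \int[P (X (c w) w)]_w' f (X s w').
Proof.
have c0 w : (0 <= c w)%R by rewrite fine_ge0//; exact: tau_stop.1.
have mGf : measurable Gf.
  apply: measurableI; last exact: (measurable_finite_stopping mX tau_stop).
  by apply: (sub_observed mX _ FG.1) => r /=; rewrite in_itv/= => /andP[].
have mXc (r : R) : (0 <= r)%R -> measurable_fun setT (fun w => X (c w + r)%R w).
  by move=> r0; exact: measurable_after_stopping.
have KE w (g : nat * R -> \bar R) : measurable_fun setT g -> (forall y, 0 <= g y) ->
    \int[P (X (c w) w)]_w' g (X s w') = transition lam h g (s, X (c w) w).
  move=> mg g0.
  by apply: (queue_transition Il Ih X_queue) => //; exact: Xsp.
have pJ := posfun_integral (P x) mGf.
have p1 : posfun (fun g : nat * R -> \bar R => \int[P x]_(w in Gf) g (X (c w + s)%R w)).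
  apply: (posfun_mix pJ (K := fun w g => g (X (c w + s)%R w))).
    by move=> w; exact: posfun_eval.
  by move=> g mg g0; apply: (measurableT_comp mg); exact: mXc.
have p2 : posfun (fun g : nat * R -> \bar R =>
    \int[P x]_(w in Gf) \int[P (X (c w) w)]_w' g (X s w')).
  apply: (posfun_mix pJ (K := fun w g => \int[P (X (c w) w)]_w' g (X s w'))).
    move=> w; apply: (posfun_mix (posfun_integral (P (X (c w) w)) measurableT) (K := fun w' g => g (X s w'))).
      by move=> w'; exact: posfun_eval.
    by move=> g mg g0; apply: (measurableT_comp mg); exact: mX.
  move=> g mg g0; under eq_fun do rewrite KE//.
  apply: (measurableT_comp (measurable_transition Il Ih mg g0)).
  apply: measurable_fun_pair => //.
  by have := mXc _ (lexx 0%R); under eq_fun do rewrite addr0.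
(* the rays with integer endpoints cover the whole type, negative ages included *)
pose g_ (k : nat) : set (nat * R) :=
  let p := odflt (0%N, 0%N) (pickle_inv k) in ray p.1 (- p.2%:R)%R.
apply: (@posfun_unique _ _ _ _ _ rays g_ p1 p2) => //.
- exact: rays_generate.
- exact: raysI.
- by move=> k; right; rewrite /g_; eexists; eexists.
- apply/seteqP; split=> // -[m z] _.
  exists (pickle (m, (Num.truncn `|z|).+1)) => //; rewrite /g_ pickleK_inv /=; split => //=.
  rewrite in_itv/= andbT lerNl; apply: le_trans (ler_norm _) _.
  by rewrite normrN; exact/ltW/truncnS_gt.
- move=> A [->|[n [a ->]]].
    rewrite indic0 integral0_eq//; rewrite integral0_eq// => w _.
    by rewrite integral0_eq.
  have ray_flow' := ray_flow n a.
  rewrite (flow_stable_strong_markov (measurable_ray n a) s0 (ray_flow n a) sx tau_stop FG).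
  apply: eq_integral => w _; apply/esym; apply: (KE w (fun y => (\1_(ray n a) y)%:E)) => //.
  by apply/measurable_EFinP; apply: measurable_indic; exact: measurable_ray.
- move=> k; apply: (@le_lt_trans _ _ (\int[P x]_(w in Gf) (cst 1%:E) w)).
    apply: ge0_le_integral => //.
    + apply: measurable_funTS; apply: (@measurableT_comp _ _ _ _ _ _ (fun y => (\1_(g_ k) y)%:E)); last exact: mXc.
      apply/measurable_EFinP; apply: measurable_indic; exact: measurable_ray.
    + by move=> w _; rewrite lee_fin indicE lern1 leq_b1.
  rewrite integral_cst// mul1e; apply: le_lt_trans (probability_le1 _ mGf) _; exact: ltry.
Qed.

End at_stopping_time.

Lemma measurable_transition_probability (s : R) (A : set (nat * R)) : (0 <= s)%R -> measurable A ->
  measurable_fun statespace (fun y => P y (X s @^-1` A)).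
Proof.
move=> s0 mA; pose indA (y : nat * R) : \bar R := (\1_A y)%:E.
have mind : measurable_fun setT indA by apply/measurable_EFinP; exact: measurable_indic.
have ind0 y : 0 <= indA y by rewrite lee_fin.
have mXA : measurable (X s @^-1` A) by rewrite -[_ @^-1` _]setTI; exact: mX.
apply: (@eq_measurable_fun _ _ _ _ _ (fun y => transition lam h indA (s, y))).
  move=> y /set_mem sy; rewrite -(queue_transition Il Ih X_queue sy mind ind0 s0).
  by rewrite -[X s @^-1` A]setIT -integral_indic// setIT.
apply: measurable_funTS.
exact: (measurable_fun_pair2 s (measurable_transition Il Ih mind ind0)).
Qed.

Theorem queue_strong_markov : strong_markov P X.
Proof.
split; first exact: measurable_transition_probability.
move=> x tau s A sx tau_stop s0 mA.
have mXA : measurable (X s @^-1` A) by rewrite -[_ @^-1` _]setTI; exact: mX.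
have mXc := measurable_after_stopping mX X_right tau_stop s0.
have mfin := measurable_finite_stopping mX tau_stop.
set E := mkset _.
have EE : E = [set w | tau w < +oo] `&` (fun w => X (fine (tau w) + s)%R w) @^-1` A by [].
have mE : measurable E.
  by rewrite EE; apply: measurableI => //; rewrite -[_ @^-1` _]setTI; exact: mXc.
split=> //.
  move=> B mB.
  pose Q := statespace `&` (fun y => P y (X s @^-1` A)) @^-1` B.
  have mQ : measurable Q.
    by apply: measurable_transition_probability => //; exact: measurable_statespace.
  rewrite (_ : _ @^-1` B = [set w | if tau w < +oo then Q (X (fine (tau w)) w) else `[< B 0 >]]).
    exact: (stopped_past_state X_right tau_stop).
  apply/seteqP; split=> w /=; case: ifPn => tw.
  - by split => //; apply: Xsp; rewrite fine_ge0//; exact: tau_stop.1.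
  - by move=> B0; apply/asboolP.
  - by move=> [].
  - by move=> /asboolP.
move=> G FG.
have mG : measurable G by apply: (sub_observed mX _ FG.1) => r /=; rewrite in_itv/= => /andP[].
pose fin := [set w | tau w < +oo].
pose indA (y : nat * R) : \bar R := (\1_A y)%:E.
have mind : measurable_fun setT indA by apply/measurable_EFinP; exact: measurable_indic.
have ind0 y : 0 <= indA y by rewrite lee_fin.
have := strong_markov_expectation sx tau_stop FG s0 mind ind0.
rewrite integral_mkcondr [X in _ = X -> _]integral_mkcondr.
rewrite -/fin => H.
transitivity (\int[P x]_(w in G) ((fun w => indA (X (fine (tau w) + s)%R w)) \_ fin) w).
  rewrite setIC -integral_indic//; apply: eq_integral => w _.
  rewrite /patch EE indicI /= /indA; case: ifPn => tw.
    by rewrite indicE tw mul1r.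
  by rewrite indicE (negbTE tw) mul0r.
rewrite H; apply: eq_integral => w _; rewrite /patch.
have -> : (w \in fin) = (tau w < +oo) by apply/idP/idP => [/set_mem|/mem_set].
case: (boolP (tau w < +oo)) => tw //.
by rewrite -[X s @^-1` A]setIT -integral_indic// setIT.
Qed.

End queue_strong_markov.

(** * Expectations of bounded variables *)

Section bounded_expectation.
Context {R : realType} {d : measure_display} {Omega : measurableType d}.
Notation mu := (@lebesgue_measure R).
Variable Q : probability Omega R.

Lemma bounded_integrable_prob (g : Omega -> R) M : measurable_fun setT g ->
  (forall w, `|g w| <= M) -> Q.-integrable setT (EFin \o g).
Proof.
move=> mg gM; apply: measurable_bounded_integrable => //.
- by rewrite /= probability_setT ltry.
- exists M; split; first by rewrite num_real.
  by move=> N MN w _; apply: le_trans (gM _) _; exact: ltW.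
Qed.

Lemma le_normr_prob (g : Omega -> R) M : measurable_fun setT g ->
  (forall w, `|g w| <= M) -> `|\int[Q]_w g w| <= M.
Proof.
move=> mg gM; apply: (le_trans (le_normr_Rintegral _ (bounded_integrable_prob mg gM))) => //.
have -> : M = \int[Q]_w cst M w.
  by rewrite Rintegral_cst//= probability_setT mulr1.
apply: le_Rintegral => //.
- apply: (@bounded_integrable_prob (fun w => `|g w|) M); first exact: measurableT_comp.
  by move=> w; rewrite normr_id.
- by apply: (@bounded_integrable_prob (cst M) `|M|).
Qed.

Lemma Rintegral_prob_cst (c : R) : \int[Q]_w c = c.
Proof. by have := @Rintegral_cst _ _ _ Q setT measurableT c; rewrite /= probability_setT mulr1. Qed.

Lemma EFin_Rintegral_prob (g : Omega -> R) M : measurable_fun setT g ->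
  (forall w, `|g w| <= M) -> (\int[Q]_w (g w)%:E)%E = (\int[Q]_w g w)%:E.
Proof.
move=> mg gM; rewrite /Rintegral fineK//; apply: integrable_fin_num => //.
exact: bounded_integrable_prob mg gM.
Qed.

Section exchange.
Variables (G : R * Omega -> R) (M : R).
Hypotheses (mG : measurable_fun setT G) (GM : forall p, `|G p| <= M).

Let GM0 p : 0 <= G p + M.
Proof. by have := GM p; rewrite ler_norml => /andP[+ _]; lra. Qed.

Let mGM : measurable_fun setT (fun p : R * Omega => (G p + M)%:E).
Proof. by apply/measurable_EFinP; apply: measurable_funD. Qed.

Let GMM p : `|G p + M| <= M + M.
Proof. by rewrite ger0_norm// lerD2r; exact: le_trans (ler_norm _) (GM p). Qed.

Lemma measurable_expectation : measurable_fun setT (fun z => \int[Q]_w G (z, w)).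
Proof.
have mz z : measurable_fun setT (fun w => G (z, w)) by exact: measurable_fun_pair2.
rewrite (_ : (fun z => _) = (fun z => fine (\int[Q]_w (G (z, w) + M)%:E)%E - M)); last first.
  apply/funext => z; rewrite -[fine _]/(\int[Q]_w (G (z, w) + M)).
  rewrite RintegralD//; last 2 first.
    exact: (bounded_integrable_prob (mz z) (fun w => GM _)).
    exact: (@bounded_integrable_prob (cst M) `|M|).
  by rewrite Rintegral_prob_cst addrK.
apply: measurable_funB => //; apply: measurableT_comp => //.
by apply: (measurable_fun_fubini_tonelli_F (fun p : R * Omega => (G p + M)%:E)) => // p; rewrite lee_fin.
Qed.

Lemma measurable_segment_integral (a b : R) :
  measurable_fun setT (fun w => \int[mu]_(z in `[a, b]) G (z, w)).
Proof.
have mw w : measurable_fun setT (fun z => G (z, w)) by exact: measurable_fun_pair1.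
rewrite (_ : (fun w => _) = (fun w => \int[mu]_(z in `[a, b]) (G (z, w) + M) -
    \int[mu]_(z in `[a, b]) M)).
  apply: measurable_funB => //.
  apply: (@measurable_fun_Rintegral_segment _ _ _ (cst a) (cst b) (fun q => G (q.2, q.1) + M)) => //.
  by apply: measurable_funD => //; apply: (measurableT_comp mG); exact: measurable_fun_pair.
apply/funext => w; rewrite RintegralD ?addrK//.
  by apply: (@bounded_integrable_segment _ (fun z => G (z, w)) M) => // z _; exact: GM.
by apply: (@bounded_integrable_segment _ (cst M) `|M|).
Qed.

Lemma Rintegral_exchange (a b : R) :
  \int[Q]_w \int[mu]_(z in `[a, b]) G (z, w) = \int[mu]_(z in `[a, b]) \int[Q]_w G (z, w).
Proof.
have mz z : measurable_fun setT (fun w => G (z, w)) by exact: measurable_fun_pair2.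
have mw w : measurable_fun setT (fun z => G (z, w)) by exact: measurable_fun_pair1.
pose f (p : R * Omega) := (G p * \1_(`[a, b]%classic : set R) p.1)%:E.
have mf : measurable_fun setT f.
  apply/measurable_EFinP; apply: measurable_funM => //.
  have m1 : measurable_fun setT (\1_(`[a, b]%classic : set R) : R -> R).
    by apply: measurable_indic; exact: measurable_itv.
  exact: (measurableT_comp m1 measurable_fst).
have fE z w : f (z, w) = ((fun z => (G (z, w))%:E) \_ `[a, b]) z.
  rewrite /f /= indicE patchE; case: ifP => _; first by rewrite mulr1.
  by rewrite mulr0.
have intf : (mu \x Q)%E.-integrable setT f.
  apply/integrable12ltyP => //.
  apply: (@le_lt_trans _ _ (\int[mu]_(z in `[a, b]) (cst M%:E z))%E); last first.
    rewrite integral_cst//.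
    have mf' : mu `[a, b] \is a fin_num by rewrite ge0_fin_numE//; exact: segment_lty.
    by rewrite ltey_eq; apply/orP; left; apply: fin_numM.
  rewrite [leRHS]integral_mkcond; apply: ge0_le_integral => //.
  - by move=> z _; apply: integral_ge0.
  - apply: (measurable_fun_fubini_tonelli_F (fun p : R * Omega => `|f p|%E)) => //.
    exact: measurableT_comp.
  - by apply/(measurable_restrictT _ (measurable_itv _)).
  - move=> z _; rewrite patchE; case: ifPn => zab.
      apply: (@le_trans _ _ (\int[Q]_w (cst M%:E w))%E); last first.
        by rewrite integral_cst//= probability_setT mule1.
      apply: ge0_le_integral => //.
      + apply: measurableT_comp => //; exact: (measurable_fun_pair2 z mf).
      + by move=> w _; rewrite fE patchE zab /= lee_fin.
    by rewrite integral0_eq// => w _; rewrite fE patchE (negbTE zab) abse0.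
have H := Fubini intf.
have i1 z : z \in (`[a, b]%classic : set R) -> (\int[Q]_w f (z, w))%E = (\int[Q]_w G (z, w))%:E.
  move=> zab; rewrite -(EFin_Rintegral_prob (mz z) (fun w => GM _)).
  by apply: eq_integral => w _; rewrite fE patchE zab.
have i2 w : (\int[mu]_z f (z, w))%E = (\int[mu]_(z in `[a, b]) G (z, w))%:E.
  rewrite /Rintegral fineK; last first.
    apply: integrable_fin_num => //.
    by apply: (@bounded_integrable_segment _ (fun z => G (z, w)) M) => // z _; exact: GM.
  by rewrite [RHS]integral_mkcond; apply: eq_integral => z _; rewrite fE.
rewrite {1}/Rintegral [RHS]/Rintegral; congr fine.
transitivity (\int[Q]_w \int[mu]_z f (z, w))%E.
  by apply: eq_integral => w _; rewrite i2.
rewrite -H [RHS]integral_mkcond; apply: eq_integral => z _; rewrite patchE; case: ifPn => zab.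
  by rewrite i1.
by rewrite integral0_eq// => w _; rewrite fE patchE (negbTE zab).
Qed.

End exchange.
End bounded_expectation.

(** * Dynkin's formula *)

Section dynkin_local.
Context {R : realType}.
Notation mu := (@lebesgue_measure R).
Variables (lam h : nat * R -> R) (C : R).
Hypotheses (Il : bounded_intensity C lam) (Ih : bounded_intensity C h).
Let lam_meas := intensity_meas Il. Let h_meas := intensity_meas Ih.
Let lam_ge0 := intensity_ge0 Il. Let h_ge0 := intensity_ge0 Ih.
Let lam_le := intensity_le Il. Let h_le := intensity_le Ih.
Variables (phi psi : R -> nat * R -> R) (M K : R).
Hypothesis mphi : measurable_fun setT (fun p : R * (nat * R) => phi p.1 p.2).
Hypothesis mpsi : measurable_fun setT (fun p : R * (nat * R) => psi p.1 p.2).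
Hypotheses (phi_ge0 : forall t y, 0 <= phi t y) (phi_le : forall t y, phi t y <= M).
Hypothesis psi_le : forall t y, `|psi t y| <= K.
Hypothesis phi_flow : forall t y z, 0 <= t -> statespace y -> 0 <= z ->
  phi (t + z) (shift y z) - phi t y = \int[mu]_(r in `[0, z]) psi (t + r) (shift y r).

(** When [psi] is the derivative of [phi] along the flow, this is the generator of the process
    (t, X_t) applied to [phi]. *)
Definition drift (t : R) (y : nat * R) : R :=
  psi t y + lam y * (phi t (up y) - phi t y) + h y * (phi t (down y) - phi t y).

Let C0 : 0 <= C. Proof. exact: le_trans (lam_ge0 (0%N, 0)) (lam_le _). Qed.
Let M0 : 0 <= M. Proof. exact: le_trans (phi_ge0 0 (0%N, 0)) (phi_le _ _). Qed.
Let K0 : 0 <= K. Proof. exact: le_trans (normr_ge0 _) (psi_le 0 (0%N, 0)). Qed.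

Let mphit t : measurable_fun setT (phi t).
Proof. exact: (measurable_fun_pair2 t mphi). Qed.

Let mphitE t : measurable_fun setT (EFin \o phi t).
Proof. exact/measurable_EFinP. Qed.

Let phiE0 t y : (0 <= (EFin \o phi t) y)%E. Proof. by rewrite lee_fin. Qed.
Let phiEM t y : ((EFin \o phi t) y <= M%:E)%E. Proof. by rewrite lee_fin. Qed.

Lemma measurable_drift : measurable_fun setT (fun p : R * (nat * R) => drift p.1 p.2).
Proof.
have mup : measurable_fun setT (fun p : R * (nat * R) => phi p.1 (up p.2)).
  apply: (measurableT_comp mphi (g := fun p : R * (nat * R) => (p.1, up p.2))).
  apply: measurable_fun_pair => //; apply: measurableT_comp => //; exact: measurable_up.
have mdown : measurable_fun setT (fun p : R * (nat * R) => phi p.1 (down p.2)).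
  apply: (measurableT_comp mphi (g := fun p : R * (nat * R) => (p.1, down p.2))).
  apply: measurable_fun_pair => //; apply: measurableT_comp => //; exact: measurable_down.
have ml : measurable_fun setT (fun p : R * (nat * R) => lam p.2) by exact: measurableT_comp.
have mh : measurable_fun setT (fun p : R * (nat * R) => h p.2) by exact: measurableT_comp.
by apply: measurable_funD; [apply: measurable_funD => //|]; apply: measurable_funM => //; apply: measurable_funB.
Qed.

Let diff_le t y y' : `|phi t y - phi t y'| <= M.
Proof.
by have := (phi_ge0 t y, phi_le t y, phi_ge0 t y', phi_le t y') => -[[[]]] *; rewrite ler_norml; apply/andP; split; lra.
Qed.

Lemma drift_le t y : `|drift t y| <= K + 2 * C * M.
Proof.
have H (g : R) y' : 0 <= g -> g <= C -> `|g * (phi t y' - phi t y)| <= C * M.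
  by move=> g0 gC; rewrite normrM ger0_norm// ler_pM.
rewrite /drift; apply: le_trans (ler_normD _ _) _.
have -> : K + 2 * C * M = (K + C * M) + C * M by ring.
apply: lerD; last exact: H.
by apply: le_trans (ler_normD _ _) _; apply: lerD => //; exact: H.
Qed.

Lemma flow_increment t y z : 0 <= t -> statespace y -> 0 <= z ->
  `|phi (t + z) (shift y z) - phi t y| <= K * z.
Proof.
move=> t0 sy z0; rewrite phi_flow//.
have := @le_normr_segment _ (fun r => psi (t + r) (shift y r)) K 0 z z0; rewrite subr0; apply => //.
apply: (measurableT_comp mpsi (g := fun r => (t + r, shift y r))).
apply: measurable_fun_pair; first by apply: measurable_funD.
exact: (measurable_fun_pair2 y measurable_shift).
Qed.

(** On a time interval of length [s] at most one jump matters. In the renewal equation, what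
    follows that jump may be replaced by the flow and [no_jump] by 1: each replacement changes an
    integrand over [0, s] by [O(s)]. *)
Lemma dynkin_local t y s : 0 <= t -> statespace y -> 0 <= s ->
  `|fine (transition lam h (EFin \o phi (t + s)) (s, y)) - phi t y -
    \int[mu]_(z in `[0, s]) drift (t + z) (shift y z)| <= 4 * C * (4 * C * M + K) * s ^+ 2.
Proof.
move=> t0 sy s0.
pose f := EFin \o phi (t + s).
have mf : measurable_fun setT f by exact: mphitE.
have f0 y' : (0 <= f y')%E by exact: phiE0.
have fM y' : (f y' <= M%:E)%E by exact: phiEM.
pose S z := no_jump lam h y z.
have S0 z : 0 <= S z by exact: no_jump_ge0.
have S1 z : S z <= 1 by exact: (no_jump_le1 Il Ih).
have SC z : 0 <= z -> 1 - 2 * C * z <= S z by exact: (no_jump_ge Il Ih).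
pose q y' := lam y' + h y'.
have Iq : bounded_intensity (C + C) q by exact: bounded_intensityD.
have q0 y' : 0 <= q y' by exact: intensity_ge0 Iq y'.
have qC y' : q y' <= C + C by exact: intensity_le Iq y'.
pose v y' r := fine (transition lam h f (r, y')).
have v_fin r y' : 0 <= r -> transition lam h f (r, y') \is a fin_num.
  by move=> r0; apply: (transition_fin Il Ih mf f0 fM).
have v0 r y' : 0 <= v y' r by rewrite fine_ge0// (transition_ge0 Il Ih mf f0).
have vM r y' : 0 <= r -> v y' r <= M.
  move=> r0; rewrite -lee_fin fineK ?v_fin//.
  by apply: (transition_le Il Ih mf f0 fM).
pose JS z := fine (jump_op lam h (fun y' => transition lam h f ((s - z)%R, y')) (shift y z) * (S z)%:E)%E.
have JSE z : z <= s -> (jump_op lam h (fun y' => transition lam h f ((s - z)%R, y')) (shift y z) * (S z)%:E)%E =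
    ((lam (shift y z) * v (up (shift y z)) (s - z) + h (shift y z) * v (down (shift y z)) (s - z)) * S z)%R%:E.
  move=> zs; rewrite /jump_op -(fineK (v_fin (s - z) (up (shift y z)) _)) ?subr_ge0//.
  by rewrite -(fineK (v_fin (s - z) (down (shift y z)) _)) ?subr_ge0.
have JSv z : z <= s -> JS z =
    (lam (shift y z) * v (up (shift y z)) (s - z) + h (shift y z) * v (down (shift y z)) (s - z)) * S z.
  by move=> zs; rewrite /JS JSE.
have mJS : measurable_fun setT JS.
  apply: measurableT_comp => //.
  have mt := measurable_transition Il Ih mf f0.
  exact: (measurable_fun_pair2 (s, y) (measurable_renewal_integrand Il Ih mt)).
have JSM z : 0 <= z <= s -> `|JS z| <= 2 * C * M.
  move=> /andP[z0 zs]; rewrite JSv// normrM (ger0_norm (S0 z)).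
  rewrite ger0_norm; last by rewrite addr_ge0// mulr_ge0.
  rewrite -[leRHS]mulr1 ler_pM//; first by rewrite addr_ge0// mulr_ge0.
  have -> : 2 * C * M = C * M + C * M by ring.
  by apply: lerD; apply: ler_pM => //; apply: vM; rewrite subr_ge0.
have tr : v y s = phi (t + s) (shift y s) * S s + \int[mu]_(z in `[0, s]) JS z.
  rewrite /v (transition_renewal Il Ih mf f0) /renewal /=.
  have -> : (\int[mu]_(z in `[0%R, s]) (jump_op lam h (fun y' => transition lam h f ((s - z)%R, y')) (shift y z) *
      (no_jump lam h y z)%:E))%E = (\int[mu]_(z in `[0%R, s]) (JS z)%:E)%E.
    apply: eq_integral => z; rewrite inE/= in_itv/= => /andP[_ zs].
    by rewrite [LHS]JSE// JSv.
  rewrite fineD//= ; last by apply: integrable_fin_num => //; exact: bounded_integrable_segment mJS JSM.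
pose W z := wait_density q y z.
have mW : measurable_fun setT W by exact: (measurable_fun_pair2 y (measurable_wait_density Iq)).
have WE z : W z = q (shift y z) * S z.
  by rewrite /W wait_densityE /S (no_jumpE Il Ih).
have W2 z : `|W z| <= 2 * C.
  rewrite WE normrM !ger0_norm// -[leRHS]mulr1 ler_pM//.
  by apply: le_trans (qC _) _; lra.
have intW : \int[mu]_(z in `[0, s]) W z = 1 - S s.
  by rewrite (Rintegral_wait_density Iq)// /S (no_jumpE Il Ih).
pose Psi z := psi (t + z) (shift y z).
pose L z := drift (t + z) (shift y z).
have mline : measurable_fun setT (fun z => (t + z, shift y z)).
  apply: measurable_fun_pair; first by apply: measurable_funD.
  exact: (measurable_fun_pair2 y measurable_shift).
have mPsi : measurable_fun setT Psi by exact: (measurableT_comp mpsi mline).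
have mL : measurable_fun setT L by exact: (measurableT_comp measurable_drift mline).
have iJS := bounded_integrable_segment mJS JSM.
have iW : mu.-integrable `[0, s] (EFin \o W).
  by apply: (bounded_integrable_segment (M := 2 * C) mW) => z _.
have iPsi : mu.-integrable `[0, s] (EFin \o Psi).
  by apply: (bounded_integrable_segment (M := K) mPsi) => z _; exact: psi_le.
have iL : mu.-integrable `[0, s] (EFin \o L).
  by apply: (bounded_integrable_segment (M := K + 2 * C * M) mL) => z _; exact: drift_le.
pose F z := phi (t + z) (shift y z).
have FF : F s - phi t y = \int[mu]_(z in `[0, s]) Psi z by exact: phi_flow.
pose T z := (Psi z + JS z) - (F s * W z + L z).
have iFW : mu.-integrable `[0, s] (EFin \o (fun z => F s * W z)).
  apply: (bounded_integrable_segment (M := M * (2 * C))); first exact: measurable_funM.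
  by move=> z _; rewrite normrM ler_pM// ger0_norm// /F.
have -> : v y s - phi t y - \int[mu]_(z in `[0, s]) L z = \int[mu]_(z in `[0, s]) T z.
  have iPJ : mu.-integrable `[0, s] (EFin \o (fun z => Psi z + JS z)).
    apply: (bounded_integrable_segment (M := K + 2 * C * M)); first exact: measurable_funD.
    by move=> z zs; apply: le_trans (ler_normD _ _) _; apply: lerD; [exact: psi_le|exact: JSM].
  have iFL : mu.-integrable `[0, s] (EFin \o (fun z => F s * W z + L z)).
    apply: (bounded_integrable_segment (M := M * (2 * C) + (K + 2 * C * M))).
      by apply: measurable_funD => //; exact: measurable_funM.
    move=> z zs; apply: le_trans (ler_normD _ _) _; apply: lerD; last exact: drift_le.
    by rewrite normrM ler_pM// ger0_norm// /F.
  rewrite (RintegralB _ iPJ iFL)// (RintegralD _ iPsi iJS)// (RintegralD _ iFW iL)//.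
  rewrite (RintegralZl _ _ iW)// intW -FF tr -/(F s).
  ring.
have mT : measurable_fun setT T.
  by apply: measurable_funB; apply: measurable_funD => //; apply: measurable_funM.
have -> : 4 * C * (4 * C * M + K) * s ^+ 2 = (4 * C * ((4 * C * M + K) * s)) * (s - 0) by ring.
apply: le_normr_segment => // z /andP[z0 zs].
have sz : statespace (shift y z) by exact: statespace_shift.
pose E := (4 * C * M + K) * s.
have E0 : 0 <= E by rewrite mulr_ge0// addr_ge0// !mulr_ge0.
have sz0 : 0 <= s - z by rewrite subr_ge0.
have near_one a b : 0 <= a -> a <= M -> `|a - b| <= (2 * C * M + K) * s -> `|a * S z - b| <= E.
  move=> a0 aM ab; have -> : a * S z - b = (a - b) - a * (1 - S z) by ring.
  apply: le_trans (ler_normB _ _) _.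
  have -> : E = (2 * C * M + K) * s + M * (2 * C * s) by rewrite /E; ring.
  apply: lerD => //; rewrite ger0_norm; last by rewrite mulr_ge0// subr_ge0.
  apply: ler_pM => //; first by rewrite subr_ge0.
  rewrite lerBlDr -lerBlDl; apply: le_trans (SC z z0).
  by rewrite lerD2l lerN2 ler_wpM2l// mulr_ge0.
have after_jump y' : statespace y' -> `|v y' (s - z) * S z - phi (t + z) y'| <= E.
  move=> sy'; apply: near_one => //; first exact: vM.
  apply: le_trans (ler_distD (phi (t + s) (shift y' (s - z))) _ _) _.
  have -> : (2 * C * M + K) * s = 2 * C * M * s + K * s by ring.
  apply: lerD.
    apply: le_trans (transition_short_time Il Ih mf f0 fM y' sz0) _.
    by rewrite ler_wpM2l ?mulr_ge0// gerBl.
  have := @flow_increment (t + z) y' (s - z) (addr_ge0 t0 z0) sy' sz0.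
  rewrite (_ : t + z + (s - z) = t + s); last by ring.
  by move=> /le_trans; apply; rewrite ler_wpM2l// gerBl.
have no_jump_yet : `|F s * S z - F z| <= E.
  apply: near_one; [exact: phi_ge0|exact: phi_le|].
  have := @flow_increment (t + z) (shift y z) (s - z) (addr_ge0 t0 z0) sz sz0.
  rewrite shift_shift (_ : t + z + (s - z) = t + s); last by ring.
  rewrite (_ : z + (s - z) = s); last by ring.
  rewrite -/(F s) -/(F z) => /le_trans; apply.
  by apply: ler_pM => //; [rewrite lerDr !mulr_ge0|rewrite gerBl].
have := after_jump _ (@statespace_up R _ sz); have := after_jump _ (@statespace_down R (shift y z)).
rewrite /T JSv// WE /L /drift -/(Psi z) -/(F z).
set a1 := v (up _) _; set a2 := v (down _) _; set b1 := phi _ (up _); set b2 := phi _ (down _).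
move=> h2 h1.
set l := lam _; set m := h _.
have -> : Psi z + (l * a1 + m * a2) * S z - (F s * (q (shift y z) * S z) +
    (Psi z + l * (b1 - F z) + m * (b2 - F z))) =
    l * (a1 * S z - b1) + m * (a2 * S z - b2) - (q (shift y z)) * (F s * S z - F z).
  by rewrite /q -/l -/m; ring.
apply: le_trans (ler_normB _ _) _; rewrite -/E.
have -> : 4 * C * E = (C * E + C * E) + (C + C) * E by ring.
apply: lerD; last by rewrite normrM ger0_norm// ler_pM.
apply: le_trans (ler_normD _ _) _; rewrite !normrM (ger0_norm (lam_ge0 _ : 0 <= l)) (ger0_norm (h_ge0 _ : 0 <= m)).
by apply: lerD; apply: ler_pM => //; [exact: lam_ge0|exact: lam_le|exact: h_ge0|exact: h_le].
Qed.

End dynkin_local.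

Section dynkin.
Context {R : realType}.
Notation mu := (@lebesgue_measure R).
Variables (lam h : nat * R -> R) (C : R).
Hypotheses (Il : bounded_intensity C lam) (Ih : bounded_intensity C h).
Let lam_meas := intensity_meas Il. Let h_meas := intensity_meas Ih.
Let lam_ge0 := intensity_ge0 Il. Let h_ge0 := intensity_ge0 Ih.
Let lam_le := intensity_le Il. Let h_le := intensity_le Ih.
Context {d : measure_display} {Omega : measurableType d}.
Variables (P : nat * R -> probability Omega R) (X : R -> Omega -> nat * R).
Hypothesis X_queue : queue_process lam h P X.
Variable x : nat * R.
Hypothesis sx : statespace x.

Let mX t : 0 <= t -> measurable_fun setT (X t).
Proof. by move=> t0; exact: (measurable_queue X_queue). Qed.

Let Xsp t w : 0 <= t -> statespace (X t w).
Proof. by move=> t0; exact: (queue_statespace X_queue). Qed.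

Let pos (s : R) : R := if 0 <= s then s else 0.

Let pos_ge0 s : 0 <= pos s. Proof. by rewrite /pos; case: ifP. Qed.

Let posE s : 0 <= s -> pos s = s. Proof. by rewrite /pos => ->. Qed.

Let mpos : measurable_fun setT pos.
Proof. by apply: measurable_fun_ifT => //; apply: measurable_fun_ler. Qed.

(** On pairs (time, outcome), the time is itself a random time at which the process is read. *)
Lemma measurable_queue_joint :
  measurable_fun setT (fun p : R * Omega => X (pos p.1) p.2).
Proof.
apply: (measurable_process_at_clock (X := fun s (p : R * Omega) => X s p.2) (c := fun p : R * Omega => pos p.1)).
- by move=> s s0; apply: measurableT_comp => //; exact: mX.
- by move=> p; exact: pos_ge0.
- exact: measurableT_comp.
- move=> p u cu uc; apply: (right_cvg_seq (g := fun s => X s p.2)) => //.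
  by case: X_queue => _ _ + _ _; apply.
Qed.

Section nonnegative.
Variables (phi psi : R -> nat * R -> R) (M K : R).
Hypothesis mphi : measurable_fun setT (fun p : R * (nat * R) => phi p.1 p.2).
Hypothesis mpsi : measurable_fun setT (fun p : R * (nat * R) => psi p.1 p.2).
Hypotheses (phi_ge0 : forall t y, 0 <= phi t y) (phi_le : forall t y, phi t y <= M).
Hypothesis psi_le : forall t y, `|psi t y| <= K.
Hypothesis phi_flow : forall t y z, 0 <= t -> statespace y -> 0 <= z ->
  phi (t + z) (shift y z) - phi t y = \int[mu]_(r in `[0, z]) psi (t + r) (shift y r).

Let L := drift lam h phi psi.
Let ML := K + 2 * C * M.

Let mL : measurable_fun setT (fun p : R * (nat * R) => L p.1 p.2).
Proof. exact: measurable_drift. Qed.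

Let L_le t y : `|L t y| <= ML. Proof. exact: drift_le. Qed.

Let mphit t : measurable_fun setT (phi t).
Proof. exact: (measurable_fun_pair2 t mphi). Qed.

Let mLt t : measurable_fun setT (L t).
Proof. exact: (measurable_fun_pair2 t mL). Qed.

Let phi_norm t y : `|phi t y| <= M. Proof. by rewrite ger0_norm. Qed.

Let C0 : 0 <= C. Proof. exact: le_trans (lam_ge0 (0%N, 0)) (lam_le _). Qed.
Let ML0 : 0 <= ML. Proof. exact: le_trans (normr_ge0 _) (L_le 0 x). Qed.

Lemma expectation_markov (f : nat * R -> R) (B t s : R) : measurable_fun setT f ->
  (forall y, 0 <= f y) -> (forall y, f y <= B) -> 0 <= t -> 0 <= s ->
  \int[P x]_w f (X (t + s) w) = \int[P x]_w fine (transition lam h (EFin \o f) (s, X t w)).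
Proof.
move=> mf f0 fB t0 s0.
have mfE : measurable_fun setT (EFin \o f) by exact/measurable_EFinP.
have fE0 y : (0 <= (EFin \o f) y)%E by rewrite lee_fin.
have fEB y : ((EFin \o f) y <= B%:E)%E by rewrite lee_fin.
rewrite /Rintegral; congr fine.
rewrite (queue_markov Il Ih X_queue sx mfE fE0 t0 s0
  (@measurableT _ (observedType X `[0, t]))).
apply: eq_integral => w _; rewrite fineK//.
exact: (transition_fin Il Ih mfE fE0 fEB).
Qed.

Lemma measurable_fine_transition (f : nat * R -> R) (s t : R) : measurable_fun setT f ->
  (forall y, 0 <= f y) -> 0 <= t ->
  measurable_fun setT (fun w => fine (transition lam h (EFin \o f) (s, X t w))).
Proof.
move=> mf f0 t0; apply: measurableT_comp => //.
have mfE : measurable_fun setT (EFin \o f) by exact/measurable_EFinP.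
have fE0 y : (0 <= (EFin \o f) y)%E by rewrite lee_fin.
apply: (measurableT_comp (measurable_transition Il Ih mfE fE0)).
by apply: measurable_fun_pair => //; exact: mX.
Qed.

Let l (s : R) := \int[P x]_w L s (X (pos s) w).

Let mG : measurable_fun setT (fun p : R * Omega => L p.1 (X (pos p.1) p.2)).
Proof.
apply: (measurableT_comp mL (g := fun p : R * Omega => (p.1, X (pos p.1) p.2))).
by apply: measurable_fun_pair => //; exact: measurable_queue_joint.
Qed.

Let ml : measurable_fun setT l.
Proof. by apply: (@measurable_expectation _ _ _ (P x) (fun p => L p.1 (X (pos p.1) p.2)) ML) => // p. Qed.

Let l_le s : `|l s| <= ML.
Proof. by apply: le_normr_prob => //; exact: (measurable_fun_pair2 s mG). Qed.

(** In the mean drift, the process may be replaced by the flow from its state at [t]. *)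
Let drift_short_time (t z : R) : 0 <= t -> 0 <= z ->
  `|\int[P x]_w L (t + z) (shift (X t w) z) - l (t + z)| <= 2 * C * (ML + ML) * z.
Proof.
move=> t0 z0; have tz0 : 0 <= t + z by exact: addr_ge0.
pose f y := L (t + z) y + ML.
have f0 y : 0 <= f y by have := L_le (t + z) y; rewrite ler_norml => /andP[+ _]; rewrite /f; lra.
have fB y : f y <= ML + ML by rewrite lerD2r; exact: le_trans (ler_norm _) (L_le _ _).
have mf : measurable_fun setT f by apply: measurable_funD.
have mfE : measurable_fun setT (EFin \o f) by exact/measurable_EFinP.
have fE0 y : (0 <= (EFin \o f) y)%E by rewrite lee_fin.
have fEB y : ((EFin \o f) y <= (ML + ML)%:E)%E by rewrite lee_fin.
have mXz : measurable_fun setT (fun w => shift (X t w) z).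
  by apply: (measurableT_comp measurable_shift (g := fun w => (X t w, z))); apply: measurable_fun_pair => //; exact: mX.
have mLXz : measurable_fun setT (fun w => L (t + z) (shift (X t w) z)) by exact: measurableT_comp.
have mLX : measurable_fun setT (fun w => L (t + z) (X (t + z) w)).
  by apply: measurableT_comp => //; exact: mX.
pose g w := fine (transition lam h (EFin \o f) (z, X t w)).
have mg : measurable_fun setT g by exact: measurable_fine_transition.
have gB w : `|g w| <= ML + ML.
  have g0 : 0 <= g w by rewrite fine_ge0//; exact: transition_ge0.
  rewrite ger0_norm// -lee_fin fineK.
    by apply: (transition_le Il Ih mfE fE0 fEB).
  exact: (transition_fin Il Ih mfE fE0 fEB).
have lE : l (t + z) = \int[P x]_w g w - ML.
  rewrite -(expectation_markov mf f0 fB t0 z0) /f /l posE// RintegralD//.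
  - by rewrite Rintegral_prob_cst addrK.
  - by apply: (bounded_integrable_prob (P x) (M := ML)) => // w.
  - by apply: (@bounded_integrable_prob _ _ _ _ (cst ML) `|ML|).
have i1 : (P x).-integrable setT (EFin \o (fun w => f (shift (X t w) z))).
  by apply: (bounded_integrable_prob (P x) (M := ML + ML)) => [|w]; [exact: measurableT_comp|rewrite ger0_norm].
have i2 : (P x).-integrable setT (EFin \o g) by exact: bounded_integrable_prob mg gB.
have -> : \int[P x]_w L (t + z) (shift (X t w) z) = \int[P x]_w f (shift (X t w) z) - ML.
  rewrite /f RintegralD//.
  - by rewrite Rintegral_prob_cst addrK.
  - by apply: (bounded_integrable_prob (P x) (M := ML)) => // w.
  - by apply: (@bounded_integrable_prob _ _ _ _ (cst ML) `|ML|).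
rewrite lE (_ : forall a b c : R, a - c - (b - c) = a - b); last by move=> *; ring.
rewrite -(RintegralB _ i1 i2)//; apply: le_normr_prob.
  by apply: measurable_funB => //; exact: measurableT_comp.
move=> w; rewrite distrC.
exact: (transition_short_time Il Ih mfE fE0 fEB).
Qed.

Let a (t : R) := \int[P x]_w phi t (X t w).

(** [dynkin_local] is averaged over the state at [t]. *)
Let increment (t s : R) : 0 <= t -> 0 <= s ->
  `|a (t + s) - a t - \int[mu]_(z in `[0, s]) l (t + z)| <=
  (4 * C * (4 * C * M + K) + 2 * C * (ML + ML)) * s ^+ 2.
Proof.
move=> t0 s0; have ts0 : 0 <= t + s by exact: addr_ge0.
pose H w := fine (transition lam h (EFin \o phi (t + s)) (s, X t w)).
pose I w := \int[mu]_(z in `[0, s]) L (t + z) (shift (X t w) z).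
pose GG (p : R * Omega) := L (t + p.1) (shift (X t p.2) p.1).
have mGG : measurable_fun setT GG.
  apply: (measurableT_comp mL (g := fun p : R * Omega => (t + p.1, shift (X t p.2) p.1))).
  apply: measurable_fun_pair; first by apply: measurable_funD.
  apply: (measurableT_comp measurable_shift (g := fun p : R * Omega => (X t p.2, p.1))).
  by apply: measurable_fun_pair => //; apply: measurableT_comp => //; exact: mX.
have GGM p : `|GG p| <= ML by exact: L_le.
have mI : measurable_fun setT I by exact: (measurable_segment_integral mGG GGM).
have IM w : `|I w| <= ML * s.
  rewrite -[s in leRHS]subr0; apply: le_normr_segment => //.
  exact: (measurable_fun_pair1 w mGG).
have EI : \int[P x]_w I w = \int[mu]_(z in `[0, s]) \int[P x]_w GG (z, w).
  exact: (Rintegral_exchange (P x) mGG GGM).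
have mH : measurable_fun setT H by exact: measurable_fine_transition.
have mfE : measurable_fun setT (EFin \o phi (t + s)) by exact/measurable_EFinP.
have fE0 y : (0 <= (EFin \o phi (t + s)) y)%E by rewrite lee_fin.
have fEB y : ((EFin \o phi (t + s)) y <= M%:E)%E by rewrite lee_fin.
have HM w : `|H w| <= M.
  have g0 : 0 <= H w by rewrite fine_ge0//; exact: transition_ge0.
  rewrite ger0_norm// -lee_fin fineK.
    by apply: (transition_le Il Ih mfE fE0 fEB).
  exact: (transition_fin Il Ih mfE fE0 fEB).
have aE : a (t + s) = \int[P x]_w H w.
  exact: (expectation_markov (mphit _) (phi_ge0 _) (phi_le _) t0 s0).
have mphX : measurable_fun setT (fun w => phi t (X t w)).
  by apply: measurableT_comp => //; exact: mX.
have -> : a (t + s) - a t - \int[mu]_(z in `[0, s]) l (t + z) =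
    \int[P x]_w (H w - phi t (X t w) - I w) +
    \int[mu]_(z in `[0, s]) (\int[P x]_w GG (z, w) - l (t + z)).
  have i1 := bounded_integrable_prob (P x) mH HM.
  have i2 := bounded_integrable_prob (P x) mphX (fun w => phi_norm t _).
  have i3 := bounded_integrable_prob (P x) mI IM.
  have i12 : (P x).-integrable setT (EFin \o (fun w => H w - phi t (X t w))).
    apply: (bounded_integrable_prob (P x) (M := M + M)); first exact: measurable_funB.
    by move=> w; apply: le_trans (ler_normB _ _) _; apply: lerD.
  have i4 : mu.-integrable `[0, s] (EFin \o (fun z => \int[P x]_w GG (z, w))).
    apply: (bounded_integrable_segment (M := ML)); first exact: measurable_expectation GGM.
    by move=> z _; apply: le_normr_prob => //; exact: (measurable_fun_pair2 z mGG).
  have i5 : mu.-integrable `[0, s] (EFin \o (fun z => l (t + z))).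
    apply: (bounded_integrable_segment (M := ML)); last by move=> z _.
    by apply: (measurableT_comp ml); apply: measurable_funD.
  rewrite (RintegralB _ i12 i3)// (RintegralB _ i1 i2)// (RintegralB _ i4 i5)// -aE EI.
  by rewrite addrA subrK.
apply: le_trans (ler_normD _ _) _; rewrite mulrDl; apply: lerD.
  apply: le_normr_prob; first by apply: measurable_funB => //; exact: measurable_funB.
  move=> w; apply: (dynkin_local Il Ih mphi mpsi) => //.
  exact: Xsp.
have -> : 2 * C * (ML + ML) * s ^+ 2 = (2 * C * (ML + ML) * s) * (s - 0) by ring.
apply: le_normr_segment => //.
  apply: measurable_funB; first exact: measurable_expectation GGM.
  by apply: (measurableT_comp ml); apply: measurable_funD.
move=> z /andP[z0 zs]; apply: le_trans (drift_short_time t0 z0) _.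
by rewrite ler_wpM2l// !mulr_ge0// addr_ge0.
Qed.

Lemma dynkin_nonnegative (T : R) : 0 <= T ->
  \int[P x]_w phi T (X T w) - phi 0 x =
  \int[P x]_w \int[mu]_(s in `[0, T]) L s (X s w).
Proof.
move=> T0.
pose D (t : R) := a t - \int[mu]_(s in `[0, t]) l s.
have := @quadratic_increments_const R D (4 * C * (4 * C * M + K) + 2 * C * (ML + ML)) T T0.
have HD (b c : R) : 0 <= b -> b <= c -> c <= T ->
    `|D c - D b| <= (4 * C * (4 * C * M + K) + 2 * C * (ML + ML)) * (c - b) ^+ 2.
  move=> b0 bc cT.
  have sub_sub (u v A B : R) : u - (A + B) - (v - A) = u - v - B by ring.
  have -> : D c - D b = a (b + (c - b)) - a b - \int[mu]_(z in `[0, c - b]) l (b + z).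
    have bcb : b + (c - b) = c by ring.
    rewrite bcb /D (Rintegral_segmentD b0 bc ml (fun s _ => l_le s)) sub_sub.
    by rewrite -(@Rintegral_translate _ l b 0 (c - b) ml) addr0 bcb.
  by apply: increment => //; rewrite subr_ge0.
move=> /(_ HD); rewrite /D set_itv1 Rintegral_set1 subr0.
have -> : a 0 = phi 0 x.
  rewrite /a /Rintegral.
  have mfE : measurable_fun setT (EFin \o phi 0) by exact/measurable_EFinP.
  have fE0 y : (0 <= (EFin \o phi 0) y)%E by rewrite lee_fin.
  rewrite (queue_transition Il Ih X_queue sx mfE fE0 (lexx 0)).
  by rewrite (transition0 Il Ih mfE fE0).
move=> aT; rewrite -aT /a opprB addrC subrK.
transitivity (\int[P x]_w \int[mu]_(s in `[0, T]) L s (X (pos s) w)).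
  exact/esym/(Rintegral_exchange (P x) mG (fun p => L_le _ _)).
apply: eq_Rintegral => w _; apply: eq_Rintegral => s; rewrite inE/= in_itv/= => /andP[s0 _].
by rewrite posE.
Qed.

End nonnegative.

(** Adding a constant to [phi] makes it nonnegative and leaves its drift unchanged. *)
Theorem dynkin (phi psi : R -> nat * R -> R) (M K : R) :
  measurable_fun setT (fun p : R * (nat * R) => phi p.1 p.2) ->
  measurable_fun setT (fun p : R * (nat * R) => psi p.1 p.2) ->
  (forall t y, `|phi t y| <= M) -> (forall t y, `|psi t y| <= K) ->
  (forall t y z, 0 <= t -> statespace y -> 0 <= z ->
    phi (t + z) (shift y z) - phi t y = \int[mu]_(r in `[0, z]) psi (t + r) (shift y r)) ->
  forall T, 0 <= T -> \int[P x]_w phi T (X T w) - phi 0 x =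
    \int[P x]_w \int[mu]_(s in `[0, T]) drift lam h phi psi s (X s w).
Proof.
move=> mphi mpsi phiM psiK flow T T0.
pose phi' t y := phi t y + M.
have phi'0 t y : 0 <= phi' t y.
  by have := phiM t y; rewrite ler_norml => /andP[+ _]; rewrite /phi'; lra.
have phi'M t y : phi' t y <= M + M by rewrite lerD2r; exact: le_trans (ler_norm _) (phiM _ _).
have mphi' : measurable_fun setT (fun p : R * (nat * R) => phi' p.1 p.2) by apply: measurable_funD.
have flow' t y z : 0 <= t -> statespace y -> 0 <= z ->
    phi' (t + z) (shift y z) - phi' t y = \int[mu]_(r in `[0, z]) psi (t + r) (shift y r).
  by move=> t0 sy z0; rewrite -flow// /phi'; ring.
have dE : drift lam h phi' psi = drift lam h phi psi.
  by apply/funext => t; apply/funext => y; rewrite /drift /phi'; ring.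
have := dynkin_nonnegative mphi' mpsi phi'0 phi'M psiK flow' T0.
rewrite dE => <-; rewrite /phi' RintegralD//.
- by rewrite Rintegral_prob_cst; ring.
- apply: (bounded_integrable_prob (P x) (M := M)) => // .
  by apply: (measurableT_comp (measurable_fun_pair2 T mphi)); exact: mX.
- by apply: (@bounded_integrable_prob _ _ _ _ (cst M) `|M|).
Qed.

Corollary dynkin_expectation (phi psi : R -> nat * R -> R) (M K : R) :
  measurable_fun setT (fun p : R * (nat * R) => phi p.1 p.2) ->
  measurable_fun setT (fun p : R * (nat * R) => psi p.1 p.2) ->
  (forall t y, `|phi t y| <= M) -> (forall t y, `|psi t y| <= K) ->
  (forall t y z, 0 <= t -> statespace y -> 0 <= z ->
    phi (t + z) (shift y z) - phi t y = \int[mu]_(r in `[0, z]) psi (t + r) (shift y r)) ->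
  forall T, 0 <= T -> (\int[P x]_w (phi T (X T w))%:E - (phi 0 x)%:E =
    \int[P x]_w (\int[mu]_(s in `[0, T]) drift lam h phi psi s (X s w))%R%:E)%E.
Proof.
move=> mphi mpsi phiM psiK flow T T0.
have md := measurable_drift Il Ih mphi mpsi.
pose G (p : R * Omega) := drift lam h phi psi p.1 (X (pos p.1) p.2).
have mG : measurable_fun setT G.
  apply: (measurableT_comp md (g := fun p : R * Omega => (p.1, X (pos p.1) p.2))).
  by apply: measurable_fun_pair => //; exact: measurable_queue_joint.
have jumpM g t y y' : 0 <= g -> g <= C -> `|g * (phi t y - phi t y')| <= C * (M + M).
  move=> g0 gC; rewrite normrM (ger0_norm g0); apply: ler_pM => //.
  by apply: le_trans (ler_normB _ _) _; apply: lerD.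
have GM p : `|G p| <= K + C * (M + M) + C * (M + M).
  apply: le_trans (ler_normD _ _) _; apply: lerD; last exact: jumpM.
  by apply: le_trans (ler_normD _ _) _; apply: lerD => //; exact: jumpM.
have GE w : \int[mu]_(s in `[0, T]) drift lam h phi psi s (X s w) = \int[mu]_(s in `[0, T]) G (s, w).
  apply: eq_Rintegral => s; rewrite inE/= in_itv/= => /andP[s0 _].
  by rewrite /G posE.
have mphX : measurable_fun setT (fun w => phi T (X T w)).
  by apply: (measurableT_comp (measurable_fun_pair2 T mphi)); exact: mX.
rewrite (EFin_Rintegral_prob (P x) mphX (fun w => phiM T _)) -EFinB.
rewrite (dynkin mphi mpsi phiM psiK flow T0).
under [in RHS]eq_integral do rewrite GE; under [in LHS]eq_Rintegral do rewrite GE.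
rewrite (EFin_Rintegral_prob (P x) (measurable_segment_integral mG GM 0 T)
  (M := (K + C * (M + M) + C * (M + M)) * (T - 0)))// => w.
apply: le_normr_segment => //; exact: (measurable_fun_pair1 w mG).
Qed.

End dynkin.

(** * Calculus on the half-line *)

Section half_line.
Context {R : realType}.
Notation mu := (@lebesgue_measure R).
Implicit Types (g : R -> R) (x l : R).

Lemma half_nearP x (A : set R) : within `[0, +oo[ x^' A <->
  exists2 e, 0 < e & forall u, 0 <= u -> u != x -> `|u - x| < e -> A u.
Proof.
split.
  move=> [e /= e0 He]; exists e => // u u0 ux ue; apply: He => //=.
    by rewrite /ball_/= distrC.
  by rewrite in_itv/= andbT.
move=> [e e0 He]; exists e => //= u /=; rewrite /ball_/= => ue ux; rewrite in_itv/= andbT => u0.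
by apply: He => //; rewrite distrC.
Qed.

Lemma half_proper x : 0 <= x -> ProperFilter (within `[0, +oo[ x^').
Proof.
move=> x0; split; last exact: within_filter.
move=> /half_nearP[e e0]; apply.
- exact: (addr_ge0 x0 (ltW (divr_gt0 e0 (ltr0Sn R 1)))).
- by rewrite -subr_eq0 addrAC subrr add0r lt0r_neq0// divr_gt0.
- rewrite addrAC subrr add0r gtr0_norm ?divr_gt0//.
  by rewrite ltr_pdivrMr// ltr_pMr// ltr1n.
Qed.

Lemma half_deriveE g x l : 0 <= x -> half_quotient g x --> l -> half_derive g x = l.
Proof. by move=> x0 gl; have PF := half_proper x0; apply: cvg_lim gl. Qed.

Lemma half_quotient_is_derive g x l : 0 < x -> half_quotient g x --> l -> is_derive x 1 g l.
Proof.
move=> x0 gl.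
have H : h^-1 *: ((g \o pseudometric_normed_Zmodule.shift x) (h *: 1) - g x) @[h --> 0^'] --> l.
  move=> A /gl /half_nearP[e e0 He].
  exists (Num.min e x) => /=; first by rewrite lt_min e0 x0.
  move=> h /=; rewrite sub0r normrN lt_min => /andP[he hx] h0.
  have hx0 : 0 <= h + x.
    by have := ler_norm (- h); rewrite normrN => /le_lt_trans /(_ hx); lra.
  have hxx : h + x != x by rewrite -subr_eq0 addrK.
  have := He (h + x) hx0 hxx; rewrite addrK => /(_ he) /=; rewrite addrK.
  have -> : h%:A = h :> R by exact: mulr1.
  by have -> : h^-1 *: (g (h + x) - g x) = (g (h + x) - g x) / h by exact: mulrC.
by split; [apply/cvg_ex; exists l|exact: cvg_lim H].
Qed.

Lemma half_quotient_lipschitz g x l : half_quotient g x --> l ->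
  exists2 e, 0 < e & forall u, 0 <= u -> `|u - x| < e -> `|g u - g x| <= (`|l| + 1) * `|u - x|.
Proof.
move=> /cvgrPdist_lt /(_ 1 ltr01) /half_nearP[e e0 He]; exists e => // u u0 ue.
have [->|ux] := eqVneq u x; first by rewrite !subrr normr0 mulr0.
have ux' : u - x != 0 by rewrite subr_eq0.
have := He u u0 ux ue => /= H.
have -> : g u - g x = ((g u - g x) / (u - x)) * (u - x) by rewrite divfK.
rewrite normrM ler_wpM2r//.
have -> : (g u - g x) / (u - x) = l - (l - (g u - g x) / (u - x)) by rewrite subKr.
by apply: le_trans (ler_normB _ _) _; rewrite lerD2l ltW.
Qed.

Lemma half_quotient_cvg {S : Type} g (x l : R) (F : set_system S) {FF : Filter F} (u : S -> R) : half_quotient g x --> l ->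
  u @ F --> x -> (\forall r \near F, 0 <= u r) -> g (u r) @[r --> F] --> g x.
Proof.
move=> /half_quotient_lipschitz[e e0 He] ux u0.
apply/cvgrPdist_lt => e' e'0.
pose k := `|l| + 1; have k0 : 0 < k by rewrite ltr_wpDl.
have m0 : 0 < Num.min e (e' / k) by rewrite lt_min e0 divr_gt0.
move/cvgrPdist_lt : ux => /(_ _ m0); apply: filterS2 u0 => r u0.
rewrite distrC lt_min => /andP[h1 h2]; rewrite distrC.
apply: le_lt_trans (He _ u0 h1) _.
by rewrite mulrC -ltr_pdivlMr.
Qed.

Section mean_value.
Variables (g dg : R -> R).
Hypothesis g_half : forall x, 0 <= x -> half_quotient g x --> dg x.

Let g_derive x : 0 < x -> is_derive x 1 g (dg x).
Proof. by move=> x0; apply: half_quotient_is_derive => //; apply: g_half; exact: ltW. Qed.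

Lemma half_within_continuous a b : 0 <= a -> {within `[a, b], continuous g}.
Proof.
move=> a0; apply/subspace_continuousP => x /=; rewrite in_itv/= => /andP[ax xb].
have x0 : 0 <= x by exact: le_trans ax.
apply: (half_quotient_cvg (g_half x0)); first exact: cvg_within.
apply: filterS (@withinT _ _ _ _) => u /=; rewrite in_itv/= => /andP[au _].
exact: le_trans au.
Qed.

Lemma half_MVT a b : 0 <= a -> 0 <= b ->
  exists c, [/\ 0 <= c, `|c - a| <= `|b - a| & g b - g a = dg c * (b - a)].
Proof.
move=> a0 b0; have [ab|ba|<-] := ltgtP a b.
- have H x : x \in `]a, b[ -> is_derive x 1 g (dg x).
    by rewrite in_itv/= => /andP[ax _]; apply: g_derive; exact: le_lt_trans ax.
  have [c] := MVT ab H (@half_within_continuous a b a0).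
  rewrite in_itv/= => /andP[ac cb] E; exists c; split => //.
    exact: le_trans (ltW ac).
  by rewrite !gtr0_norm ?subr_gt0// lerD2r ltW.
- have H x : x \in `]b, a[ -> is_derive x 1 g (dg x).
    by rewrite in_itv/= => /andP[bx _]; apply: g_derive; exact: le_lt_trans bx.
  have [c] := MVT ba H (@half_within_continuous b a b0).
  rewrite in_itv/= => /andP[bc ca] E; exists c; split => //.
  + exact: le_trans (ltW bc).
  + by rewrite !ltr0_norm ?subr_lt0// lerN2 lerD2r ltW.
  + by rewrite -opprB E -mulrN opprB.
- by exists a; rewrite !subrr mulr0.
Qed.

Lemma half_FTC T : 0 <= T -> {within `[0, T], continuous dg} ->
  g T - g 0 = \int[mu]_(r in `[0, T]) dg r.
Proof.
rewrite le_eqVlt => /orP[/eqP <-|T0] cdg; first by rewrite set_itv1 Rintegral_set1 subrr.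
rewrite /Rintegral (@continuous_FTC2 _ dg g)//.
- split.
  + by move=> x; rewrite in_itv/= => /andP[x0 _]; have [] := g_derive x0.
  + have /(continuous_within_itvP _ T0)[_ + _] := @half_within_continuous 0 T (lexx 0).
    by [].
  + have /(continuous_within_itvP _ T0)[_ _ +] := @half_within_continuous 0 T (lexx 0).
    by [].
- move=> x; rewrite in_itv/= => /andP[x0 _].
  by rewrite derive1E; have [_ ->] := g_derive x0.
Qed.

End mean_value.

End half_line.

(** * Smooth functions of the time and the state *)

Section smooth.
Context {R : realType}.
Notation mu := (@lebesgue_measure R).

Lemma within_cvg_comp {T U : topologicalType} {S : Type} (D : set T) (f : T -> U) (p : T)
  (F : set_system S) {FF : Filter F} (u : S -> T) :
  {within D, continuous f} -> D p -> u @ F --> p -> (\forall i \near F, D (u i)) ->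
  f (u i) @[i --> F] --> f p.
Proof.
move=> /subspace_continuousP cf Dp up Du A /(cf _ Dp) /= nA.
have := up _ nA; apply: filterS2 Du => i Dui /=; exact.
Qed.

Lemma cvg_shift (F : set_system R) {FF : Filter F} (u : R -> R) (y : nat * R) (r : R) :
  u @ F --> r -> shift y (u i) @[i --> F] --> shift y r.
Proof.
move=> ur; rewrite /shift; case: ifP => _; first exact: cvg_cst.
apply: (@cvg_pair _ _ _ F (nbhs y.1) (nbhs (y.2 + r))); first exact: cvg_cst.
by apply: cvgD => //; exact: cvg_cst.
Qed.

Section time_state.
Variable phi : R -> nat * R -> R.
Hypothesis phi_smooth : C1b_time phi.

Let dt t y := derive_t phi t y.
Let dx t y := derive_x (phi t) y.
Let psi t y := dt t y + dx t y.

Let cdt : {within time_statespace, continuous (fun p => dt p.1 p.2)}.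
Proof. by case: phi_smooth => _ _ []. Qed.

Let cdx : {within time_statespace, continuous (fun p => dx p.1 p.2)}.
Proof. by case: phi_smooth => _ _ []. Qed.

Let phi_t t y : 0 <= t -> statespace y -> half_quotient (fun s => phi s y) t --> dt t y.
Proof. by case: phi_smooth => _ + _ _ t0 sy => /(_ t y t0 sy)[]. Qed.

Let phi_x t n x : 0 <= t -> 0 <= x -> n <> 0%N ->
  half_quotient (fun z => phi t (n, z)) x --> dx t (n, x).
Proof.
move=> t0 x0 n0; have sy : statespace (n, x) by split.
case: phi_smooth => _ /(_ t (n, x) t0 sy)[_ /(_ n0)] + _ _.
by rewrite /dx /derive_x /=; move: n0 => /eqP/negbTE ->.
Qed.

(** Along the flow, the increment of [phi] is an increment in time plus an increment in age. The
    mean value theorem writes both as derivatives at neighbouring points, and these converge. *)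
Lemma flow_half_quotient t y r : 0 <= t -> statespace y -> 0 <= r ->
  half_quotient (fun r => phi (t + r) (shift y r)) r --> psi (t + r) (shift y r).
Proof.
move=> t0 sy r0.
have tr0 : 0 <= t + r by exact: addr_ge0.
have sr := statespace_shift sy r0.
have FF : Filter (within `[0, +oo[ r^') by exact: within_filter.
have idr : r' @[r' --> within `[0, +oo[ r^'] --> r.
  by apply: cvg_trans (cvg_within _) _; apply: cvg_within.
have nr0 : \forall r' \near within `[0, +oo[ r^', 0 <= r'.
  by apply/half_nearP; exists 1 => // u.
have nrr : \forall r' \near within `[0, +oo[ r^', r' != r.
  by apply/half_nearP; exists 1 => // u.
have near_pt (c : R -> R) (b : R) : (forall r', 0 <= r' -> `|c r' - b| <= `|r' - r|) ->
    c r' @[r' --> within `[0, +oo[ r^'] --> b.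
  move=> cb; apply/cvgrPdist_lt => e e0; apply/half_nearP; exists e => // u u0 _ ue.
  by rewrite distrC; exact: le_lt_trans (cb _ u0) ue.
have xi_ex (r' : R) : exists c : R, 0 <= r' -> [/\ 0 <= c, `|c - (t + r)| <= `|r' - r| &
    phi (t + r') (shift y r') - phi (t + r) (shift y r') = dt c (shift y r') * (r' - r)].
  have [r'0|r'0] := boolP (0 <= r'); last by exists 0.
  have sr' := statespace_shift sy r'0.
  have [c [c0]] := @half_MVT R (fun s => phi s (shift y r')) (fun s => dt s (shift y r'))
     (fun s s0 => phi_t s0 sr') _ _ tr0 (addr_ge0 t0 r'0).
  rewrite (_ : t + r' - (t + r) = r' - r); last by ring.
  by exists c.
have [xi Hxi] := choice xi_ex.
have H1 : dt (xi r') (shift y r') @[r' --> within `[0, +oo[ r^'] --> dt (t + r) (shift y r).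
  apply: (within_cvg_comp (p := (t + r, shift y r)) (u := fun r' => (xi r', shift y r')) cdt) => //.
    apply: (@cvg_pair _ _ _ _ (nbhs (t + r)) (nbhs (shift y r))); last exact: cvg_shift.
    by apply: near_pt => r' r'0; have [] := Hxi _ r'0.
  apply: filterS nr0 => r' r'0; split; first by have [] := Hxi _ r'0.
  exact: statespace_shift.
clear xi_ex; case: y sy sr Hxi H1 => -[|n] x sy sr Hxi H1.
  (* the empty system does not age *)
  rewrite /half_quotient /psi /dx /derive_x /= addr0.
  apply: cvg_trans H1; apply: near_eq_cvg; apply: filterS2 nr0 nrr => r' r'0 r'r.
  have [_ _] := Hxi _ r'0; rewrite /shift /= => ->.
  by rewrite mulfK// subr_eq0.
have x0 : 0 <= x by case: sy.
have n0 : n.+1 <> 0%N by [].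
have xr0 z : 0 <= z -> 0 <= x + z by exact: addr_ge0.
have eta_ex (r' : R) : exists c : R, 0 <= r' -> [/\ 0 <= c, `|c - (x + r)| <= `|r' - r| &
    phi (t + r) (n.+1, x + r') - phi (t + r) (n.+1, x + r) = dx (t + r) (n.+1, c) * (r' - r)].
  have [r'0|r'0] := boolP (0 <= r'); last by exists 0.
  have [c [c0]] := @half_MVT R (fun z => phi (t + r) (n.+1, z)) (fun z => dx (t + r) (n.+1, z))
     (fun z z0 => phi_x tr0 z0 n0) _ _ (xr0 _ r0) (xr0 _ r'0).
  rewrite (_ : x + r' - (x + r) = r' - r); last by ring.
  by exists c.
have [eta Heta] := choice eta_ex.
have H2 : dx (t + r) (n.+1, eta r') @[r' --> within `[0, +oo[ r^'] --> dx (t + r) (n.+1, x + r).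
  apply: (within_cvg_comp (p := (t + r, (n.+1, x + r))) (u := fun r' => (t + r, (n.+1, eta r'))) cdx) => //.
    apply: (@cvg_pair _ _ _ _ (nbhs (t + r)) (nbhs (n.+1, x + r))); first exact: cvg_cst.
    apply: (@cvg_pair _ _ _ _ (nbhs n.+1) (nbhs (x + r))); first exact: cvg_cst.
    by apply: near_pt => r' r'0; have [] := Heta _ r'0.
  by apply: filterS nr0 => r' r'0; split => //; split => //=; have [] := Heta _ r'0.
have H12 : dt (xi r') (shift (n.+1, x) r') + dx (t + r) (n.+1, eta r') @[r' --> within `[0, +oo[ r^'] -->
    psi (t + r) (shift (n.+1, x) r) by exact: cvgD.
rewrite /half_quotient; apply: cvg_trans H12.
apply: near_eq_cvg; apply: filterS2 nr0 nrr => r' r'0 r'r.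
have [_ _ E1] := Hxi _ r'0; have [_ _ E2] := Heta _ r'0.
have r'r0 : r' - r != 0 by rewrite subr_eq0.
rewrite /shift /= in E1 *.
apply: (mulIf r'r0); rewrite divfK// mulrDl -E1 -E2; ring.
Qed.

Lemma continuous_along_flow t y T : 0 <= t -> statespace y ->
  {within `[0, T], continuous (fun r => psi (t + r) (shift y r))}.
Proof.
move=> t0 sy; apply/subspace_continuousP => r /=; rewrite in_itv/= => /andP[r0 _].
have FF : Filter (within `[0, T] (nbhs r)) by exact: within_filter.
have idr : r' @[r' --> within `[0, T] (nbhs r)] --> r by exact: cvg_within.
have pt : (t + r', shift y r') @[r' --> within `[0, T] (nbhs r)] --> (t + r, shift y r).
  apply: (@cvg_pair _ _ _ _ (nbhs (t + r)) (nbhs (shift y r))); last exact: cvg_shift.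
  by apply: cvgD => //; exact: cvg_cst.
have D0 : time_statespace (t + r, shift y r).
  by split; [exact: addr_ge0|exact: statespace_shift].
have Dn : \forall r' \near within `[0, T] (nbhs r), time_statespace (t + r', shift y r').
  apply: filterS (@withinT _ _ _ _) => r' /=; rewrite in_itv/= => /andP[r'0 _].
  by split; [exact: addr_ge0|exact: statespace_shift].
apply: cvgD; [exact: (within_cvg_comp cdt D0 pt Dn)|exact: (within_cvg_comp cdx D0 pt Dn)].
Qed.

Lemma flow_FTC t y z : 0 <= t -> statespace y -> 0 <= z ->
  phi (t + z) (shift y z) - phi t y = \int[mu]_(r in `[0, z]) psi (t + r) (shift y r).
Proof.
move=> t0 sy z0.
have := @half_FTC R (fun r => phi (t + r) (shift y r)) (fun r => psi (t + r) (shift y r))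
  (fun r r0 => flow_half_quotient t0 sy r0) z z0 (continuous_along_flow t0 sy).
by rewrite addr0 shift0.
Qed.

End time_state.
End smooth.

(** * Measurability of smooth functions *)

Section smooth_measurability.
Context {R : realType}.
Notation mu := (@lebesgue_measure R).

Let pos (s : R) : R := if 0 <= s then s else 0.
Let pos_ge0 s : 0 <= pos s. Proof. by rewrite /pos; case: ifP. Qed.
Let posE s : 0 <= s -> pos s = s. Proof. by rewrite /pos => ->. Qed.
Let mpos : measurable_fun setT pos.
Proof. by apply: measurable_fun_ifT => //; apply: measurable_fun_ler. Qed.

(** The idle state has no age to discretize. *)
Let state_point (k i n j : nat) : R * (nat * R) :=
  (grid_point k i, (n, if n == 0%N then 0 else grid_point k j)).

Let state_grid (k : nat) (p : R * (nat * R)) : R * (nat * R) :=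
  state_point k (grid_index k (pos p.1)) p.2.1 (grid_index k (pos p.2.2)).

Lemma measurable_time_statespace : measurable (@time_statespace R).
Proof.
rewrite (_ : time_statespace = (setT `&` fst @^-1` `[0, +oo[) `&` (setT `&` snd @^-1` statespace)).
  by apply: measurableI; [exact: measurable_fst|apply: measurable_snd => //; exact: measurable_statespace].
by apply/seteqP; split=> -[t y] /=; rewrite /time_statespace/= in_itv/= andbT => -[]; [|case=> _ + []].
Qed.

Lemma state_grid_time_statespace k p : time_statespace p -> time_statespace (state_grid k p).
Proof.
case: p => t [n x] [/= t0 [/= x0 nx]]; split; first exact: grid_point_ge0.
by split => /=; case: eqP => // n0; exact: grid_point_ge0.
Qed.

Lemma cvg_state_grid p : time_statespace p -> state_grid k p @[k --> \oo] --> p.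
Proof.
case: p => t [n x] [/= t0 [/= x0 nx]].
apply: (@cvg_pair _ _ _ _ (nbhs t) (nbhs (n, x))).
  by have := cvg_grid t0; rewrite /grid -{1}(posE t0).
apply: (@cvg_pair _ _ _ _ (nbhs n) (nbhs x)); first exact: cvg_cst.
have [n0|n0] := eqVneq n 0%N; first by rewrite nx//; exact: cvg_cst.
by have := cvg_grid x0; rewrite /grid -{1}(posE x0).
Qed.

(** A function that is the limit of its values on the grid is a limit of functions taking
    countably many values. *)
Lemma measurable_on_grid (f : R * (nat * R) -> R) :
  (forall p, time_statespace p -> f (state_grid k p) @[k --> \oo] --> f p) ->
  measurable_fun time_statespace f.
Proof.
move=> cf; apply: (@measurable_fun_cvg _ _ _ _ (fun k p => f (state_grid k p))) => // k.
apply: measurable_funTS.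
apply: (@measurable_fun_nat_cases _ _ (fun p : R * (nat * R) => grid_index k (pos p.1)) _ _
  (fun i p => f (state_point k i p.2.1 (grid_index k (pos p.2.2))))) => [|i].
  by apply: measurable_grid_index => //; exact: measurableT_comp.
apply: (@measurable_fun_nat_cases _ _ (fun p : R * (nat * R) => p.2.1) _ _
  (fun n p => f (state_point k i n (grid_index k (pos p.2.2))))) => [n|n].
  rewrite -[X in measurable X]setTI; apply: (measurableT_comp measurable_fst measurable_snd) => //.
apply: (@measurable_fun_nat_cases _ _ (fun p : R * (nat * R) => grid_index k (pos p.2.2)) _ _
  (fun j p => f (state_point k i n j))) => // .
apply: measurable_grid_index => //; apply: measurableT_comp => //.
exact: (measurableT_comp measurable_snd measurable_snd).
Qed.

Lemma continuous_measurable_time_state (f : R * (nat * R) -> R) :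
  {within time_statespace, continuous f} -> measurable_fun time_statespace f.
Proof.
move=> cf; apply: measurable_on_grid => p Dp.
apply: (within_cvg_comp cf Dp (cvg_state_grid Dp)).
by apply: nearW => k; exact: state_grid_time_statespace.
Qed.

Lemma bounded_bound {T : Type} (f : T -> R) (D : set T) : [bounded f p | p in D] ->
  exists2 K, 0 <= K & forall p, D p -> `|f p| <= K.
Proof.
move=> [M [_ HM]]; exists (`|M| + 1); first by rewrite addr_ge0.
apply: HM; apply: le_lt_trans (ler_norm M) _; by rewrite ltrDl.
Qed.

Section time_state.
Variable phi : R -> nat * R -> R.
Hypothesis phi_smooth : C1b_time phi.

Let phi_t t y : 0 <= t -> statespace y -> half_quotient (fun s => phi s y) t --> derive_t phi t y.
Proof. by case: phi_smooth => _ + _ _ t0 sy => /(_ t y t0 sy)[]. Qed.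

Let phi_x t n x : 0 <= t -> 0 <= x -> n <> 0%N ->
  half_quotient (fun z => phi t (n, z)) x --> derive_x (phi t) (n, x).
Proof.
move=> t0 x0 n0; have sy : statespace (n, x) by split.
case: phi_smooth => _ /(_ t (n, x) t0 sy)[_ /(_ n0)] + _ _.
by rewrite /derive_x /=; move: n0 => /eqP/negbTE ->.
Qed.

Lemma smooth_measurable : measurable_fun time_statespace (fun p => phi p.1 p.2).
Proof.
have [K K0 HK] : exists2 K, 0 <= K & forall p, time_statespace p -> `|derive_t phi p.1 p.2| <= K.
  by case: phi_smooth => _ _ _ [/bounded_bound].
apply: measurable_on_grid => -[t [n x]] Dp; have [t0 [/= x0 nx]] := Dp; rewrite /= in t0.
set p := (t, (n, x)).
have cp := cvg_state_grid Dp.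
have -> : (fun k => phi (state_grid k p).1 (state_grid k p).2) =
    (fun k => (phi (state_grid k p).1 (state_grid k p).2 - phi t (state_grid k p).2) + phi t (state_grid k p).2).
  by apply/funext => k; rewrite subrK.
rewrite -[X in _ --> X]add0r; apply: cvgD; last first.
  have [n0|n0] := eqVneq n 0%N.
    by apply: cvg_near_cst; apply: nearW => k; rewrite /state_grid /= n0 /= nx.
  have H := half_quotient_cvg (F := \oo) (u := fun k => (state_grid k p).2.2) (phi_x t0 x0 (elimN eqP n0)).
  apply: H.
    exact: (cvg_comp _ _ (cvg_comp _ _ cp cvg_snd) cvg_snd).
  by apply: nearW => k; have [_ []] := state_grid_time_statespace k Dp.
have ct : (state_grid k p).1 - t @[k --> \oo] --> 0.
  by rewrite -[X in _ --> X](subrr t); apply: cvgB; [exact: (cvg_comp _ _ cp cvg_fst)|exact: cvg_cst].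
have ct' : K * `|(state_grid k p).1 - t| @[k --> \oo] --> 0.
  rewrite -[X in _ --> X](mulr0 K); apply: cvgM; first exact: cvg_cst.
  rewrite -[X in _ --> X](normr0 R).
  exact: cvg_norm.
have ctN : - (K * `|(state_grid k p).1 - t|) @[k --> \oo] --> 0.
  by rewrite -[X in _ --> X]oppr0; exact: cvgN.
apply: (squeeze_cvgr _ ctN ct'); apply: nearW => k.
rewrite -ler_norml.
have [g0 gs] := state_grid_time_statespace k Dp.
have [c [c0 _ ->]] := @half_MVT R (fun s => phi s (state_grid k p).2) (fun s => derive_t phi s (state_grid k p).2)
  (fun s s0 => phi_t s0 gs) _ _ t0 g0.
by rewrite normrM ler_wpM2r// (HK (c, (state_grid k p).2)).
Qed.

End time_state.
End smooth_measurability.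

(** * Smooth functions along the queue *)

Section dynkin_smooth.
Context {R : realType}.
Notation mu := (@lebesgue_measure R).
Variables (lam h : nat * R -> R) (C : R).
Hypotheses (Il : bounded_intensity C lam) (Ih : bounded_intensity C h).
Let lam_meas := intensity_meas Il. Let h_meas := intensity_meas Ih.
Let lam_ge0 := intensity_ge0 Il. Let h_ge0 := intensity_ge0 Ih.
Let lam_le := intensity_le Il. Let h_le := intensity_le Ih.
Context {d : measure_display} {Omega : measurableType d}.
Variables (P : nat * R -> probability Omega R) (X : R -> Omega -> nat * R).
Hypothesis X_queue : queue_process lam h P X.
Variable x : nat * R.
Hypothesis sx : statespace x.

Lemma dynkin_smooth (phi : R -> nat * R -> R) (T : R) : C1b_time phi -> 0 <= T ->
  ('E_(P x)[fun w => phi T (X T w)] - (phi 0 x)%:E =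
   'E_(P x)[fun w => (\int[mu]_(s in `[0, T])
     (derive_t phi s (X s w) + generator lam h (phi s) (X s w)))%R])%E.
Proof.
move=> phi_smooth T0.
have [/bounded_bound[M M0 HM] _ [cdt cdx] [/bounded_bound[K1 K10 HK1] /bounded_bound[K2 K20 HK2]]] := phi_smooth.
have mD := @measurable_time_statespace R.
pose cut (f : R -> nat * R -> R) t y := ((fun p => f p.1 p.2) \_ time_statespace) (t, y).
have cutE f t y : 0 <= t -> statespace y -> cut f t y = f t y.
  by move=> t0 sy; rewrite /cut patchE mem_set.
have cut_le f B : 0 <= B -> (forall p, time_statespace p -> `|f p.1 p.2| <= B) -> forall t y, `|cut f t y| <= B.
  by move=> B0 fB t y; rewrite /cut patchE; case: ifPn => [/set_mem /fB//|_]; rewrite normr0.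
have mcut f : measurable_fun time_statespace (fun p => f p.1 p.2) ->
    measurable_fun setT (fun p : R * (nat * R) => cut f p.1 p.2).
  move=> mf; rewrite (_ : (fun _ => _) = (fun p => f p.1 p.2) \_ time_statespace).
    exact/(measurable_restrictT _ mD).
  by apply/funext => -[].
pose psi0 t y := derive_t phi t y + derive_x (phi t) y.
pose psi := cut psi0.
have mphi := mcut _ (smooth_measurable phi_smooth).
have mpsi : measurable_fun setT (fun p : R * (nat * R) => psi p.1 p.2).
  by apply: mcut; apply: measurable_funD; apply: continuous_measurable_time_state.
have phiM := cut_le phi M M0 HM.
have psiK : forall t y, `|psi t y| <= K1 + K2.
  apply: cut_le; first exact: addr_ge0.
  by move=> p Dp; apply: le_trans (ler_normD _ _) _; apply: lerD; [exact: HK1|exact: HK2].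
have flow t y z : 0 <= t -> statespace y -> 0 <= z ->
    cut phi (t + z) (shift y z) - cut phi t y = \int[mu]_(r in `[0, z]) psi (t + r) (shift y r).
  move=> t0 sy z0; have tz0 : 0 <= t + z by exact: addr_ge0.
  rewrite !cutE//; last exact: statespace_shift.
  rewrite (flow_FTC phi_smooth t0 sy z0).
  apply: eq_Rintegral => r; rewrite inE/= in_itv/= => /andP[r0 _].
  by rewrite /psi cutE//; [exact: addr_ge0|exact: statespace_shift].
have Xsp t w : 0 <= t -> statespace (X t w) by move=> t0; exact: (queue_statespace X_queue).
have := dynkin_expectation Il Ih X_queue sx mphi mpsi phiM psiK flow T0.
rewrite unlock (cutE phi 0 x (lexx 0) sx) => E.
have <- : (\int[P x]_w (cut phi T (X T w))%:E = \int[P x]_w (phi T (X T w))%:E)%E.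
  by apply: eq_integral => w _; rewrite cutE//; exact: Xsp.
rewrite E; apply: eq_integral => w _; congr EFin.
apply: eq_Rintegral => s; rewrite inE/= in_itv/= => /andP[s0 _].
have sXs := Xsp s w s0.
have su := statespace_up sXs; have sd := @statespace_down R (X s w).
rewrite /drift /psi (cutE phi s _ s0 su) (cutE phi s _ s0 sd) (cutE phi s _ s0 sXs) (cutE psi0 s _ s0 sXs).
by rewrite /psi0 /generator -!addrA.
Qed.

End dynkin_smooth.

Section time_independent.
Context {R : realType}.

Lemma half_quotient_cst (c t : R) : half_quotient (cst c) t --> 0.
Proof.
rewrite /half_quotient /cst; apply: cvg_near_cst.
by apply: nearW => u; rewrite subrr mul0r.
Qed.

Lemma derive_t_cst (f : nat * R -> R) t y : 0 <= t -> derive_t (fun=> f) t y = 0.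
Proof. by move=> t0; apply: half_deriveE => //; exact: half_quotient_cst. Qed.

Lemma C1b_time_cst (f : nat * R -> R) : C1b f -> C1b_time (fun=> f).
Proof.
move=> [/bounded_bound[M M0 HM] df cdf /bounded_bound[K K0 HK]].
have bnd (g : R * (nat * R) -> R) B : (forall p, time_statespace p -> `|g p| <= B) ->
    [bounded g p | p in time_statespace].
  move=> gB; exists B; split; first by rewrite num_real.
  by move=> N BN p /gB /le_trans; apply; exact: ltW.
split.
- by apply: (bnd _ M) => -[t y] [_ /HM].
- move=> t y t0 sy; split; last exact: df.
  by apply/cvg_ex; exists 0; exact: half_quotient_cst.
- split.
    apply/subspace_continuousP => -[t y] Dp.
    have H : derive_t (fun=> f) p.1 p.2 @[p --> within time_statespace (nbhs (t, y))] -->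
        derive_t (fun=> f) t y.
      rewrite derive_t_cst; last by case: Dp.
      apply: cvg_near_cst; apply: filterS (@withinT _ _ _ _) => -[t' y'] [t'0 _].
      by rewrite /= derive_t_cst.
    exact: H.
  apply/subspace_continuousP => -[t y] Dp.
  have FF : Filter (within time_statespace (nbhs (t, y))) by exact: within_filter.
  apply: (within_cvg_comp (p := y) (u := fun p : R * (nat * R) => p.2) cdf); first by case: Dp.
    by apply: cvg_within_filter; exact: cvg_snd.
  by apply: filterS (@withinT _ _ _ _) => -[t' y'] [].
- split; last by apply: (bnd _ K) => -[t y] [_ /HK].
  by apply: (bnd _ 0) => -[t y] [t0 _]; rewrite derive_t_cst ?normr0.
Qed.

End time_independent.

(** * Intensities outside the state space *)

Section extension.
Context {R : realType}.
Notation mu := (@lebesgue_measure R).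

(** A waiting-time law depends on the intensity along the flow only. *)
Lemma wait_law_ext (g g' : nat * R -> R) y A : {in statespace, g =1 g'} -> statespace y ->
  wait_law g y A = wait_law g' y A.
Proof.
move=> gg' sy.
have e z : 0 <= z -> g (shift y z) = g' (shift y z).
  by move=> z0; apply: gg'; apply: mem_set; exact: statespace_shift.
have de z : 0 <= z -> wait_density g y z = wait_density g' y z.
  move=> z0; rewrite /wait_density e//; congr (_ * expR (- _)).
  by apply: eq_Rintegral => s; rewrite inE/= in_itv/= => /andP[s0 _]; exact: e.
have E1 : (\int[mu]_(z in `[0%R, +oo[ `&` [set z : R | A z%:E]) (wait_density g y z)%:E =
    \int[mu]_(z in `[0%R, +oo[ `&` [set z : R | A z%:E]) (wait_density g' y z)%:E)%E.
  by apply: eq_integral => z; rewrite inE/= => -[]; rewrite in_itv/= andbT => z0 _; rewrite de.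
have E2 : (\int[mu]_(z in `[0%R, +oo[) (wait_density g y z)%:E =
    \int[mu]_(z in `[0%R, +oo[) (wait_density g' y z)%:E)%E.
  by apply: eq_integral => z; rewrite inE/= in_itv/= andbT => z0; rewrite de.
by rewrite /wait_law E1 E2.
Qed.

(** The waiting times are drawn from the states of the jump chain, which are in the state space. *)
Lemma queue_process_ext (lam h lam' h' : nat * R -> R) {d : measure_display} {Omega : measurableType d}
  (P : nat * R -> probability Omega R) (X : R -> Omega -> nat * R) :
  {in statespace, lam =1 lam'} -> {in statespace, h =1 h'} ->
  queue_process lam h P X -> queue_process lam' h' P X.
Proof.
move=> el eh [mX Xs Xr Xl Xc]; split; [exact: mX|exact: Xs|exact: Xr|exact: Xl|] => x sx.
have [U [V [mUV UV0 law XP]]] := Xc x sx; exists U, V; split; [exact: mUV|exact: UV0| |exact: XP] => k A B mA mB.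
rewrite (_ : (fun w => _) = (fun w => let y := jump_state x (U ^~ w) (V ^~ w) k in
  wait_law lam y A * wait_law h y B)%E); first exact: law.
apply/funext => w.
have sy : statespace (jump_state x (U ^~ w) (V ^~ w) k).
  by apply: statespace_jump_state => // j; have [] := UV0 j w.
by rewrite /= (wait_law_ext A el sy) (wait_law_ext B eh sy).
Qed.

End extension.

Theorem theorem1 (R : realType) (lam h : nat * R -> R)
    (lam_meas : measurable_fun statespace lam)
    (h_meas : measurable_fun statespace h)
    (lam_ge0 : forall y, statespace y -> 0 <= lam y)
    (h_ge0 : forall y, statespace y -> 0 <= h y)
    (lam_bounded : [bounded lam y | y in statespace])
    (h_bounded : [bounded h y | y in statespace])
    (h_idle : h (0%N, 0) = 0)
    (d : measure_display) (Omega : measurableType d)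
    (P : nat * R -> probability Omega R) (X : R -> Omega -> nat * R)
    (X_queue : queue_process lam h P X) :
  [/\ forall (x : nat * R) (t : R) (f : nat * R -> R),
        statespace x -> 0 < t -> C1b f ->
        ('E_(P x)[fun w => f (X t w)] - (f x)%:E =
         'E_(P x)[fun w =>
           (\int[lebesgue_measure]_(s in `[0, t])
              generator lam h f (X s w))%R])%E,
      forall (x : nat * R) (t : R) (phi : R -> nat * R -> R),
        statespace x -> 0 < t -> C1b_time phi ->
        ('E_(P x)[fun w => phi t (X t w)] - (phi 0 x)%:E =
         'E_(P x)[fun w =>
           (\int[lebesgue_measure]_(s in `[0, t])
              (derive_t phi s (X s w) + generator lam h (phi s) (X s w)))%R])%E
    & strong_markov P X].
Proof.
have mS := @measurable_statespace R.
pose ext (g : nat * R -> R) : nat * R -> R := g \_ statespace.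
have extE g : {in statespace, g =1 ext g} by move=> y sy; rewrite /ext patchE sy.
have [L L0 lamL] := bounded_bound lam_bounded; have [H H0 hH] := bounded_bound h_bounded.
have extI (g : nat * R -> R) (B : R) : measurable_fun statespace g -> (forall y, statespace y -> 0 <= g y) ->
    B <= L + H -> (forall y, statespace y -> `|g y| <= B) -> bounded_intensity (L + H) (ext g).
  move=> mg g0 BC gB; split=> [|y|y]; first exact/(measurable_restrictT _ mS).
    by rewrite /ext patchE; case: ifPn => // /set_mem /g0.
  rewrite /ext patchE; case: ifPn => [/set_mem sy|_]; last exact: addr_ge0.
  exact: le_trans (ler_norm _) (le_trans (gB _ sy) BC).
have Il := extI lam L lam_meas lam_ge0 (ler_wpDr H0 (lexx L)) lamL.
have Ih := extI h H h_meas h_ge0 (ler_wpDl L0 (lexx H)) hH.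
have Xq := queue_process_ext (extE lam) (extE h) X_queue.
have dyn x t phi : statespace x -> 0 < t -> C1b_time phi ->
    ('E_(P x)[fun w => phi t (X t w)] - (phi 0 x)%:E =
     'E_(P x)[fun w => (\int[lebesgue_measure]_(s in `[0, t])
       (derive_t phi s (X s w) + generator lam h (phi s) (X s w)))%R])%E.
  move=> sx t0 phi_smooth.
  rewrite (dynkin_smooth Il Ih Xq sx phi_smooth (ltW t0)).
  rewrite unlock; apply: eq_integral => w _; congr EFin.
  apply: eq_Rintegral => s; rewrite inE/= in_itv/= => /andP[s0 _].
  have sX : X s w \in statespace by apply: mem_set; exact: (queue_statespace Xq).
  by rewrite /generator -(extE lam _ sX) -(extE h _ sX).
split=> //; last first.
  exact: (queue_strong_markov Il Ih Xq).
move=> x t f sx t0 /C1b_time_cst f_smooth.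
rewrite (dyn x t (fun=> f) sx t0 f_smooth) unlock; apply: eq_integral => w _; congr EFin.
apply: eq_Rintegral => s; rewrite inE/= in_itv/= => /andP[s0 _].
by rewrite derive_t_cst// add0r.
Qed.
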